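(* Consider the setting described in the context, assume A1–A5, and let $s=\frac{r}{2-4r}$. A sequence $f_n$ with $cn^{-r}\le\|f_n\|\le Cn^{-r}$ (constants $0<c<C$) is purely $n^{-r}$-consistent if and only if for every $\varepsilon>0$ there are $P_\varepsilon>0$ and a sequence $f_{1n}\in\bar{\mathbb{B}}^s_{2\infty}(P_\varepsilon)$ such that $\|f_n-f_{1n}\|\le\varepsilon n^{-r}$ and $\|f_n\|^2=\|f_{1n}\|^2+\|f_n-f_{1n}\|^2$.
   Context: Fix $\sigma>0$, $0<r<1/2$ and an orthonormal basis $(\phi_j)_{j\ge1}$ of $\mathbb{L}_2(0,1)$. For each $n$ one observes $dY_n(t)=f(t)\,dt+\sigma n^{-1/2}dw(t)$, equivalently $y_j=\theta_j+\sigma n^{-1/2}\xi_j$, $\theta_j=\int_0^1f\phi_j$, $\xi_j$ i.i.d. $N(0,1)$; $H_0:f=0$. Weights $\kappa_{nj}^2\ge0$, $\rho_n=\sum_j\kappa_{nj}^2$, $T_n(Y_n)=\sum_j\kappa_{nj}^2y_j^2-\sigma^2n^{-1}\rho_n$, $k_n=\sup\{k:\sum_{j<k}\kappa_{nj}^2\le\rho_n/2\}$, $\kappa_n^2=\kappa_{nk_n}^2$. Assumptions: (A1) $j\mapsto\kappa_{nj}^2$ decreasing; (A2) $C_1<\sigma^{-4}n^2\sum_j\kappa_{nj}^4<C_2$; (A3) $c_1n^{-2r}\le\rho_n\le c_2n^{-2r}$; (A4) $\exists C_1>0,\lambda>1$: $\kappa^2_{n,[(1+\delta)k_n]}<C_1(1+\delta)^{-\lambda}\kappa_n^2$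 for all $\delta>0,n$; (A5) $\kappa_{n1}^2\asymp\kappa_n^2$ and for each $c>1$ there is $C>0$ with $\kappa^2_{n,[ck_n]}\ge C\kappa_n^2$. A test generated by $T_n$ rejects $H_0$ iff $T_n$ exceeds a threshold. A (sub)sequence $f_{n_i}$ is consistent if for every $\alpha\in(0,1)$ and every sequence of tests $K_{n_i}$ generated by $T_{n_i}$ with $\alpha(K_{n_i})=\alpha(1+o(1))$, $\limsup_i\beta(K_{n_i},f_{n_i})<1-\alpha$; inconsistent if for every sequence of such tests (any level) $\liminf_i(\alpha(K_{n_i})+\beta(K_{n_i},f_{n_i}))\ge1$. $f_n$ is $n^{-r}$-consistent if consistent with $cn^{-r}<\|f_n\|<Cn^{-r}$ for some $0<c<C$; it is purely $n^{-r}$-consistent if there is no subsequence with $f_{n_i}=f_{1n_i}+f_{2n_i}$, $f_{2n_i}\perp f_{1n_i}$, $\|f_{2n_i}\|>c_1n_i^{-r}$ for some $c_1>0$, and $f_{2n_i}$ inconsistent. $\bar{\mathbb{B}}^s_{2\infty}(P_0)=\{f=\sum_j\theta_j\phi_j:\ \sup_{\lambda>0}\lambda^{2s}\sum_{j>\lambda}\theta_j^2\le P_0\}$. *)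

(* Defs.v *)
From HB Require Import structures.
From mathcomp Require Import all_boot all_order all_algebra finmap.
From mathcomp Require Import all_classical all_reals all_analysis.
Set Implicit Arguments. Unset Strict Implicit. Unset Printing Implicit Defensive.
Import Order.TTheory GRing.Theory Num.Theory.
Import numFieldNormedType.Exports.
Local Open Scope classical_set_scope.
Local Open Scope ring_scope.

(* Conventions:
   - the paper's sample size n (>= 1) is the Rocq index n with sample size n.+1;
   - the paper's coordinate index j (>= 1) is the Rocq index j-1 (0-based);
   - a function f in L2(0,1) is represented by its coefficient sequence
     theta : nat -> R in the fixed orthonormal basis (phi_j);
   - kap n j is the weight kappa^2_{n,j+1}. *)

Section Defs.
Context {R : realType}.

Definition Nn (n : nat) : R := n.+1%:R.

Definition sqn (th : nat -> R) : \bar R := (\sum_(j <oo) ((th j) ^+ 2)%:E)%E.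

Definition ip (th et : nat -> R) : R := \big[+%R/0%R]_(j <oo) (th j * et j).

Definition rho (kap : nat -> nat -> R) (n : nat) : \bar R :=
  (\sum_(j <oo) (kap n j)%:E)%E.

Definition kn_cond (kap : nat -> nat -> R) (n k : nat) : Prop :=
  ((\sum_(i < k.-1) kap n i)%:E <= rho kap n * (2^-1)%:E)%E.
Definition is_kn (kap : nat -> nat -> R) (n k : nat) : Prop :=
  (0 < k)%N /\ kn_cond kap n k /\ (forall k', kn_cond kap n k' -> (k' <= k)%N).

Definition weights_nonneg (kap : nat -> nat -> R) : Prop :=
  forall n j, 0 <= kap n j.

Definition A1 (kap : nat -> nat -> R) : Prop :=
  forall n i j, (i <= j)%N -> kap n j <= kap n i.

Definition A2 (sigma : R) (kap : nat -> nat -> R) : Prop :=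
  exists C1 C2 : R, 0 < C1 /\ forall n,
    (C1%:E < (sigma ^- 4 * Nn n ^+ 2)%:E * \sum_(j <oo) ((kap n j) ^+ 2)%:E
     < C2%:E)%E.

Definition A3 (r : R) (kap : nat -> nat -> R) : Prop :=
  exists c1 c2 : R, 0 < c1 /\ forall n,
    ((c1 * Nn n `^ (- (2 * r)))%:E <= rho kap n
      <= (c2 * Nn n `^ (- (2 * r)))%:E)%E.

Definition A4 (kap : nat -> nat -> R) : Prop :=
  exists C1 lam : R, 0 < C1 /\ 1 < lam /\
    forall (delta : R) (n k : nat), 0 < delta -> is_kn kap n k ->
      kap n (Num.truncn ((1 + delta) * k%:R)).-1
        < C1 * (1 + delta) `^ (- lam) * kap n k.-1.

Definition A5 (kap : nat -> nat -> R) : Prop :=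
  (exists c C : R, 0 < c /\ 0 < C /\ forall n k, is_kn kap n k ->
      c * kap n k.-1 <= kap n 0 <= C * kap n k.-1) /\
  (forall c : R, 1 < c -> exists C : R, 0 < C /\ forall n k, is_kn kap n k ->
      C * kap n k.-1 <= kap n (Num.truncn (c * k%:R)).-1).

Definition besov (s P0 : R) (th : nat -> R) : Prop :=
  forall lam : R, 0 < lam ->
    ((lam `^ (2 * s))%:E * \sum_(j <oo | (lam < j.+1%:R)%R) ((th j) ^+ 2)%:E
       <= P0%:E)%E.

Section Prob.
Context {d : measure_display} {Omega : measurableType d}.
Variable (P : probability Omega R).

Definition iid_std_normal (xi : nat -> Omega -> R) : Prop :=
  (forall j, measurable_fun setT (xi j)) /\
  (forall j (B : set R), measurable B -> P (xi j @^-1` B) = normal_prob 0 1 B) /\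
  (forall (J : {fset nat}) (B : nat -> set R), (forall j, measurable (B j)) ->
     P (\bigcap_(j in [set` J]) (xi j @^-1` B j))
     = (\prod_(j <- J) P (xi j @^-1` B j))%E).

Variables (xi : nat -> Omega -> R) (sigma : R) (kap : nat -> nat -> R).

(* T_n(Y_n) with y_j = theta_j + sigma n^{-1/2} xi_j *)
Definition Tstat (n : nat) (th : nat -> R) (w : Omega) : \bar R :=
  (\sum_(j <oo) (kap n j * (th j + sigma / Num.sqrt (Nn n) * xi j w) ^+ 2)%:E
   - (sigma ^+ 2 / Nn n)%:E * rho kap n)%E.

Definition alpha (n : nat) (t : R) : \bar R :=
  P [set w | (t%:E < Tstat n (fun=> 0%R) w)%E].
Definition beta (n : nat) (t : R) (th : nat -> R) : \bar R :=
  P [set w | (Tstat n th w <= t%:E)%E].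

Definition consistent (ns : nat -> nat) (g : nat -> nat -> R) : Prop :=
  forall a : R, 0 < a < 1 -> forall t : nat -> R,
    (fun i => alpha (ns i) (t i)) @ \oo --> a%:E ->
    (limn_esup (fun i => beta (ns i) (t i) (g i)) < (1 - a)%:E)%E.

Definition inconsistent (ns : nat -> nat) (g : nat -> nat -> R) : Prop :=
  forall t : nat -> R,
    (1 <= limn_einf (fun i => alpha (ns i) (t i) + beta (ns i) (t i) (g i)))%E.

Variable r : R.

Definition nr_consistent (f : nat -> nat -> R) : Prop :=
  consistent id f /\
  exists c C : R, 0 < c /\ c < C /\ forall n,
    (((c * Nn n `^ (- r)) ^+ 2)%:E < sqn (f n)
       < ((C * Nn n `^ (- r)) ^+ 2)%:E)%E.

Definition purely_nr_consistent (f : nat -> nat -> R) : Prop :=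
  nr_consistent f /\
  ~ (exists (ns : nat -> nat) (f1 f2 : nat -> nat -> R) (c1 : R),
       (forall i, (ns i < ns i.+1)%N) /\ 0 < c1 /\
       (forall i,
          (forall j, f (ns i) j = f1 i j + f2 i j) /\
          (sqn (f1 i) < +oo)%E /\ (sqn (f2 i) < +oo)%E /\
          ip (f2 i) (f1 i) = 0 /\
          (((c1 * Nn (ns i) `^ (- r)) ^+ 2)%:E < sqn (f2 i))%E) /\
       inconsistent ns f2).

End Prob.
End Defs.

(* Main.v *)
Require Import Defs.
From HB Require Import structures.
From mathcomp Require Import all_boot all_order all_algebra finmap.
From mathcomp Require Import all_classical all_reals all_analysis.
From mathcomp Require Import measurable_realfun normal_distribution.
From mathcomp Require Import ring lra.
Set Implicit Arguments. Unset Strict Implicit. Unset Printing Implicit Defensive.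
Import Order.TTheory GRing.Theory Num.Theory.
Import numFieldNormedType.Exports.
Local Open Scope classical_set_scope.
Local Open Scope ring_scope.

(**
A1-A3 and A5 force [k_n ~ N^(2-4r)] and [kappa_n^2 ~ N^(2r-2)], so that on the
scale [N^-2] the statistic is a centred weighted chi-square sum [S] plus the
energy [A = sum_j kappa_nj^2 theta_j^2] plus a Gaussian cross term of variance
[O(N^(2r-1))]. A sequence is therefore consistent when [N^2 A] stays away from
[0] and inconsistent iff [N^2 A -> 0], provided the law of [S] neither
concentrates on short intervals nor leaves gaps between its quantiles.

Both facts are obtained without a central limit theorem. Dividing the first
[k_n] squares [xi_j^2] by [1 + y] with [y = O(k_n^(-1/2))] moves [S] by an amount of
order one, while the likelihood ratio of the scaled Gaussian vector has second
moment at most [exp (k_n y^2 / 2)]. Small scalings hence barely change the law but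
carry an interval through many disjoint ones (no concentration), and scaling
down from [{S > s}] in small steps must hit every interval below [s] (no gaps).

With A4 and A5, [N^2 A(f) -> 0] means that [f] keeps [o(N^-r)] of its norm on
[j <= D k_n] for every [D]. Since [k_n^(-2s) ~ N^(-2r)], pure consistency and the
Besov approximation both say that the part of [f_n] beyond [D k_n] is uniformly
small compared with [N^-r] as [D] grows.
*)

(** * Integration against Gaussian families *)

(** Scalings are used as perturbations because their likelihood ratio is explicit: one scaled
    coordinate contributes a second moment [(1 + y) / sqrt (1 + 2 y) <= exp (y^2 / 2)]. The cost of
    scaling [k] coordinates is thus bounded as long as [k y^2] is, and since the first [k] weights
    are of order [k^(-1/2)] on the scale [N^-2], this same range of [y] moves the sum by order one.
    Likelihood ratios are computed on finite vectors, hence the estimates are proved for partial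
    sums, with bounds free of the number [m] of terms, and then carried to the series.

    A decomposition [f = f1 + f2] that purity has to exclude is orthogonal but need not be aligned
    with the coordinates, so [f2] cannot be compared directly with a tail of [f]. The comparison
    goes through [<f, f2> = |f2|^2]: inconsistency makes [f2] small on the first [D k_n]
    coordinates, the Besov approximation makes [f] small on the others, and the inner product
    becomes too small for the assumed norm of [f2]. *)

Section transfer.
Local Open Scope ereal_scope.
Context d1 d2 d (T1 : measurableType d1) (T2 : measurableType d2)
  (S : measurableType d) (R : realType).
Variables (mu1 : {measure set T1 -> \bar R}) (mu2 : {measure set T2 -> \bar R}).
Import HBNNSimple.

(** The usual passage from indicators to simple functions to monotone limits, done once for three
    uses: the change of variable for Lebesgue measure, expectation under a density ([Y] is the
    density), and splitting one independent factor off a product ([Y] is the product of the others,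
    [K] its expectation). *)
Lemma ge0_integral_transfer (Y : T1 -> R) (X1 : T1 -> S) (X2 : T2 -> S) (K : R) :
  (forall x, 0 <= Y x)%R -> measurable_fun setT Y ->
  measurable_fun setT X1 -> measurable_fun setT X2 -> (0 <= K)%R ->
  (forall B, measurable B ->
    \int[mu1]_x (Y x * \1_B (X1 x))%:E = K%:E * mu2 (X2 @^-1` B)) ->
  forall g : S -> R, measurable_fun setT g -> (forall x, 0 <= g x)%R ->
  \int[mu1]_x (Y x * g (X1 x))%:E = K%:E * \int[mu2]_x (g (X2 x))%:E.
Proof.
move=> Y0 mY mX1 mX2 K0 H g mg g0.
have mgE : measurable_fun setT (fun x => (g x)%:E) by exact/measurable_EFinP.
have simple (h : {nnsfun S >-> R}) :
    \int[mu1]_x (Y x * h (X1 x))%:E = K%:E * \int[mu2]_x (h (X2 x))%:E.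
  have mh k : measurable (h @^-1` [set k]).
    by rewrite -(setTI (_ @^-1` _)); exact: measurable_funP.
  have m1 k : measurable_fun setT (fun x => (Y x * \1_(h @^-1` [set k]) (X1 x))%R).
    apply: measurable_funM => //; apply: (measurableT_comp _ mX1).
    exact: measurable_indic.
  have m2 k : measurable_fun setT (fun x => (\1_(h @^-1` [set k]) (X2 x) : R)).
    by apply: (measurableT_comp _ mX2); exact: measurable_indic.
  transitivity (\sum_(k \in range h)
      \int[mu1]_x (k%:E * (Y x * \1_(h @^-1` [set k]) (X1 x))%:E)).
    rewrite -ge0_integral_fsum//.
    - apply: eq_integral => x _; rewrite fimfunE mulrC EFinM -fsumEFin//.
      rewrite muleC ge0_mule_fsumr; last by move=> i; exact: nnfun_muleindic_ge0.
      by apply: eq_fsbigr => k _; rewrite -!EFinM mulrCA.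
    - by move=> k; exact/measurable_EFinP/measurable_funM.
    - move=> k x _; rewrite -EFinM mulrCA EFinM mule_ge0 ?lee_fin//.
      exact: nnfun_muleindic_ge0.
  transitivity (K%:E * \sum_(k \in range h)
      \int[mu2]_x (k%:E * (\1_(h @^-1` [set k]) (X2 x))%:E)); last first.
    rewrite -ge0_integral_fsum//.
    - congr *%E; apply: eq_integral => x _; rewrite fimfunE -fsumEFin//.
    - by move=> k; exact/measurable_EFinP/measurable_funM.
    - by move=> k x _; exact: nnfun_muleindic_ge0.
  rewrite ge0_mule_fsumr; last first.
    by move=> k; apply: integral_ge0 => x _; exact: nnfun_muleindic_ge0.
  apply: eq_fsbigr => k /[!inE] -[x0 _ kE].
  have k0 : (0 <= k)%R by rewrite -kE.
  rewrite ge0_integralZl_EFin//; last 2 first.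
  - by move=> x _; rewrite lee_fin mulr_ge0.
  - exact/measurable_EFinP.
  rewrite H// ge0_integralZl_EFin//; last exact/measurable_EFinP.
  rewrite muleCA; congr (_ * (_ * _)).
  rewrite -[RHS]/(\int[mu2]_x (\1_(X2 @^-1` (h @^-1` [set k])) x)%:E).
  by rewrite integral_indic ?setIT// -(setTI (X2 @^-1` _)); exact: mX2.
pose f_ := nnsfun_approx measurableT mgE.
have f_cvg y : (EFin \o f_ ^~ y) n @[n --> \oo] --> (g y)%:E.
  by apply: (@cvg_nnsfun_approx _ _ _ _ measurableT _ mgE) => //= x _; rewrite lee_fin.
have f_nd m n y : (m <= n)%N -> (f_ m y <= f_ n y)%R.
  by move=> mn; exact/lefP/nd_nnsfun_approx.
transitivity (limn (fun n => \int[mu1]_x (Y x * f_ n (X1 x))%:E)).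
  rewrite -monotone_convergence//.
  - apply: eq_integral => x _; apply/esym/cvg_lim => //.
    under eq_fun do rewrite EFinM; rewrite EFinM.
    by apply: cvgeZl => //; exact: f_cvg.
  - move=> n; apply/measurable_EFinP/measurable_funM => //.
    exact: measurableT_comp.
  - by move=> n x _; rewrite lee_fin mulr_ge0.
  - by move=> x _ m n mn; rewrite lee_fin ler_wpM2l// f_nd.
transitivity (limn (fun n => \int[mu2]_x (K * f_ n (X2 x))%:E)).
  apply/congr_lim/funext => n; rewrite simple.
  under [RHS]eq_integral do rewrite EFinM.
  rewrite ge0_integralZl_EFin//; first by move=> x _; rewrite lee_fin.
  by apply/measurable_EFinP; exact: measurableT_comp.
rewrite -monotone_convergence//; last first.
- by move=> x _ m n mn; rewrite lee_fin ler_wpM2l// f_nd.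
- by move=> n x _; rewrite lee_fin mulr_ge0.
- move=> n; apply/measurable_EFinP/measurable_funM => //.
  exact: measurableT_comp.
rewrite -ge0_integralZl_EFin//; last 2 first.
- by move=> x _; rewrite lee_fin.
- by apply/measurable_EFinP; exact: measurableT_comp.
apply: eq_integral => x _; apply/cvg_lim => //.
under eq_fun do rewrite EFinM.
by apply: cvgeZl => //; exact: f_cvg.
Qed.

End transfer.

Definition image_measure d d' (T1 : measurableType d) (T2 : measurableType d')
    (R : realType) (m : {measure set T1 -> \bar R}) (f : T1 -> T2)
    (mf : measurable_fun setT f) : {measure set T2 -> \bar R} :=
  measure_function_pushforward__canonical__measure_function_Measure m mf.

Section standard_normal_law.
Local Open Scope ereal_scope.
Context {R : realType}.
Notation mu := (@lebesgue_measure R).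

Lemma lebesgue_measure_scale (a : R) (A : set (measurableTypeR R)) : (0 < a)%R ->
  measurable A -> mu A = a%:E * mu ((fun x => a * x)%R @^-1` A).
Proof.
move=> a0 mA.
have ma : measurable_fun setT (fun x : measurableTypeR R => (a * x)%R : measurableTypeR R).
  exact: measurable_funM.
pose M := mscale (NngNum (ltW a0)) (image_measure mu ma).
rewrite (@lebesgue_measure_unique _ M)// => _ [[x y] _ <-].
rewrite -[RHS]/(a%:E * mu ((fun x => a * x)%R @^-1` `]x, y]%classic)).
rewrite (_ : _ @^-1` _ = `](x / a)%R, (y / a)%R]%classic); last first.
  apply/seteqP; split=> u /=; rewrite !in_itv/= ltr_pdivrMr// ler_pdivlMr//;
  by rewrite (mulrC u).
rewrite /= !lebesgue_measure_itv/= !lte_fin ltr_pM2r ?invr_gt0//.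
case: ifP => _; last by rewrite mule0.
by rewrite -!EFinB -EFinM; congr EFin; field; rewrite gt_eqF.
Qed.

Lemma ge0_integral_scale (a : R) (g : R -> R) : (0 < a)%R ->
  measurable_fun setT g -> (forall x, 0 <= g x)%R ->
  \int[mu]_x (g x)%:E = a%:E * \int[mu]_x (g (a * x)%R)%:E.
Proof.
move=> a0 mg g0.
have := @ge0_integral_transfer _ _ _ _ _ _ _ mu mu (fun=> 1%R)
  (@id (measurableTypeR R)) (fun x : measurableTypeR R => (a * x)%R) a.
move=> /(_ _ _ _ _ _ _ g mg g0) <-//; last 3 first.
- exact: measurable_funM.
- exact: ltW.
- move=> B mB; under eq_integral do rewrite mul1r.
  by rewrite integral_indic ?setIT//; exact: lebesgue_measure_scale.
by apply: eq_integral => x _; rewrite mul1r.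
Qed.

Lemma normal_pdf01E (x : R) :
  normal_pdf 0 1 x = (normal_peak 1 * expR (- x ^+ 2 / 2))%R.
Proof. by rewrite normal_pdfE ?oner_neq0// /normal_fun subr0 expr1n. Qed.

(** [p] is a precision: the left side is the density of [X / sqrt p] for standard normal [X], so the
    factor in front of [normal_pdf 0 1 x] is its likelihood ratio with respect to [X]. *)
Lemma normal_pdf_scale (p x : R) : (0 < p)%R ->
  (Num.sqrt p * normal_pdf 0 1 (Num.sqrt p * x) =
   Num.sqrt p * expR ((1 - p) * x ^+ 2 / 2) * normal_pdf 0 1 x)%R.
Proof.
move=> p0; rewrite !normal_pdf01E exprMn sqr_sqrtr ?ltW//.
rewrite -!mulrA; congr *%R; rewrite [RHS]mulrCA; congr *%R.
by rewrite -expRD; congr expR; field.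
Qed.

End standard_normal_law.

Section gaussian_variable.
Local Open Scope ereal_scope.
Context {R : realType} d (Omega : measurableType d) (P : probability Omega R).
Notation mu := (@lebesgue_measure R).
Variable X : Omega -> R.
Hypothesis mX : measurable_fun setT X.
Hypothesis X_law : forall B, measurable B -> P (X @^-1` B) = normal_prob 0 1 B.

Lemma ge0_normal_expectation (g : R -> R) :
  measurable_fun setT g -> (forall x, 0 <= g x)%R ->
  \int[P]_w (g (X w))%:E = \int[mu]_x (normal_pdf 0 1 x * g x)%:E.
Proof.
move=> mg g0.
rewrite (@ge0_integral_transfer _ _ _ _ _ _ _ mu P (normal_pdf 0 1)
  (@id (measurableTypeR R)) X 1 (normal_pdf_ge0 0 1) _ _ _ _ _ g)// ?mul1e//.
- exact: measurable_normal_pdf.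
- move=> B mB; rewrite mul1e -[RHS]/(P (X @^-1` B)) X_law// /normal_prob [RHS]integral_mkcond.
  apply: eq_integral => x _; rewrite patchE indicE.
  by case: (x \in B); rewrite ?mulr1 ?mulr0.
Qed.

(** The integrand times the normal density is, up to the factor [1 / sqrt (1 + 2 l)], the density
    with precision [1 + 2 l], which is positive exactly under the hypothesis on [l]. *)
Lemma normal_expectation_expsq (l : R) : (- 2^-1 < l)%R ->
  \int[P]_w (expR (- l * X w ^+ 2))%:E = ((Num.sqrt (1 + 2 * l))^-1)%:E.
Proof.
move=> l2; have p0 : (0 < 1 + 2 * l)%R by lra.
have s0 : (0 < Num.sqrt (1 + 2 * l))%R by rewrite sqrtr_gt0.
rewrite (@ge0_normal_expectation (fun x => expR (- l * x ^+ 2)))//; last first.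
  apply: measurableT_comp => //=.
  by apply: measurable_funM => //=; exact: measurable_funX.
have H := @ge0_integral_scale R _ (normal_pdf 0 1) s0
  (measurable_normal_pdf 0 1) (normal_pdf_ge0 0 1).
rewrite integral_normal_pdf in H.
transitivity (((Num.sqrt (1 + 2 * l))^-1)%:E *
   ((Num.sqrt (1 + 2 * l))%:E * \int[mu]_x (normal_pdf 0 1 (Num.sqrt (1 + 2 * l) * x))%:E)); last first.
  by rewrite -H mule1.
rewrite muleA -EFinM mulVf ?gt_eqF// mul1e.
apply: eq_integral => x _; congr EFin.
apply: (mulfI (lt0r_neq0 s0)); rewrite normal_pdf_scale// -mulrA; congr *%R.
by rewrite mulrC; congr (expR _ * _)%R; field.
Qed.

Lemma normal_expectation_exp (u : R) :
  \int[P]_w (expR (u * X w))%:E = (expR (u ^+ 2 / 2))%:E.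
Proof.
rewrite (@ge0_normal_expectation (fun x => expR (u * x)))//; last first.
  by apply: measurableT_comp => //=; exact: measurable_funM.
transitivity (\int[mu]_x ((expR (u ^+ 2 / 2))%:E * (normal_pdf u 1 x)%:E)).
  apply: eq_integral => x _; rewrite -EFinM normal_pdf01E normal_pdfE ?oner_neq0//.
  rewrite /normal_fun expr1n mulrCA -mulrA -!expRD; congr (_ * expR _)%:E.
  by field.
rewrite ge0_integralZl_EFin// ?expR_ge0//; last 2 first.
- by move=> x _; rewrite lee_fin normal_pdf_ge0.
- by apply/measurable_EFinP; exact: measurable_normal_pdf.
by rewrite integral_normal_pdf mule1.
Qed.

Lemma normal_scale_law (p : R) (B : set R) : (0 < p)%R -> measurable B ->
  P [set w | B (X w / Num.sqrt p)%R] =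
  \int[P]_w (Num.sqrt p * expR ((1 - p) * X w ^+ 2 / 2) * \1_B (X w))%:E.
Proof.
move=> p0 mB; have s0 : (0 < Num.sqrt p)%R by rewrite sqrtr_gt0.
have mf : measurable_fun setT (fun x : R => Num.sqrt p * expR ((1 - p) * x ^+ 2 / 2) * \1_B x)%R.
  apply: measurable_funM; last exact: measurable_indic.
  apply: measurable_funM => //; apply: measurableT_comp => //=.
  apply: measurable_funM => //=; apply: measurable_funM => //=.
rewrite (@ge0_normal_expectation (fun x => Num.sqrt p * expR ((1 - p) * x ^+ 2 / 2) * \1_B x)%R)//.
have mS : measurable [set x : R | B (x / Num.sqrt p)%R].
  rewrite -[X in measurable X]setTI.
  by apply: (@measurable_funM _ _ _ setT id (cst (Num.sqrt p)^-1)%R).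
rewrite -[P _]/(P (X @^-1` [set x | B (x / Num.sqrt p)%R])) X_law//.
rewrite /normal_prob integral_mkcond.
rewrite [LHS](_ : _ = \int[mu]_x (normal_pdf 0 1 x * \1_B (x / Num.sqrt p))%:E); last first.
  apply: eq_integral => x _; rewrite patchE indicE.
  rewrite [in LHS](_ : (x \in [set x | B (x / Num.sqrt p)%R]) = ((x / Num.sqrt p)%R \in B)).
    by case: (_ \in _); rewrite ?mulr1 ?mulr0.
  by apply/idP/idP; rewrite !inE.
rewrite (@ge0_integral_scale _ _ _ s0); last 2 first.
- apply: measurable_funM; first exact: measurable_normal_pdf.
  apply: (@measurableT_comp _ _ _ _ _ _ _ _ (fun x : R => (x / Num.sqrt p)%R)).
    exact: measurable_indic.
  exact: measurable_funM.
- by move=> x; rewrite mulr_ge0// normal_pdf_ge0.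
rewrite -ge0_integralZl_EFin//; last first.
  apply/measurable_EFinP/measurable_funM.
    apply: (@measurableT_comp _ _ _ _ _ _ _ _ (fun x : R => (Num.sqrt p * x)%R)).
      exact: measurable_normal_pdf.
    exact: measurable_funM.
  apply: (@measurableT_comp _ _ _ _ _ _ _ _ (fun x : R => (Num.sqrt p * x / Num.sqrt p)%R)).
    exact: measurable_indic.
  by apply: measurable_funM => //; exact: measurable_funM.
  by move=> x _; rewrite lee_fin mulr_ge0// normal_pdf_ge0.
apply: eq_integral => x _; rewrite -EFinM; congr EFin.
rewrite mulrA normal_pdf_scale// (mulrC (Num.sqrt p) x) mulfK ?gt_eqF//.
by rewrite [LHS]mulrAC mulrC.
Qed.

End gaussian_variable.

Section density_measure.
Local Open Scope ereal_scope.
Context d (T : measurableType d) (R : realType) (mu : {measure set T -> \bar R}).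
Variables (f : T -> R) (f0 : forall x, (0 <= f x)%R) (mf : measurable_fun setT f).

(** The proofs of positivity and measurability are arguments so that the measure structure can be
    attached to the applied term. *)
Definition density_measure (_ : forall x, (0 <= f x)%R)
  (_ : measurable_fun setT f) (A : set T) : \bar R := \int[mu]_(x in A) (f x)%:E.

Local Notation dm := (density_measure f0 mf).

Let dm0 : dm set0 = 0. Proof. exact: integral_set0. Qed.

Let dm_ge0 A : 0 <= dm A.
Proof. by apply: integral_ge0 => x _; rewrite lee_fin. Qed.

Let dm_sigma_additive : semi_sigma_additive dm.
Proof.
move=> /= A mA tA mUA; rewrite /density_measure ge0_integral_bigcup//=.
- apply: is_cvg_ereal_nneg_natsum_cond => n _ _; exact: dm_ge0.
- exact/measurable_EFinP/(measurable_funS _ _ mf).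
- by move=> x _; rewrite lee_fin.
Qed.

HB.instance Definition _ := isMeasure.Build _ _ _ dm dm0 dm_ge0 dm_sigma_additive.
End density_measure.

(** * Laws of finite vectors of independent normals *)

Section cylinders.
Context (R : realType) (m : nat).

Definition cylinder : set (set (nat -> R)) :=
  [set A | exists2 B : nat -> set R, (forall j, measurable (B j)) &
    A = [set x | forall j, (j < m)%N -> B j (x j)]].

(** Vectors of length [m] are encoded as sequences whose sigma-algebra sees only the first [m]
    coordinates. Cylinders form a pi-system containing the whole space, so finite measures on
    [seqspace] are determined by them. *)
Definition seqspace : measurableType _ := g_sigma_algebraType cylinder.

Lemma cylinder_setI_closed : setI_closed cylinder.
Proof.
move=> _ _ [B mB ->] [B' mB' ->]; exists (fun j => B j `&` B' j).
  by move=> j; exact: measurableI.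
apply/seteqP; split=> x /=.
  by move=> [h h'] j jm; split; [exact: h|exact: h'].
by move=> h; split=> j jm; have [] := h j jm.
Qed.

Lemma cylinderT : cylinder setT.
Proof. by exists (fun=> setT) => //; apply/seteqP; split. Qed.

Lemma measurable_coordinate j : (j < m)%N ->
  measurable_fun setT (fun x : seqspace => x j : R).
Proof.
move=> jm _ A mA; rewrite setTI; apply: sub_sigma_algebra.
exists (fun i => if i == j then A else setT); first by move=> i; case: ifP.
apply/seteqP; split=> x /=; first by move=> Ax i _; case: eqP => // ->.
by move=> /(_ j jm); rewrite eqxx.
Qed.

Lemma measurable_to_seqspace d (T : measurableType d) (X : nat -> T -> R) :
  (forall j, measurable_fun setT (X j)) ->
  measurable_fun setT (fun w => (X ^~ w) : seqspace).
Proof.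
move=> mX.
apply: (@measurability _ _ T seqspace setT (fun w => (X ^~ w) : seqspace) cylinder).
  by [].
move=> _ [_ [B mB ->] <-].
rewrite setTI.
rewrite [X in measurable X](_ : _ = \bigcap_(j in [set j | (j < m)%N]) (X j @^-1` B j)).
  by apply: bigcap_measurableType => j _; rewrite -[X in measurable X]setTI; exact: mX.
by apply/seteqP; split.
Qed.

Lemma measurable_wsumsq (c : nat -> R) :
  measurable_fun setT (fun x : seqspace => \sum_(j < m) c j * x j ^+ 2).
Proof.
apply: measurable_sum => j; apply: measurable_funM => //.
by apply: measurable_funX; exact: measurable_coordinate.
Qed.

End cylinders.

Section independent_normals.
Local Open Scope ereal_scope.
Context {R : realType} d (Omega : measurableType d) (P : probability Omega R).
Variable xi : nat -> Omega -> R.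
Hypothesis xi_iid : iid_std_normal P xi.

Lemma measurable_xi j : measurable_fun setT (xi j).
Proof. by have [+ _] := xi_iid; exact. Qed.

Lemma xi_law j B : measurable B -> P (xi j @^-1` B) = normal_prob 0 1 B.
Proof. by have [_ [+ _]] := xi_iid; exact. Qed.

Lemma measurable_xi_preimage j B : measurable B -> measurable (xi j @^-1` B).
Proof. by move=> mB; rewrite -[X in measurable X]setTI; exact: measurable_xi. Qed.

Lemma xi_cylinder m (B : nat -> set R) : (forall j, measurable (B j)) ->
  P [set w | forall j, (j < m)%N -> B j (xi j w)] =
  \prod_(j < m) P (xi j @^-1` B j).
Proof.
move=> mB; have [_ [_ indep]] := xi_iid.
have := indep [fset j in iota 0 m]%fset B mB.
rewrite [X in P X = _ -> _](_ : _ = [set w | forall j, (j < m)%N -> B j (xi j w)]); last first.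
  by apply/seteqP; split => w /= h j; have := h j; rewrite /= !inE/= mem_iota.
move=> ->; rewrite -(big_mkord xpredT (fun j => P (xi j @^-1` B j))) /index_iota subn0.
apply: perm_big; apply: uniq_perm; [exact: fset_uniq|exact: iota_uniq|].
by move=> j; rewrite !inE.
Qed.

(** Independence is given for events only. The induction is on the number [k] of factors that are
    not yet indicators: for [k = 0] the claim is the product rule for cylinders, and in the step
    factor [k] passes from indicators to a general function while all others are frozen. *)
Lemma expectation_prod_xi m (g : nat -> R -> R) (e : nat -> R) :
  (forall j, measurable_fun setT (g j)) -> (forall j x, 0 <= g j x)%R ->
  (forall j, \int[P]_w (g j (xi j w))%:E = (e j)%:E) ->
  \int[P]_w (\prod_(j < m) g j (xi j w))%:E = (\prod_(j < m) e j)%:E.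
Proof.
suff main k : (k <= m)%N -> forall (g : nat -> R -> R) (e : nat -> R),
    (forall j, measurable_fun setT (g j)) -> (forall j x, 0 <= g j x)%R ->
    (forall j, \int[P]_w (g j (xi j w))%:E = (e j)%:E) ->
    (forall j, (k <= j)%N -> exists2 B, measurable B & g j = \1_B) ->
    \int[P]_w (\prod_(j < m) g j (xi j w))%:E = (\prod_(j < m) e j)%:E.
  move=> mg g0 ge.
  (* Factors beyond [m] are replaced by 1, the indicator of [setT], so that [main] applies with
     [k = m]. *)
  pose g' j := if (j < m)%N then g j else cst 1%R.
  pose e' j := if (j < m)%N then e j else 1%R.
  have e'E : (\prod_(j < m) e' j = \prod_(j < m) e j)%R.
    by apply: eq_bigr => j _; rewrite /e' ltn_ord.
  have := main m (leqnn _) g' e'; rewrite e'E.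
  move=> <-.
  - by apply: eq_integral => w _; congr EFin; apply: eq_bigr => j _; rewrite /g' ltn_ord.
  - by move=> j; rewrite /g'; case: ifP.
  - by move=> j x; rewrite /g'; case: ifP.
  - move=> j; rewrite /g' /e'; case: ifP => // _.
    by rewrite (integral_cst P measurableT 1%E) mul1e; exact: probability_setT.
  - by move=> j mj; exists setT => //; rewrite /g' ltnNge mj/= indicT.
elim: k => [_|k IH km] {}g {}e mg g0 ge gB.
  have /choice[B HB] : forall j, exists B, measurable B /\ g j = \1_B.
    by move=> j; have [B] := gB j (leq0n _); exists B.
  have mB j : measurable (B j) by case: (HB j).
  transitivity (\int[P]_w (\1_[set w | forall j, (j < m)%N -> B j (xi j w)] w : R)%:E).
    apply: eq_integral => w _; congr EFin; rewrite indicE.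
    have [h|h] := pselect (forall j, (j < m)%N -> B j (xi j w)).
      rewrite mem_set//; apply: big1 => j _; case: (HB j) => _ ->; rewrite indicE mem_set//; exact: h.
    have [j [jm nB]] : exists j, (j < m)%N /\ ~ B j (xi j w).
      by apply: contrapT => h'; apply: h => j jm; apply: contrapT => h2; apply: h'; exists j.
    rewrite memNset// (bigD1 (Ordinal jm))//=; case: (HB j) => _ ->.
    by rewrite indicE memNset// mul0r.
  rewrite integral_indic ?setIT//; last first.
    rewrite [X in measurable X](_ : _ = \bigcap_(j in [set j | (j < m)%N]) (xi j @^-1` B j)).
      by apply: bigcap_measurableType => j _; exact: measurable_xi_preimage.
    by apply/seteqP; split.
  rewrite [LHS](xi_cylinder m mB) -prodEFin; apply: eq_bigr => j _; rewrite -ge.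
  case: (HB j) => _ ->.
  rewrite -[RHS]/(\int[P]_w (\1_(xi j @^-1` B j) w)%:E).
  by rewrite integral_indic ?setIT//; exact: measurable_xi_preimage.
have [mY Y0] : measurable_fun setT (fun w => \prod_(j < m | j != Ordinal km) g j (xi j w))%R
    /\ forall w, (0 <= \prod_(j < m | j != Ordinal km) g j (xi j w))%R.
  split; last by move=> w; exact: prodr_ge0.
  rewrite [X in measurable_fun _ X](_ : _ = (fun w => \prod_(j < m)
      if j != Ordinal km then g j (xi j w) else 1)%R); last first.
    by apply/funext => w; rewrite big_mkcond.
  apply: measurable_prod => j _; case: (j != Ordinal km) => //.
  by apply: measurableT_comp => //; exact: measurable_xi.
have e0 j : (0 <= e j)%R.
  by rewrite -lee_fin -ge; apply: integral_ge0 => w _; rewrite lee_fin.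
have E0 : (0 <= \prod_(j < m | j != Ordinal km) e j)%R by exact: prodr_ge0.
have step B : measurable B ->
    \int[P]_w ((\prod_(j < m | j != Ordinal km) g j (xi j w)) * \1_B (xi k w))%:E =
    (\prod_(j < m | j != Ordinal km) e j)%:E * P (xi k @^-1` B).
  move=> mB.
  pose g' j := if j == k then \1_B else g j.
  pose e' j := if j == k then fine (P (xi k @^-1` B)) else e j.
  have e'E : (\prod_(j < m) e' j)%:E =
      (\prod_(j < m | j != Ordinal km) e j)%R%:E * P (xi k @^-1` B).
    rewrite (bigD1 (Ordinal km))//= {1}/e' eqxx mulrC EFinM fineK; last first.
      exact: fin_num_measure (measurable_xi_preimage _ _).
    congr (_%:E * _); apply: eq_bigr => j jk; rewrite /e' ifF//; apply/negbTE.
    by apply: contra jk => /eqP jk; apply/eqP/val_inj.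
  have := IH (ltnW km) g' e'; rewrite e'E.
  move=> <-.
  - apply: eq_integral => w _; rewrite [in RHS](bigD1 (Ordinal km))//= {1}/g' eqxx mulrC.
    congr (_ * _)%:E; apply: eq_bigr => j jk; rewrite /g' ifF//; apply/negbTE.
    by apply: contra jk => /eqP jk; apply/eqP/val_inj.
  - by move=> j; rewrite /g'; case: ifP => // _; exact: measurable_indic.
  - by move=> j x; rewrite /g'; case: ifP.
  - move=> j; rewrite /g' /e'; case: eqP => // ->.
    rewrite -[LHS]/(\int[P]_w (\1_(xi k @^-1` B) w)%:E).
    rewrite integral_indic ?setIT//; last exact: measurable_xi_preimage.
    by rewrite fineK//; exact: fin_num_measure (measurable_xi_preimage _ _).
  - move=> j kj; rewrite /g'; case: eqP => [_|/eqP jk]; first by exists B.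
    by apply: gB; rewrite ltn_neqAle eq_sym jk.
transitivity (\int[P]_w ((\prod_(j < m | j != Ordinal km) g j (xi j w)) * g k (xi k w))%:E).
  by apply: eq_integral => w _; rewrite (bigD1 (Ordinal km))//= mulrC.
rewrite (ge0_integral_transfer Y0 mY (measurable_xi k) (measurable_xi k) E0 step (mg k) (g0 k)).
by rewrite ge -EFinM [in RHS](bigD1 (Ordinal km))//= mulrC.
Qed.

(** Likelihood ratio of the vector [xi j / sqrt (p j)], [j < m], with respect to the vector
    [xi j]. *)
Definition scale_lr (m : nat) (p : nat -> R) (w : Omega) : R :=
  (\prod_(j < m) (Num.sqrt (p j) * expR ((1 - p j) * xi j w ^+ 2 / 2)))%R.

Lemma scale_lr_ge0 m p w : (0 <= scale_lr m p w)%R.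
Proof. by apply: prodr_ge0 => j _; rewrite mulr_ge0 ?sqrtr_ge0 ?expR_ge0. Qed.

Lemma measurable_scale_lr_factor (p : R) :
  measurable_fun setT (fun x : R => (Num.sqrt p * expR ((1 - p) * x ^+ 2 / 2))%R).
Proof.
apply: measurable_funM => //; apply: measurableT_comp => //=.
by apply: measurable_funM => //=; apply: measurable_funM => //=.
Qed.

Lemma measurable_scale_lr m p : measurable_fun setT (scale_lr m p).
Proof.
apply: measurable_prod => j _.
by apply: (measurableT_comp (measurable_scale_lr_factor (p j))); exact: measurable_xi.
Qed.

(** The event about the sum is not a cylinder, so the product formula does not apply to it directly.
    The law of the scaled vector and the law weighted by [scale_lr] are two finite measures on
    [seqspace] that agree on cylinders, hence on this event. *)
Lemma scaled_law m (c p : nat -> R) (B : set R) :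
  (forall j, 0 < p j)%R -> measurable B ->
  P [set w | B (\sum_(j < m) c j * (xi j w ^+ 2 / p j))%R] =
  \int[P]_(w in [set w | B (\sum_(j < m) c j * xi j w ^+ 2)%R]) (scale_lr m p w)%:E.
Proof.
move=> p0 mB.
pose X' j w := (xi j w / Num.sqrt (p j))%R.
have mX' j : measurable_fun setT (X' j).
  by apply: measurable_funM => //; exact: measurable_xi.
pose m1 := image_measure P (@measurable_to_seqspace _ m _ _ X' mX').
pose dm := @density_measure _ _ _ P _ (scale_lr_ge0 m p) (measurable_scale_lr m p).
pose m2 := image_measure dm (@measurable_to_seqspace _ m _ _ xi measurable_xi).
have mA : measurable [set x : seqspace R m | B (\sum_(j < m) c j * x j ^+ 2)%R].
  by rewrite -[X in measurable X]setTI; exact: (@measurable_wsumsq R m c measurableT B mB).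
have : m1 [set x : seqspace R m | B (\sum_(j < m) c j * x j ^+ 2)%R] = m2 [set x : seqspace R m | B (\sum_(j < m) c j * x j ^+ 2)%R].
  apply: (@measure_unique _ R (seqspace R m) (@cylinder R m) (fun=> setT) _ _ _ _ m1 m2) => //.
  - exact: cylinder_setI_closed.
  - by move=> _; exact: cylinderT.
  - by rewrite bigcup_const.
  - move=> _ [C mC ->].
    rewrite -[LHS]/(P [set w | forall j, (j < m)%N -> C j (X' j w)]).
    rewrite -[RHS]/(\int[P]_(w in [set w | forall j, (j < m)%N -> C j (xi j w)]) (scale_lr m p w)%:E).
    have mC' j : measurable [set x | C j (x / Num.sqrt (p j))%R].
      rewrite -[X in measurable X]setTI.
      by apply: (@measurable_funM _ _ _ setT id (cst (Num.sqrt (p j))^-1)%R).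
    rewrite -[LHS]/(P [set w | forall j, (j < m)%N -> [set x | C j (x / Num.sqrt (p j))%R] (xi j w)]).
    rewrite (xi_cylinder m mC') integral_mkcond.
    transitivity (\int[P]_w (\prod_(j < m) (Num.sqrt (p j) * expR ((1 - p j) * xi j w ^+ 2 / 2) * \1_(C j) (xi j w)))%:E); last first.
      apply: eq_integral => w _; rewrite patchE.
      have [h|h] := pselect (forall j, (j < m)%N -> C j (xi j w)).
        rewrite mem_set//; congr EFin; apply: eq_bigr => j _; rewrite indicE mem_set ?mulr1//; exact: h.
      have [j [jm nB]] : exists j, (j < m)%N /\ ~ C j (xi j w).
        by apply: contrapT => h'; apply: h => j jm; apply: contrapT => h2; apply: h'; exists j.
      by rewrite [RHS]ifF ?memNset// (bigD1 (Ordinal jm))//= indicE memNset// mulr0 mul0r.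
    have Pfin j : P [set w | C j (xi j w / Num.sqrt (p j))%R] \is a fin_num.
      exact: fin_num_measure (measurable_xi_preimage _ (mC' j)).
    rewrite (@expectation_prod_xi m (fun j x => Num.sqrt (p j) * expR ((1 - p j) * x ^+ 2 / 2) * \1_(C j) x)%R
       (fun j => fine (P [set w | C j (xi j w / Num.sqrt (p j))%R]))).
    + rewrite -prodEFin; apply: eq_bigr => j _; rewrite fineK//; exact: Pfin.
    + move=> j; apply: measurable_funM; last exact: measurable_indic.
      exact: measurable_scale_lr_factor.
    + by move=> j x; rewrite !mulr_ge0 ?sqrtr_ge0 ?expR_ge0.
    + move=> j; rewrite fineK//; rewrite (normal_scale_law (measurable_xi j) (xi_law j))//.
  - by move=> _; rewrite -[m1 _]/(P setT) probability_setT ltry.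
rewrite -[m2 _]/(\int[P]_(w in [set w | B (\sum_(j < m) c j * xi j w ^+ 2)%R]) (scale_lr m p w)%:E) => <-.
rewrite -[RHS]/(P [set w | B (\sum_(j < m) c j * (xi j w / Num.sqrt (p j)) ^+ 2)%R]).
congr (P _); apply/funext => w /=; congr B; apply: eq_bigr => j _.
by rewrite exprMn exprVn sqr_sqrtr// ltW.
Qed.

End independent_normals.

(** * Quasi-invariance of weighted chi-square sums under scaling *)

Section real_probability.
Context {R : realType} d (Omega : measurableType d) (P : probability Omega R).

Definition pr (A : set Omega) : R := fine (P A).

Lemma prE A : measurable A -> P A = (pr A)%:E.
Proof. by move=> mA; rewrite fineK//; exact: fin_num_measure. Qed.

Lemma pr_ge0 A : 0 <= pr A. Proof. exact: fine_ge0. Qed.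

Lemma pr_le A B : measurable A -> measurable B -> A `<=` B -> pr A <= pr B.
Proof. by move=> mA mB AB; rewrite -lee_fin -!prE// le_measure ?inE. Qed.

Lemma pr_setC A : measurable A -> pr (~` A) = 1 - pr A.
Proof.
move=> mA; apply: EFin_inj; rewrite -prE; last exact: measurableC.
by rewrite probability_setC// prE// EFinB.
Qed.

Lemma pr_setU_le A B C : measurable A -> measurable B -> measurable C ->
  A `<=` B `|` C -> pr A <= pr B + pr C.
Proof.
move=> mA mB mC ABC; rewrite -lee_fin EFinD -!prE//.
apply: (@le_trans _ _ (P (B `|` C))); last exact: measureU2.
by rewrite le_measure ?inE//; exact: measurableU.
Qed.

Lemma pr_bigcup_le (n : nat) A (B : nat -> set Omega) C :
  measurable A -> (forall i, measurable (B i)) -> measurable C ->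
  A `<=` C `|` [set w | exists2 i, (i < n)%N & B i w] ->
  pr A <= pr C + \sum_(i < n) pr (B i).
Proof.
move=> mA mB; elim: n C => [|n IH] C mC AC.
  rewrite big_ord0 addr0; apply: pr_le => // w /AC[//|[i]]; by rewrite ltn0.
rewrite big_ord_recr/=.
apply: (@le_trans _ _ (pr (C `|` B n) + \sum_(i < n) pr (B i))).
  apply: IH; first exact: measurableU.
  move=> w /AC[Cw|[i]]; first by left; left.
  rewrite ltnS leq_eqVlt => /orP[/eqP -> Bw|]; first by left; right.
  by move=> ? ?; right; exists i.
rewrite addrA [leRHS]addrAC lerD2r.
by apply: pr_setU_le => //; exact: measurableU.
Qed.

Lemma pr_disjoint_sum_le1 (n : nat) (B : nat -> set Omega) :
  (forall i, measurable (B i)) -> trivIset [set i | (i < n)%N] B ->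
  \sum_(i < n) pr (B i) <= 1.
Proof.
move=> mB tB; rewrite -lee_fin -sumEFin.
under eq_bigr do rewrite -prE//.
rewrite -(measure_semi_additive_ord_I P (fun k _ => mB k) tB).
  by apply: probability_le1; apply: bigsetU_measurable.
by apply: bigsetU_measurable.
Qed.

Definition nonneg_measurable (f : Omega -> R) : Prop :=
  measurable_fun setT f /\ forall w, 0 <= f w.

Lemma nonneg_measurableD f g : nonneg_measurable f -> nonneg_measurable g ->
  nonneg_measurable (fun w => f w + g w).
Proof.
move=> [mf f0] [mg g0]; split; first exact: measurable_funD.
by move=> w; exact: addr_ge0.
Qed.

Lemma nonneg_measurableM f g : nonneg_measurable f -> nonneg_measurable g ->
  nonneg_measurable (fun w => f w * g w).
Proof.
move=> [mf f0] [mg g0]; split; first exact: measurable_funM.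
by move=> w; exact: mulr_ge0.
Qed.

Lemma nonneg_measurable_cst k : 0 <= k -> nonneg_measurable (fun=> k).
Proof. by move=> k0; split. Qed.

Lemma nonneg_measurable_indic A : measurable A -> nonneg_measurable (\1_A).
Proof. by move=> mA; split=> //; exact: measurable_indic. Qed.

Lemma expectationD_ge0 f g : nonneg_measurable f -> nonneg_measurable g ->
  (\int[P]_w (f w + g w)%:E = \int[P]_w (f w)%:E + \int[P]_w (g w)%:E)%E.
Proof.
move=> [mf f0] [mg g0]; under eq_integral do rewrite EFinD.
by rewrite ge0_integralD//; try exact/measurable_EFinP;
  move=> w _; rewrite lee_fin.
Qed.

Lemma expectationZ_ge0 k f : 0 <= k -> nonneg_measurable f ->
  (\int[P]_w (k * f w)%:E = k%:E * \int[P]_w (f w)%:E)%E.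
Proof.
move=> k0 [mf f0]; under eq_integral do rewrite EFinM.
by rewrite ge0_integralZl_EFin//; try exact/measurable_EFinP;
  move=> w _; rewrite lee_fin.
Qed.

Lemma expectation_cst_pr (k : R) : (\int[P]_w k%:E = k%:E)%E.
Proof.
rewrite (integral_cst P measurableT k%:E).
by have := probability_setT P; rewrite /= => ->; rewrite mule1.
Qed.

Lemma expectation_indic_pr A : measurable A -> (\int[P]_w (\1_A w)%:E = (pr A)%:E)%E.
Proof. by move=> mA; rewrite integral_indic// setIT; exact: prE. Qed.

Lemma expectation_le f g : nonneg_measurable f -> nonneg_measurable g ->
  (forall w, f w <= g w) -> (\int[P]_w (f w)%:E <= \int[P]_w (g w)%:E)%E.
Proof.
by move=> [mf f0] [mg g0] fg; apply: ge0_le_integral => //;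
  try exact/measurable_EFinP; move=> w _; rewrite lee_fin.
Qed.

Lemma pr_markov (A : set Omega) (Y : Omega -> R) (e : R) :
  measurable A -> measurable_fun setT Y -> (forall w, 0 <= Y w) ->
  (forall w, A w -> 1 <= Y w) -> (\int[P]_w (Y w)%:E)%E = e%:E -> pr A <= e.
Proof.
move=> mA mY Y0 AY eE; rewrite -lee_fin -eE -expectation_indic_pr//.
apply: expectation_le; [exact: nonneg_measurable_indic|by split|move=> w].
by rewrite indicE; have [/set_mem/AY//|_] := boolP (w \in A); exact: Y0.
Qed.

End real_probability.

Section scaling_estimates.
Context {R : realType} d (Omega : measurableType d) (P : probability Omega R).
Variable xi : nat -> Omega -> R.
Hypothesis xi_iid : iid_std_normal P xi.

Let mxi j : measurable_fun setT (xi j) := measurable_xi xi_iid j.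

Definition wsum (m : nat) (c : nat -> R) (w : Omega) : R :=
  \sum_(j < m) c j * xi j w ^+ 2.

(** Only the first [k] precisions are raised, the range where the weights have a lower bound of
    order [k^(-1/2)]; the length [m] of the sum later tends to infinity with [k] fixed. *)
Definition scaling (k : nat) (y : R) (j : nat) : R := if (j < k)%N then 1 + y else 1.

Definition scaled_wsum (m k : nat) (c : nat -> R) (y : R) (w : Omega) : R :=
  \sum_(j < m) c j * (xi j w ^+ 2 / scaling k y j).

Lemma measurable_wsum m c : measurable_fun setT (wsum m c).
Proof.
by apply: measurable_sum => j; apply: measurable_funM => //; exact: measurable_funX.
Qed.

Lemma scaling_gt0 k y j : 0 <= y -> 0 < scaling k y j.
Proof. by move=> y0; rewrite /scaling; case: ifP => _ //; lra. Qed.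

Lemma scaled_wsumE m k c y w : (k <= m)%N -> 0 <= y ->
  scaled_wsum m k c y w = wsum m c w - wsum k c w * (y / (1 + y)).
Proof.
move=> km y0; rewrite /scaled_wsum /wsum (big_ord_widen m (fun j => c j * xi j w ^+ 2) km).
rewrite mulr_suml [in X in _ - X]big_mkcond -sumrB; apply: eq_bigr => j _.
rewrite /scaling; case: ifP => _; last by rewrite divr1 subr0.
by field; rewrite gt_eqF//; lra.
Qed.

Lemma measurable_scaled_wsum m k c y : measurable_fun setT (scaled_wsum m k c y).
Proof.
apply: measurable_sum => j; apply: measurable_funM => //.
by apply: measurable_funM => //; exact: measurable_funX.
Qed.

Lemma measurable_wsum_event m c (B : set R) : measurable B ->
  measurable [set w | B (wsum m c w)].
Proof. by move=> mB; rewrite -[X in measurable X]setTI; exact: measurable_wsum. Qed.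

Lemma measurable_scaled_wsum_event m k c y (B : set R) : measurable B ->
  measurable [set w | B (scaled_wsum m k c y w)].
Proof.
by move=> mB; rewrite -[X in measurable X]setTI; exact: measurable_scaled_wsum.
Qed.

(** After squaring: [(1 + y)^2 <= (1 + y^2) (1 + 2 y)], with difference [2 y^3], and
    [1 + y^2 <= exp (y^2)]. *)
Lemma sqrt_lr_moment_le (y : R) : 0 <= y ->
  (1 + y) / Num.sqrt (1 + 2 * y) <= expR (y ^+ 2 / 2).
Proof.
move=> y0; have s0 : 0 < Num.sqrt (1 + 2 * y) by rewrite sqrtr_gt0; lra.
rewrite ler_pdivrMr// -(@ler_pXn2r _ 2) ?nnegrE ?mulr_ge0 ?expR_ge0 ?sqrtr_ge0//; last lra.
rewrite exprMn sqr_sqrtr; last lra.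
rewrite -expRM_natl.
have := expR_ge1Dx (y ^+ 2); rewrite (_ : 2%:R * (y ^+ 2 / 2) = y ^+ 2); last by field.
move=> h; have := sqr_ge0 y => y2.
apply: (@le_trans _ _ ((1 + y ^+ 2) * (1 + 2 * y))); last by rewrite ler_wpM2r//; lra.
by rewrite -subr_ge0 (_ : _ - _ = 2 * y * y ^+ 2); [rewrite !mulr_ge0|ring].
Qed.

Lemma scale_lr_moment2 m k y : (k <= m)%N -> 0 <= y ->
  exists2 v, (\int[P]_w (scale_lr xi m (scaling k y) w ^+ 2)%:E)%E = v%:E &
    v <= expR (k%:R * y ^+ 2 / 2).
Proof.
move=> km y0; have p0 j := @scaling_gt0 k y j y0.
pose g j (x : R) := scaling k y j * expR (- (scaling k y j - 1) * x ^+ 2).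
pose e j := scaling k y j / Num.sqrt (1 + 2 * (scaling k y j - 1)).
exists (\prod_(j < m) e j).
  rewrite -(@expectation_prod_xi _ _ _ _ _ xi_iid m g e).
  - apply: eq_integral => w _; rewrite /scale_lr -prodrXl; congr EFin.
    apply: eq_bigr => j _; rewrite exprMn sqr_sqrtr ?ltW// -expRM_natl /g.
    by congr (_ * expR _); field.
  - move=> j; apply: measurable_funM => //; apply: measurableT_comp => //=.
    by apply: measurable_funM => //; exact: measurable_funX.
  - by move=> j x; rewrite mulr_ge0 ?expR_ge0// ltW.
  - move=> j; rewrite /g.
    under eq_integral do rewrite EFinM.
    rewrite ge0_integralZl_EFin//; last 2 first.
    + apply/measurable_EFinP; apply: measurableT_comp => //=.
      by apply: measurable_funM => //; exact: measurable_funX.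
    + exact: ltW.
    rewrite (normal_expectation_expsq (mxi j) (xi_law xi_iid j)) -?EFinM//.
    by rewrite /scaling; case: ifP => _; lra.
rewrite (_ : k%:R * y ^+ 2 / 2 = \sum_(j < m) if (j < k)%N then y ^+ 2 / 2 else 0); last first.
  rewrite -big_mkcond/= -(big_ord_widen m (fun=> y ^+ 2 / 2) km) sumr_const card_ord.
  by rewrite -[RHS]mulr_natl mulrA.
rewrite expR_sum; apply: ler_prod => j _; rewrite /e /scaling; case: ifP => _.
  rewrite divr_ge0 ?sqrtr_ge0//=; last lra.
  by rewrite addrAC subrr add0r sqrt_lr_moment_le.
by rewrite subrr mulr0 addr0 sqrtr1 divr1 expR0 lexx ler01.
Qed.

Let mE m c (B : set R) : measurable B -> measurable [set w | B (wsum m c w)].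
Proof. exact: measurable_wsum_event. Qed.

Lemma scaled_wsum_law m k c y (B : set R) : 0 <= y -> measurable B ->
  (\int[P]_w (scale_lr xi m (scaling k y) w * \1_[set w | B (wsum m c w)] w)%:E)%E
  = (pr P [set w | B (scaled_wsum m k c y w)])%:E.
Proof.
move=> y0 mB; rewrite -prE; last exact: measurable_scaled_wsum_event.
rewrite [RHS](scaled_law xi_iid m c (fun j => @scaling_gt0 k y j y0) mB).
rewrite [RHS]integral_mkcond; apply: eq_integral => w _; rewrite patchE indicE /wsum.
by case: (w \in _); rewrite ?mulr1 ?mulr0.
Qed.

(** Pointwise [L <= M + L^2 / M] for the likelihood ratio [L], by comparing [L] with [M]. An event
    that is rare before scaling stays rare after it, with [M] balancing the two terms. *)
Lemma scaled_wsum_upper m k c y (B : set R) (M : R) : (k <= m)%N -> 0 <= y ->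
  measurable B -> 0 < M ->
  pr P [set w | B (scaled_wsum m k c y w)] <=
  M * pr P [set w | B (wsum m c w)] + expR (k%:R * y ^+ 2 / 2) / M.
Proof.
move=> km y0 mB M0.
have [v vE vle] := scale_lr_moment2 km y0.
apply: (@le_trans _ _ (M * pr P [set w | B (wsum m c w)] + v / M)); last first.
  by rewrite lerD2l ler_pM2r// invr_gt0.
have nL : nonneg_measurable (scale_lr xi m (scaling k y)).
  by split; [exact: (measurable_scale_lr xi_iid m _)|exact: scale_lr_ge0].
have nL2 : nonneg_measurable (fun w => scale_lr xi m (scaling k y) w ^+ 2).
  exact: (nonneg_measurableM nL nL).
have nI : nonneg_measurable (\1_[set w | B (wsum m c w)] : Omega -> R).
  by apply: nonneg_measurable_indic; exact: mE.
have M'0 : 0 <= M^-1 by rewrite invr_ge0 ltW.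
rewrite -lee_fin -scaled_wsum_law// EFinD [v / M]mulrC !EFinM -vE.
rewrite -(expectation_indic_pr P (mE m c mB)) -!expectationZ_ge0 ?(ltW M0)//.
rewrite -expectationD_ge0//; last 2 first.
  by apply: nonneg_measurableM => //; exact: (nonneg_measurable_cst _ (ltW M0)).
  by apply: nonneg_measurableM => //; exact: nonneg_measurable_cst.
apply: expectation_le.
- exact: nonneg_measurableM.
- apply: nonneg_measurableD; apply: nonneg_measurableM => //;
  exact: (nonneg_measurable_cst _ (ltW _)).
- move=> w; rewrite indicE.
  have L0 := scale_lr_ge0 xi m (scaling k y) w.
  set L := scale_lr _ _ _ _ in L0 *.
  case: (_ \in _); rewrite ?mulr1 ?mulr0 ?add0r; last first.
    by rewrite mulr_ge0 ?sqr_ge0// invr_ge0 ltW.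
  have h : 0 <= M^-1 * L ^+ 2 by rewrite mulr_ge0 ?sqr_ge0// invr_ge0 ltW.
  have [LM|ML] := leP L M; first by lra.
  have : L <= M^-1 * L ^+ 2 by rewrite ler_pdivlMl// expr2 ler_pM2r// ?ltW//; lra.
  by lra.
Qed.

(** A total variation bound: [1 - L <= t / 2 + (L - 1)^2 / (2 t)] pointwise, and [L] has mean 1, so
    the square integrates to the second moment minus 1. The free parameter [t] takes the place of
    the Cauchy-Schwarz inequality. *)
Lemma scaled_wsum_lower m k c y (B : set R) (t : R) : (k <= m)%N -> 0 <= y ->
  measurable B -> 0 < t ->
  pr P [set w | B (wsum m c w)] <= pr P [set w | B (scaled_wsum m k c y w)] +
    t / 2 + (expR (k%:R * y ^+ 2 / 2) - 1) / (2 * t).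
Proof.
move=> km y0 mB t0.
have [v vE vle] := scale_lr_moment2 km y0.
have t20 : 0 < (2 * t)^-1 by rewrite invr_gt0; lra.
apply: (@le_trans _ _ (pr P [set w | B (scaled_wsum m k c y w)] + t / 2 + (v - 1) / (2 * t))); last first.
  by rewrite lerD2l ler_pM2r//; lra.
pose L := scale_lr xi m (scaling k y).
pose I : Omega -> R := \1_[set w | B (wsum m c w)].
have L0 w : 0 <= L w by exact: scale_lr_ge0.
have nL : nonneg_measurable L by split=> //; exact: (measurable_scale_lr xi_iid m _).
have nL2 : nonneg_measurable (fun w => L w ^+ 2) by exact: (nonneg_measurableM nL nL).
have nI : nonneg_measurable I by apply: nonneg_measurable_indic; exact: mE.
have t'0 : 0 <= t^-1 by rewrite invr_ge0 ltW.
have t2'0 := ltW t20.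
have L1 : (\int[P]_w (L w)%:E = 1)%E.
  have := @scaled_wsum_law m k c y setT y0 measurableT.
  rewrite -[pr P _]/(fine (P setT)) probability_setT => <-.
  by apply: eq_integral => w _; rewrite indicE mem_set// mulr1.
have nZ k0 f : 0 <= k0 -> nonneg_measurable f -> nonneg_measurable (fun w : Omega => k0 * f w : R).
  by move=> h nf; apply: nonneg_measurableM => //; exact: nonneg_measurable_cst.
have nC : nonneg_measurable (fun _ : Omega => t / 2 + (2 * t)^-1).
  by apply: nonneg_measurable_cst; lra.
(* The linear term of [(L - 1)^2 / (2 t)] is moved to the left, so that both integrands are
   non-negative and no integrability has to be checked. *)
have LHS : (\int[P]_w (I w + t^-1 * L w)%:E = (pr P [set w | B (wsum m c w)] + t^-1)%:E)%E.
  rewrite expectationD_ge0//; last exact: nZ.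
  by rewrite expectationZ_ge0// L1 mule1 expectation_indic_pr//; exact: mE.
have RHS : (\int[P]_w (L w * I w + ((2 * t)^-1 * L w ^+ 2 + (t / 2 + (2 * t)^-1)))%:E =
    (pr P [set w | B (scaled_wsum m k c y w)] + ((2 * t)^-1 * v + (t / 2 + (2 * t)^-1)))%:E)%E.
  rewrite (@expectationD_ge0 _ _ _ P (fun w => L w * I w)); last 2 first.
    exact: nonneg_measurableM.
    by apply: nonneg_measurableD => //; exact: nZ.
  rewrite scaled_wsum_law// expectationD_ge0//; last exact: nZ.
  by rewrite expectationZ_ge0// vE expectation_cst_pr.
have : pr P [set w | B (wsum m c w)] + t^-1 <=
  pr P [set w | B (scaled_wsum m k c y w)] + ((2 * t)^-1 * v + (t / 2 + (2 * t)^-1)).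
  rewrite -lee_fin -LHS -RHS; apply: expectation_le.
  - by apply: nonneg_measurableD => //; exact: nZ.
  - apply: nonneg_measurableD; first exact: nonneg_measurableM.
    by apply: nonneg_measurableD => //; exact: nZ.
  - move=> w; rewrite /I indicE.
    have tE : (t^-1 = 2 * (2 * t)^-1) by field; rewrite gt_eqF.
    have tt : t * (2 * t)^-1 = 2^-1 by field; rewrite gt_eqF.
    rewrite tE; set z := (2 * t)^-1 in tt t20 *; set x := L w.
    have hx : 0 <= x by exact: L0.
    have sq : 0 <= z * (x - 1 + t) ^+ 2 by rewrite mulr_ge0 ?sqr_ge0// ltW.
    have sq2 : 0 <= z * (x - 1) ^+ 2 by rewrite mulr_ge0 ?sqr_ge0// ltW.
    rewrite (_ : z * (x - 1 + t) ^+ 2 = z * (x - 1) ^+ 2 + 2 * (t * z) * (x - 1) + (t * z) * t) in sq; last by ring.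
    rewrite tt in sq.
    rewrite (_ : z * (x - 1) ^+ 2 = z * x ^+ 2 - 2 * z * x + z) in sq sq2; last by ring.
    by clearbody x z; case: (_ \in _); rewrite /= ?mulr1 ?mulr0 ?mulr0n ?mulr1n; lra.
rewrite (_ : (v - 1) / (2 * t) = (2 * t)^-1 * v - (2 * t)^-1); last by field; rewrite gt_eqF.
have tE : (t^-1 = 2 * (2 * t)^-1) by field; rewrite gt_eqF.
by rewrite tE; lra.
Qed.

End scaling_estimates.

(** * Chernoff bounds for weighted chi-square sums *)

Section exponential_bounds.
Context {R : realType}.

(** One factor of the exponential moment of a centred sum. After squaring,
    [1 / (1 - 2 c) = 1 + 2 c / (1 - 2 c)] is at most the exponential of [2 c / (1 - 2 c)], and this
    exponent is below [2 c + 8 c^2] because [4 c^2 (1 - 4 c) >= 0]; hence the limit [4^-1]. *)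
Lemma expRN_sqrt_le (c : R) : 0 <= c <= 4^-1 ->
  expR (- c) * (Num.sqrt (1 + 2 * - c))^-1 <= expR (4 * c ^+ 2).
Proof.
move=> /andP[c0 c4]; have d0 : 0 < 1 + 2 * - c by lra.
rewrite mulrC -ler_pdivlMr ?expR_gt0// -expRN -expRD opprK.
rewrite -(@ler_pXn2r _ 2) ?nnegrE ?expR_ge0 ?invr_ge0 ?sqrtr_ge0//.
rewrite exprVn sqr_sqrtr; last exact: ltW.
rewrite -expRM_natl [leLHS](_ : _ = 1 + 2 * c / (1 + 2 * - c)); last first.
  by field; rewrite gt_eqF.
apply: le_trans (expR_ge1Dx _) _; rewrite ler_expR ler_pdivrMr//.
have h : 0 <= c * c * (1 - 4 * c) by rewrite !mulr_ge0//; lra.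
by rewrite -subr_ge0 (_ : _ - _ = 4 * (c * c * (1 - 4 * c))); [lra|ring].
Qed.

Lemma expR_sqrt_le (c : R) : 0 <= c ->
  expR c * (Num.sqrt (1 + 2 * c))^-1 <= expR (4 * c ^+ 2).
Proof.
move=> c0; have d0 : 0 < 1 + 2 * c by lra.
rewrite mulrC -ler_pdivlMr ?expR_gt0// -expRN -expRD.
rewrite -(@ler_pXn2r _ 2) ?nnegrE ?expR_ge0 ?invr_ge0 ?sqrtr_ge0//.
rewrite exprVn sqr_sqrtr; last exact: ltW.
rewrite -expRM_natl [leLHS](_ : _ = 1 + (- (2 * c) / (1 + 2 * c))); last first.
  by field; rewrite gt_eqF.
apply: le_trans (expR_ge1Dx _) _; rewrite ler_expR ler_pdivrMr//.
have h : 0 <= c * c * (1 + 4 * c) by rewrite !mulr_ge0//; lra.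
by rewrite -subr_ge0 (_ : _ - _ = 4 * (c * c * (1 + 4 * c))); [lra|ring].
Qed.

Lemma expR_le_inv (x : R) : x < 1 -> expR x <= (1 - x)^-1.
Proof.
move=> x1; rewrite -[leLHS]invrK -expRN lef_pV2 ?posrE ?expR_gt0//; last lra.
exact: expR_ge1Dx.
Qed.

End exponential_bounds.

Section gaussian_tails.
Context {R : realType} d (Omega : measurableType d) (P : probability Omega R).
Variable xi : nat -> Omega -> R.
Hypothesis xi_iid : iid_std_normal P xi.
Local Notation wsum := (wsum xi).
Let mxi j : measurable_fun setT (xi j) := measurable_xi xi_iid j.

Lemma expectation_exp_wsum m (a l : nat -> R) : (forall j, - 2^-1 < l j) ->
  (\int[P]_w (expR (\sum_(j < m) a j - wsum m l w))%:E =
   (\prod_(j < m) (expR (a j) * (Num.sqrt (1 + 2 * l j))^-1))%:E)%E.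
Proof.
move=> l2.
have mf j : measurable_fun setT (fun x : R => expR (- l j * x ^+ 2)).
  apply: measurableT_comp => //=.
  by apply: measurable_funM => //; exact: measurable_funX.
rewrite -(@expectation_prod_xi _ _ _ _ _ xi_iid m
   (fun j x => expR (a j) * expR (- l j * x ^+ 2))
   (fun j => expR (a j) * (Num.sqrt (1 + 2 * l j))^-1)).
- apply: eq_integral => w _; congr EFin; rewrite /wsum -sumrB expR_sum.
  by apply: eq_bigr => j _; rewrite -expRD mulNr.
- by move=> j; apply: measurable_funM.
- by move=> j x; rewrite mulr_ge0 ?expR_ge0.
- move=> j; rewrite (@expectationZ_ge0 _ _ _ P (expR (a j)) (fun w => expR (- l j * xi j w ^+ 2))) ?expR_ge0//.
    by rewrite (normal_expectation_expsq (mxi j) (xi_law xi_iid j)).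
  by split=> [|w]; [exact: (measurableT_comp (mf j))|exact: expR_ge0].
Qed.

Lemma expectation_exp_linear m (u : nat -> R) :
  (\int[P]_w (expR (\sum_(j < m) u j * xi j w))%:E =
   (expR (\sum_(j < m) u j ^+ 2 / 2))%:E)%E.
Proof.
rewrite expR_sum -(@expectation_prod_xi _ _ _ _ _ xi_iid m (fun j x => expR (u j * x))
  (fun j => expR (u j ^+ 2 / 2))).
- by apply: eq_integral => w _; rewrite expR_sum.
- by move=> j; apply: measurableT_comp => //=; exact: measurable_funM.
- by move=> j x; exact: expR_ge0.
- by move=> j; rewrite (normal_expectation_exp (mxi j) (xi_law xi_iid j)).
Qed.

Lemma pr_linear_tail m (u : nat -> R) (K : R) :
  pr P [set w | K <= \sum_(j < m) u j * xi j w] <= expR (\sum_(j < m) u j ^+ 2 / 2 - K).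
Proof.
have mu : measurable_fun setT (fun w => \sum_(j < m) u j * xi j w).
  by apply: measurable_sum => j; exact: measurable_funM.
have nY : nonneg_measurable (fun w => expR (\sum_(j < m) u j * xi j w)).
  by split=> [|w]; [exact: measurableT_comp|exact: expR_ge0].
apply: (@pr_markov _ _ _ _ _ (fun w => expR (- K) * expR (\sum_(j < m) u j * xi j w))).
- by rewrite -[X in measurable X]setTI; apply: measurable_fun_le.
- by apply: measurable_funM => //; case: nY.
- by move=> w; rewrite mulr_ge0 ?expR_ge0.
- by move=> w /= h; rewrite -expRD -expR0 ler_expR; lra.
- by rewrite expectationZ_ge0 ?expR_ge0// expectation_exp_linear -EFinM -expRD addrC.
Qed.

(** Markov's inequality for the exponential of [a - l xi^2] summed over coordinates. The signs of
    [a] and [l] are left free so that both tails come from one bound. *)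
Lemma pr_wsum_tail (A : set Omega) m (a l : nat -> R) (K : R) : measurable A ->
  (forall j, - 2^-1 < l j) -> (forall w, A w -> K <= \sum_(j < m) a j - wsum m l w) ->
  pr P A <= expR (- K) * \prod_(j < m) (expR (a j) * (Num.sqrt (1 + 2 * l j))^-1).
Proof.
move=> mA l2 AK.
have nY : nonneg_measurable (fun w => expR (\sum_(j < m) a j - wsum m l w)).
  split=> [|w]; last exact: expR_ge0.
  apply: measurableT_comp => //=; apply: measurable_funB => //.
  exact: (measurable_wsum xi_iid).
apply: (@pr_markov _ _ _ _ _ (fun w => expR (- K) * expR (\sum_(j < m) a j - wsum m l w))).
- exact: mA.
- by apply: measurable_funM => //; case: nY.
- by move=> w; rewrite mulr_ge0 ?expR_ge0.
- by move=> w /= /AK h; rewrite -expRD -expR0 ler_expR; lra.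
- by rewrite expectationZ_ge0 ?expR_ge0// expectation_exp_wsum// -EFinM.
Qed.

Let mle m c s : measurable [set w | wsum m c w <= s].
Proof.
by rewrite -[X in measurable X]setTI; apply: measurable_fun_le => //; exact: (measurable_wsum xi_iid).
Qed.

Let mge m c s : measurable [set w | s <= wsum m c w].
Proof.
by rewrite -[X in measurable X]setTI; apply: measurable_fun_le => //; exact: (measurable_wsum xi_iid).
Qed.

Lemma pr_sumsq_small k : pr P [set w | wsum k (fun=> 1) w <= k%:R / 6] <= (2 / 3) ^+ k.
Proof.
(* [l = 3 / 2] makes [sqrt (1 + 2 l)] equal to 2, and [exp (1/4) <= 4/3] then gives a factor at most
   [2/3] per coordinate. *)
apply: le_trans (@pr_wsum_tail _ k (fun=> 0) (fun=> 3 / 2) (- (k%:R / 4)) _ _ _) _.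
- exact: mle.
- by move=> _; lra.
- move=> w /=; rewrite big1// sub0r => h.
  have -> : wsum k (fun=> 3 / 2) w = 3 / 2 * wsum k (fun=> 1) w.
    by rewrite /wsum mulr_sumr; apply: eq_bigr => j _; rewrite mul1r.
  by lra.
- rewrite prodr_const card_ord expR0 mul1r opprK mulrC.
  rewrite expRM_natl -exprMn.
  rewrite lerXn2r ?nnegrE ?mulr_ge0 ?expR_ge0 ?invr_ge0 ?sqrtr_ge0//.
  rewrite (_ : 1 + 2 * (3 / 2) = 2 ^+ 2); last by field.
  rewrite sqrtr_sqr ger0_norm//.
  have := @expR_le_inv R (4^-1); rewrite (_ : (1 - 4^-1)^-1 = 4 / 3); last by field.
  by move=> /(_ ltac:(lra)) h; lra.
Qed.

Lemma pr_sumsq_large k : pr P [set w | 8 * k%:R <= wsum k (fun=> 1) w] <= (2 / 3) ^+ k.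
Proof.
(* [l = - 3/8] makes [sqrt (1 + 2 l)] equal to [1/2]; with [exp (-3) <= 1/4] the factor per
   coordinate is at most [1/2]. *)
apply: le_trans (@pr_wsum_tail _ k (fun=> 0) (fun=> - (3 / 8)) (3 * k%:R) _ _ _) _.
- exact: mge.
- by move=> _; lra.
- move=> w /=; rewrite big1// sub0r => h.
  have -> : wsum k (fun=> - (3 / 8)) w = - (3 / 8) * wsum k (fun=> 1) w.
    by rewrite /wsum mulr_sumr; apply: eq_bigr => j _; rewrite mul1r.
  by lra.
- rewrite prodr_const card_ord expR0 mul1r mulrC.
  rewrite (_ : - (3 * k%:R) = k%:R * - 3); last by ring.
  rewrite expRM_natl -exprMn.
  rewrite lerXn2r ?nnegrE ?mulr_ge0 ?expR_ge0 ?invr_ge0 ?sqrtr_ge0//.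
  rewrite (_ : 1 + 2 * - (3 / 8) = (2^-1) ^+ 2); last by field.
  rewrite sqrtr_sqr ger0_norm// invrK expRN.
  have := @expR_ge1Dx R 3 => h.
  have : (expR 3)^-1 <= 4^-1 :> R by rewrite lef_pV2 ?posrE ?expR_gt0//; lra.
  by lra.
Qed.

Let prod_exp_le m (c F : nat -> R) (V : R) : \sum_(j < m) c j ^+ 2 <= V ->
  (forall j, 0 <= F j <= expR (4 * c j ^+ 2)) -> \prod_(j < m) F j <= expR (4 * V).
Proof.
move=> cV FF; apply: (@le_trans _ _ (\prod_(j < m) expR (4 * c j ^+ 2))).
  by apply: ler_prod.
by rewrite -expR_sum ler_expR -mulr_sumr ler_pM2l.
Qed.

Lemma pr_wsum_upper_tail m (c : nat -> R) (V K : R) :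
  (forall j, 0 <= c j <= 4^-1) -> \sum_(j < m) c j ^+ 2 <= V ->
  pr P [set w | \sum_(j < m) c j + K <= wsum m c w] <= expR (4 * V - K).
Proof.
move=> c4 cV.
apply: le_trans (@pr_wsum_tail _ m (fun j => - c j) (fun j => - c j) K _ _ _) _.
- exact: mge.
- by move=> j; have := c4 j; lra.
- move=> w /= h; rewrite sumrN.
  have -> : wsum m (fun j => - c j) w = - wsum m c w.
    by rewrite /wsum -sumrN; apply: eq_bigr => j _; rewrite mulNr.
  by lra.
- rewrite addrC expRD ler_wpM2l ?expR_ge0//.
  apply: (@prod_exp_le m c (fun j => expR (- c j) * (Num.sqrt (1 + 2 * - c j))^-1) V cV) => j.
  by rewrite mulr_ge0 ?expR_ge0 ?invr_ge0 ?sqrtr_ge0//= expRN_sqrt_le.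
Qed.

Lemma pr_wsum_lower_tail m (c : nat -> R) (V K : R) :
  (forall j, 0 <= c j) -> \sum_(j < m) c j ^+ 2 <= V ->
  pr P [set w | wsum m c w <= \sum_(j < m) c j - K] <= expR (4 * V - K).
Proof.
move=> c0 cV.
apply: le_trans (@pr_wsum_tail _ m c c K _ _ _) _.
- exact: mle.
- by move=> j; have := c0 j; lra.
- by move=> w /= h; lra.
- rewrite addrC expRD ler_wpM2l ?expR_ge0//.
  apply: (@prod_exp_le m c (fun j => expR (c j) * (Num.sqrt (1 + 2 * c j))^-1) V cV) => j.
  by rewrite mulr_ge0 ?expR_ge0 ?invr_ge0 ?sqrtr_ge0//= expR_sqrt_le.
Qed.

End gaussian_tails.

(** * Anticoncentration and interval mass for finite sums *)

Section quasi_invariance.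
Context {R : realType} d (Omega : measurableType d) (P : probability Omega R).
Variable xi : nat -> Omega -> R.
Hypothesis xi_iid : iid_std_normal P xi.
Local Notation wsum := (wsum xi).
Local Notation scaled_wsum := (scaled_wsum xi).

Let mzle k s : measurable [set w | wsum k (fun=> 1) w <= s].
Proof.
rewrite -[X in measurable X]setTI; apply: measurable_fun_le => //.
exact: (measurable_wsum xi_iid).
Qed.

Let mzge k s : measurable [set w | s <= wsum k (fun=> 1) w].
Proof.
rewrite -[X in measurable X]setTI; apply: measurable_fun_le => //.
exact: (measurable_wsum xi_iid).
Qed.

Let mgt m c s : measurable [set w | s < wsum m c w].
Proof.
rewrite [X in measurable X](_ : _ = ~` [set w | wsum m c w <= s]); last first.
  by apply/seteqP; split=> w /=; rewrite ltNge => /negP.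
apply: measurableC; rewrite -[X in measurable X]setTI; apply: measurable_fun_le => //.
exact: (measurable_wsum xi_iid).
Qed.

Lemma wsum_ge_cst k (c : nat -> R) (b : R) w : (forall j, (j < k)%N -> b <= c j) ->
  b * wsum k (fun=> 1) w <= wsum k c w.
Proof.
move=> bc; rewrite /wsum mulr_sumr; apply: ler_sum => j _.
by rewrite mul1r ler_wpM2r ?sqr_ge0// bc.
Qed.

Lemma wsum_le_cst k (c : nat -> R) (b : R) w : (forall j, (j < k)%N -> c j <= b) ->
  wsum k c w <= b * wsum k (fun=> 1) w.
Proof.
move=> bc; rewrite /wsum mulr_sumr; apply: ler_sum => j _.
by rewrite mul1r ler_wpM2r ?sqr_ge0// bc.
Qed.

(* The scalings y = i / (M^2 sqrt k), i < M, change the law by O(1/M) in total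
   variation but move the value of the sum across M disjoint intervals. *)
Lemma wsum_anticoncentration m k (c : nat -> R) (b s : R) (M : nat) :
  (0 < k <= m)%N -> (0 < M)%N -> 0 < b ->
  (forall j, (j < k)%N -> b / Num.sqrt k%:R <= c j) ->
  pr P [set w | `]s - b / (24 * M%:R ^+ 2), s]%classic (wsum m c w)] <=
  2 / M%:R + (2 / 3) ^+ k.
Proof.
move=> /andP[k0 km] M0 b0 bc.
set q := Num.sqrt (k%:R : R); set B := `]_, s]%classic.
have mB : measurable B by exact: measurable_itv.
have kR : (1 : R) <= k%:R by rewrite ler1n.
have q2 : q ^+ 2 = k%:R by rewrite sqr_sqrtr.
have q1 : 1 <= q by rewrite -sqrtr1 ler_sqrt.
have q0 : 0 < q by lra.
have MR : (1 : R) <= M%:R by rewrite ler1n.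
pose y (i : nat) := i%:R / (M%:R ^+ 2 * q) : R.
have dn0 : 0 < M%:R ^+ 2 * q by rewrite mulr_gt0// exprn_gt0//; lra.
have y0 i : 0 <= y i by rewrite divr_ge0// ltW.
have y1 i : (i < M)%N -> y i <= 1.
  move=> iM; rewrite ler_pdivrMr// mul1r (@le_trans _ _ M%:R) ?ler_nat ?(ltnW iM)//.
  by rewrite expr2 -mulrA ler_peMr ?ler0n// mulr_ege1.
pose A i := [set w | B (scaled_wsum m k c (y i) w)] `\` [set w | wsum k (fun=> 1) w <= k%:R / 6].
have mA i : measurable (A i).
  by apply: measurableD => //; exact: (measurable_scaled_wsum_event xi_iid).
(* Off the removed event the first [k] terms sum to at least [b q / 6], and two values of
   [y / (1 + y)] differ by at least [1 / (4 M^2 q)]. The product is the interval length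
   [b / (24 M^2)], so one outcome cannot lie in two of the sets. *)
have shift i i' w : (i < i')%N -> (i' < M)%N -> A i w -> A i' w -> False.
  move=> ii' i'M [/= hA /negP +] [/= hA' _]; rewrite -ltNge => hz.
  move: hA hA'; rewrite /B/= !in_itv/= !scaled_wsumE// => /andP[_ h2] /andP[h1 _].
  have X0 := @wsum_ge_cst k c (b / q) w bc.
  have X1 : b * q / 6 <= wsum k c w.
    apply: le_trans X0; rewrite [leLHS](_ : _ = b / q * (k%:R / 6)); last first.
      by rewrite -q2; field; rewrite gt_eqF.
    by rewrite ler_wpM2l ?(ltW hz)// divr_ge0// ltW.
  have hy : (4 * (M%:R ^+ 2 * q))^-1 <= y i' / (1 + y i') - y i / (1 + y i).
    have a0 := y0 i; have a1 := y1 _ (ltn_trans ii' i'M).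
    have c0 := y0 i'; have c1 := y1 _ i'M.
    have p0 : 0 < 1 + y i by lra.
    have p1 : 0 < 1 + y i' by lra.
    rewrite [leRHS](_ : _ = (y i' - y i) / ((1 + y i) * (1 + y i'))); last first.
      by field; rewrite !gt_eqF.
    have pp : (1 + y i) * (1 + y i') <= 4.
      by rewrite (_ : 4 = 2 * 2); [apply: ler_pM; lra|ring].
    rewrite ler_pdivlMr ?mulr_gt0// invfM mulrC mulrA.
    apply: (@le_trans _ _ (M%:R ^+ 2 * q)^-1).
      by rewrite ler_piMl ?invr_ge0 ?(ltW dn0)// ler_pdivrMr//; lra.
    have ii1 : i%:R + 1 <= i'%:R :> R by rewrite natr1 ler_nat.
    by rewrite /y -mulrBl -[leLHS]mul1r ler_wpM2r ?invr_ge0 ?(ltW dn0)//; lra.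
  have : b * q / 6 * (4 * (M%:R ^+ 2 * q))^-1 <=
     wsum k c w * (y i' / (1 + y i') - y i / (1 + y i)).
    apply: ler_pM => //; first by rewrite divr_ge0// mulr_ge0// ltW.
    by rewrite invr_ge0 mulr_ge0// ltW.
  rewrite (_ : b * q / 6 * _ = b / (24 * M%:R ^+ 2)); last first.
    by field; rewrite ?gt_eqF//; lra.
  by rewrite mulrBr; lra.
have tA : trivIset [set i | (i < M)%N] A.
  apply/trivIsetP => i i' /= iM i'M; rewrite neq_ltn => ii'.
  apply/seteqP; split=> // w [Ai Ai']; case/orP: ii' => ii'.
    exact: (shift i i' w).
  exact: (shift i' i w).
have h1 := pr_disjoint_sum_le1 P mA tA.
set p := pr P _.
(* With [t = 1 / M] in the total variation bound and second moment at most [1 + 1 / M^2], scaling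
   costs at most [1 / M]. Summing over the [M] disjoint sets bounds [M p] by 2 plus [M] times the
   removed probability. *)
have hi i : (i < M)%N -> p <= pr P (A i) + (2 / 3) ^+ k + M%:R^-1.
  move=> iM; have M'0 : 0 < M%:R^-1 :> R by rewrite invr_gt0; lra.
  have := @scaled_wsum_lower _ _ _ P xi xi_iid m k c (y i) B _ km (y0 i) mB M'0.
  have h2 : pr P [set w | B (scaled_wsum m k c (y i) w)] <= pr P (A i) + (2 / 3) ^+ k.
    apply: (@le_trans _ _ (pr P (A i) + pr P [set w | wsum k (fun=> 1) w <= k%:R / 6])).
      apply: pr_setU_le => //; first exact: (measurable_scaled_wsum_event xi_iid).
      by move=> w Bw; have [|] := pselect (wsum k (fun=> 1) w <= k%:R / 6); [right|left].
    by rewrite lerD2l; exact: (pr_sumsq_small xi_iid).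
  have h3 : expR (k%:R * y i ^+ 2 / 2) <= 1 + M%:R^-1 ^+ 2.
    have -> : k%:R * y i ^+ 2 / 2 = (i%:R / M%:R) ^+ 2 * (M%:R^-1 ^+ 2 / 2).
      by rewrite /y -q2; field; rewrite !gt_eqF//; lra.
    have M1 : M%:R^-1 <= 1 :> R by rewrite invf_le1//; lra.
    have x1 : (M%:R^-1 : R) ^+ 2 <= 1 by rewrite expr_le1// ltW.
    have x0 : 0 <= (M%:R^-1 : R) ^+ 2 by rewrite sqr_ge0.
    apply: (@le_trans _ _ (expR (M%:R^-1 ^+ 2 / 2))).
      rewrite ler_expR ler_piMl ?divr_ge0// expr_le1 ?divr_ge0//.
      by rewrite ler_pdivrMr ?mul1r ?ler_nat ?(ltnW iM)//; lra.
    apply: le_trans (expR_le_inv _) _; first lra.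
    set x := _ ^+ 2 in x0 x1 *.
    rewrite -[leLHS]mul1r ler_pdivrMr; last lra.
    have xx : 0 <= x * (1 - x) by rewrite mulr_ge0//; lra.
    by rewrite -subr_ge0 (_ : _ - _ = x * (1 - x) / 2); [lra|field].
  rewrite -/p => h; apply: (le_trans h).
  have : (expR (k%:R * y i ^+ 2 / 2) - 1) / (2 * M%:R^-1) <= M%:R^-1 / 2.
    rewrite ler_pdivrMr; last lra.
    by rewrite expr2 in h3; lra.
  by lra.
have : \sum_(i < M) p <= \sum_(i < M) (pr P (A i) + ((2 / 3) ^+ k + M%:R^-1)).
  by apply: ler_sum => i _; rewrite addrA; exact: hi.
rewrite big_split/= !sumr_const card_ord -[p *+ M]mulr_natl -[(_ + _) *+ M]mulr_natl => h.
have M0' : 0 < M%:R :> R by lra.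
rewrite -(ler_pM2l M0') mulrDr (_ : M%:R * (2 / M%:R) = 2); last by field; rewrite gt_eqF.
move: h; rewrite mulrDr mulfV ?gt_eqF//.
by lra.
Qed.

(* Scaling down from {sum > s} in steps of at most delta has to hit ]s - delta, s]. *)
Lemma wsum_interval_mass m k (c : nat -> R) (b B0 s delta T M' : R) (N : nat) :
  (0 < k <= m)%N -> 0 < b -> 0 < B0 -> 0 < delta -> 0 < M' ->
  (forall j, (j < k)%N -> b / Num.sqrt k%:R <= c j <= B0 / Num.sqrt k%:R) ->
  N%:R * (delta / (8 * B0)) <= Num.sqrt k%:R ->
  T <= b * (N%:R * (delta / (8 * B0))) / 12 ->
  pr P [set w | s < wsum m c w] <= pr P [set w | s + T < wsum m c w] + 2 * (2 / 3) ^+ k +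
    N.+1%:R * (M' * pr P [set w | `]s - delta, s]%classic (wsum m c w)] +
       expR ((N%:R * (delta / (8 * B0))) ^+ 2 / 2) / M').
Proof.
move=> /andP[k0 km] b0 B00 delta0 M'0 bc Nq TN.
set q := Num.sqrt (k%:R : R) in bc Nq *; set B := `]_, s]%classic.
set tau := delta / (8 * B0) in Nq TN *.
have mB : measurable B by exact: measurable_itv.
have kR : (1 : R) <= k%:R by rewrite ler1n.
have q2 : q ^+ 2 = k%:R by rewrite sqr_sqrtr.
have q1 : 1 <= q by rewrite -sqrtr1 ler_sqrt.
have q0 : 0 < q by lra.
have tau0 : 0 < tau by rewrite divr_gt0// mulr_gt0.
(* The first [k] terms sum to at most [8 B0 q] outside [C], so one step [tau / q] of the scaling
   lowers the sum by at most [8 B0 tau = delta]. *)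
pose y (i : nat) := i%:R * tau / q : R.
have y0 i : 0 <= y i.
  by apply: divr_ge0; [apply: mulr_ge0 => //; exact: ltW|exact: ltW].
pose E i := [set w | B (scaled_wsum m k c (y i) w)].
pose C := [set w | s + T < wsum m c w] `|`
  ([set w | wsum k (fun=> 1) w <= k%:R / 6] `|` [set w | 8 * k%:R <= wsum k (fun=> 1) w]).
have mC : measurable C by apply: measurableU => //; apply: measurableU.
have mE i : measurable (E i) by exact: (measurable_scaled_wsum_event xi_iid).
have sub : [set w | s < wsum m c w] `<=` C `|` [set w | exists2 i, (i < N.+1)%N & E i w].
  move=> w /= sw; have [|nC] := pselect (C w); [by left|right].
  have hT : wsum m c w <= s + T by rewrite leNgt; apply/negP => h; apply: nC; left.
  have z1 : k%:R / 6 <= wsum k (fun=> 1) w.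
    by rewrite ltW// ltNge; apply/negP => h; apply: nC; right; left.
  have z2 : wsum k (fun=> 1) w <= 8 * k%:R.
    by rewrite ltW// ltNge; apply/negP => h; apply: nC; right; right.
  have X1 : b * q / 6 <= wsum k c w.
    apply: le_trans (@wsum_ge_cst k c (b / q) w _); last by move=> j /bc/andP[].
    rewrite [leLHS](_ : _ = b / q * (k%:R / 6)); last first.
      by rewrite -q2; field; rewrite gt_eqF.
    by rewrite ler_wpM2l// divr_ge0// ltW.
  have X2 : wsum k c w <= 8 * B0 * q.
    apply: le_trans (@wsum_le_cst k c (B0 / q) w _) _; first by move=> j /bc/andP[].
    rewrite [leRHS](_ : _ = B0 / q * (8 * k%:R)); last first.
      by rewrite -q2; field; rewrite gt_eqF.
    by rewrite ler_wpM2l// divr_ge0// ltW.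
  have X0 : 0 <= wsum k c w by apply: le_trans X1; rewrite divr_ge0// mulr_ge0// ltW.
  have iN : exists2 i, (i < N.+1)%N & scaled_wsum m k c (y i) w <= s /\
      (forall i', (i' < i)%N -> s < scaled_wsum m k c (y i') w).
    (* Outside [C] the sum exceeds [s] by at most [T], while the last scaling lowers it by at least
       [(b q / 6) (y N / 2) = b N tau / 12]. *)
    have sN : scaled_wsum m k c (y N) w <= s.
      rewrite scaled_wsumE//.
      have yN1 : y N <= 1 by rewrite ler_pdivrMr// mul1r.
      have yN0 := y0 N.
      have : b * q / 6 * (y N / 2) <= wsum k c w * (y N / (1 + y N)).
        apply: ler_pM => //; [by rewrite divr_ge0// mulr_ge0// ltW|lra|].
        by rewrite ler_wpM2l// lef_pV2 ?posrE; lra.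
      rewrite (_ : b * q / 6 * (y N / 2) = b * (N%:R * tau) / 12); last first.
        by rewrite /y; field; rewrite gt_eqF.
      by lra.
    have exN' : exists i, (fun i => scaled_wsum m k c (y i) w <= s) i by exists N.
    case: (ex_minnP exN') => i hi himin; exists i; first by rewrite ltnS himin.
    split=> // i' i'i; rewrite ltNge; apply/negP => h.
    by have := himin _ h; rewrite leqNgt i'i.
  have [i iN' [hs hmin]] := iN; exists i => //.
  rewrite /E /B/= in_itv/= hs andbT.
  (* The first index with value at most [s] is not 0, since the scaling [y 0 = 0] leaves the sum
     above [s]; the preceding value is above [s], so the step lands in the interval. *)
  case: i iN' hs hmin => [_|i iN' hs hmin].
    by rewrite scaled_wsumE// /y !mul0r mulr0 subr0; lra.
  have := hmin i (ltnSn _); rewrite !scaled_wsumE// => h.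
  have a0 := y0 i; have a1 := y0 i.+1.
  have p0 : 0 < 1 + y i by lra.
  have p1 : 0 < 1 + y i.+1 by lra.
  have hy : y i.+1 / (1 + y i.+1) - y i / (1 + y i) <= tau / q.
    rewrite [leLHS](_ : _ = (y i.+1 - y i) / ((1 + y i) * (1 + y i.+1))); last first.
      by field; rewrite !gt_eqF.
    have -> : y i.+1 - y i = tau / q by rewrite /y -natr1; ring.
    apply: ler_piMr; first by apply: divr_ge0; exact: ltW.
    by rewrite invf_le1 ?mulr_gt0// mulr_ege1//; lra.
  have hy0 : 0 <= y i.+1 / (1 + y i.+1) - y i / (1 + y i).
    rewrite (_ : _ - _ = (y i.+1 - y i) / ((1 + y i) * (1 + y i.+1))); last first.
      by field; rewrite !gt_eqF.
    have -> : y i.+1 - y i = tau / q by rewrite /y -natr1; ring.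
    by apply: divr_ge0; [apply: divr_ge0; exact: ltW|apply: mulr_ge0; exact: ltW].
  have : wsum k c w * (y i.+1 / (1 + y i.+1) - y i / (1 + y i)) <= 8 * B0 * q * (tau / q).
    exact: ler_pM.
  rewrite (_ : 8 * B0 * q * (tau / q) = delta); last first.
    by rewrite /tau; field; rewrite !gt_eqF.
  by rewrite mulrBr; lra.
apply: le_trans (pr_bigcup_le P (mgt m c s) mE mC sub) _.
apply: lerD.
  rewrite (_ : 2 * (2 / 3) ^+ k = (2 / 3) ^+ k + (2 / 3) ^+ k); last by ring.
  apply: (@le_trans _ _ (pr P [set w | s + T < wsum m c w] +
    pr P ([set w | wsum k (fun=> 1) w <= k%:R / 6] `|` [set w | 8 * k%:R <= wsum k (fun=> 1) w]))).
    by apply: pr_setU_le => //; apply: measurableU.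
  rewrite lerD2l; apply: (@le_trans _ _ (pr P [set w | wsum k (fun=> 1) w <= k%:R / 6] +
    pr P [set w | 8 * k%:R <= wsum k (fun=> 1) w])).
    by apply: pr_setU_le => //; apply: measurableU.
  by apply: lerD; [exact: (pr_sumsq_small xi_iid)|exact: (pr_sumsq_large xi_iid)].
rewrite (_ : N.+1%:R * _ = \sum_(i < N.+1) (M' * pr P [set w | B (wsum m c w)] +
    expR ((N%:R * tau) ^+ 2 / 2) / M')); last first.
  by rewrite sumr_const card_ord -[RHS]mulr_natl.
apply: ler_sum => i _.
apply: le_trans (@scaled_wsum_upper _ _ _ P xi xi_iid m k c (y i) B M' km (y0 i) mB M'0) _.
rewrite lerD2l ler_pM2r ?invr_gt0// ler_expR.
rewrite (_ : k%:R * y i ^+ 2 / 2 = (i%:R * tau) ^+ 2 / 2); last first.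
  by rewrite /y -q2; field; rewrite gt_eqF.
rewrite ler_pM2r//; apply: lerXn2r.
- by rewrite nnegrE mulr_ge0// ltW.
- by rewrite nnegrE mulr_ge0// ltW.
- by rewrite ler_pM2r// ler_nat -ltnS.
Qed.

End quasi_invariance.

(** * Passage from partial sums to series *)

Section infinite_sums.
Context {R : realType} d (Omega : measurableType d) (P : probability Omega R).

(** Trades an inequality in the extended reals for real inequalities on all partial sums, the form
    in which the later estimates are carried out. *)
Lemma nneseries_le_fin (a : nat -> R) (s : R) : (forall j, 0 <= a j) ->
  (\sum_(j <oo) (a j)%:E <= s%:E)%E <-> forall m, \sum_(j < m) a j <= s.
Proof.
move=> a0; split=> [h m|h].
  rewrite -lee_fin; apply: le_trans h; rewrite -sumEFin -(big_mkord xpredT (fun j => (a j)%:E)).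
  by apply: nneseries_lim_ge => j _; rewrite lee_fin.
apply: lime_le; first by apply: is_cvg_nneseries => j _; rewrite lee_fin.
by apply: nearW => m; rewrite big_mkord sumEFin lee_fin.
Qed.

Variable a : nat -> Omega -> R.
Hypothesis a0 : forall j w, 0 <= a j w.
Hypothesis ma : forall j, measurable_fun setT (a j).

Let mS m s : measurable [set w | \sum_(j < m) a j w <= s].
Proof.
rewrite -[X in measurable X]setTI; apply: measurable_fun_le => //.
exact: measurable_sum.
Qed.

Lemma series_event s : [set w | (\sum_(j <oo) (a j w)%:E <= s%:E)%E] =
  \bigcap_m [set w | \sum_(j < m) a j w <= s].
Proof.
apply/seteqP; split=> w /=; first by move=> /nneseries_le_fin => h m _; apply: h.
by move=> h; apply/nneseries_le_fin => // m; exact: h.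
Qed.

Lemma measurable_series_event s :
  measurable [set w | (\sum_(j <oo) (a j w)%:E <= s%:E)%E].
Proof. by rewrite series_event; apply: bigcap_measurableType => m _; exact: mS. Qed.

(** The terms are non-negative, so the events for partial sums decrease to the event for the series
    and continuity from above applies. This is why events are phrased with a non-strict upper
    bound. *)
Lemma cvg_pr_series s : pr P [set w | \sum_(j < m) a j w <= s] @[m --> \oo] -->
  pr P [set w | (\sum_(j <oo) (a j w)%:E <= s%:E)%E].
Proof.
apply: fine_cvg; rewrite -prE; last exact: measurable_series_event.
rewrite series_event; apply: nonincreasing_cvg_mu => //.
- by have := probability_le1 P (mS 0 s) => h; exact: le_lt_trans h (ltry _).
- by apply: bigcap_measurableType => m _; exact: mS.
- move=> m n mn; apply/subsetPset => w /=; apply: le_trans.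
  rewrite -(subnKC mn) big_split_ord/= lerDl; apply: sumr_ge0 => j _.
  exact: a0.
Qed.

Lemma pr_series_le s m : pr P [set w | (\sum_(j <oo) (a j w)%:E <= s%:E)%E] <=
  pr P [set w | \sum_(j < m) a j w <= s].
Proof.
apply: pr_le; [exact: measurable_series_event|exact: mS|].
by rewrite series_event => w /(_ m); exact.
Qed.

End infinite_sums.

Section chi_square_series.
Context {R : realType} d (Omega : measurableType d) (P : probability Omega R).
Variable xi : nat -> Omega -> R.
Hypothesis xi_iid : iid_std_normal P xi.
Local Notation wsum := (wsum xi).

Definition cdf_wsum (m : nat) (c : nat -> R) (s : R) : R := pr P [set w | wsum m c w <= s].

Definition cdf_wser (c : nat -> R) (s : R) : R :=
  pr P [set w | (\sum_(j <oo) (c j * xi j w ^+ 2)%:E <= s%:E)%E].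

Let mle m c s : measurable [set w | wsum m c w <= s].
Proof.
by rewrite -[X in measurable X]setTI; apply: measurable_fun_le => //; exact: (measurable_wsum xi_iid).
Qed.

Lemma pr_wsum_gt m c s : pr P [set w | s < wsum m c w] = 1 - cdf_wsum m c s.
Proof.
rewrite -pr_setC//; congr (pr P _); apply/seteqP.
by split=> w /=; rewrite ltNge => /negP.
Qed.

Lemma pr_wsum_itv m c s t : t <= s ->
  pr P [set w | `]t, s]%classic (wsum m c w)] = cdf_wsum m c s - cdf_wsum m c t.
Proof.
move=> ts; apply/eqP; rewrite -subr_eq0 opprB addrA subr_eq0; apply/eqP.
have mI : measurable [set w | `]t, s]%classic (wsum m c w)].
  by apply: (measurable_wsum_event xi_iid); exact: measurable_itv.
apply: EFin_inj; rewrite EFinD -!prE// -measureU//.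
  congr (P _); apply/seteqP; split=> w /=; rewrite in_itv/=.
    by move=> [/andP[]//|h]; exact: le_trans ts.
  by move=> ws; have [|tw] := leP (wsum m c w) t; [right|left].
apply/seteqP; split=> // w [/=]; rewrite in_itv/= => /andP[tw _].
by rewrite leNgt tw.
Qed.

Section nonneg.
Variable c : nat -> R.
Hypothesis c0 : forall j, 0 <= c j.

Let t0 j w : 0 <= c j * xi j w ^+ 2. Proof. by rewrite mulr_ge0 ?sqr_ge0. Qed.
Let mt j : measurable_fun setT (fun w => c j * xi j w ^+ 2).
Proof. by apply: measurable_funM => //; apply: measurable_funX; exact: (measurable_xi xi_iid). Qed.

Lemma cvg_cdf_wsum s : cdf_wsum m c s @[m --> \oo] --> cdf_wser c s.
Proof. exact: (@cvg_pr_series _ _ _ P (fun j w => c j * xi j w ^+ 2) t0 mt s). Qed.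

Lemma cdf_wser_le_wsum s m : cdf_wser c s <= cdf_wsum m c s.
Proof. exact: (pr_series_le P t0 mt). Qed.

Lemma measurable_wser_event s :
  measurable [set w | (\sum_(j <oo) (c j * xi j w ^+ 2)%:E <= s%:E)%E].
Proof. exact: measurable_series_event. Qed.

Lemma cdf_wser_homo s t : s <= t -> cdf_wser c s <= cdf_wser c t.
Proof.
move=> st; apply: pr_le; [exact: measurable_wser_event|exact: measurable_wser_event|].
by move=> w /= h; rewrite (le_trans h)// lee_fin.
Qed.

Lemma cdf_wser_lt0 s : s < 0 -> cdf_wser c s = 0.
Proof.
move=> s0; rewrite /cdf_wser (_ : [set w | _] = set0) /pr ?measure0//.
apply/seteqP; split=> // w /=; apply/negP; rewrite -ltNge.
apply: (@lt_le_trans _ _ 0%E); first by rewrite lte_fin.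
by apply: nneseries_ge0 => j _ _; rewrite lee_fin.
Qed.

Variables (k : nat) (D b B0 V : R).
Hypotheses (k0 : (0 < k)%N) (D0 : 0 < D) (b0 : 0 < b) (B00 : 0 < B0).
Hypothesis c_low : forall j, (j < k)%N -> b / D / Num.sqrt k%:R <= c j.
Hypothesis c_high : forall j, c j <= B0 / D / Num.sqrt k%:R.
Hypothesis c_sq : forall m, \sum_(j < m) (D * c j) ^+ 2 <= V.

(** The right side is free of [m], so the finite bound survives the limit with [k] fixed. Here and
    below [D] stands for [Nn n ^+ 2], the factor that gives the sum fluctuations of order one. *)
Lemma wser_anticoncentration (M : nat) s : (0 < M)%N ->
  cdf_wser c s - cdf_wser c (s - b / D / (24 * M%:R ^+ 2)) <= 2 / M%:R + (2 / 3) ^+ k.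
Proof.
move=> M0; set e := b / D / _.
have e0 : 0 <= e by rewrite !divr_ge0 ?mulr_ge0 ?sqr_ge0// ltW.
have cv : cdf_wsum m c s - cdf_wsum m c (s - e) @[m --> \oo] -->
    cdf_wser c s - cdf_wser c (s - e).
  by apply: cvgB; exact: cvg_cdf_wsum.
apply: (cvgr_to_le cv).
near=> m; rewrite -pr_wsum_itv; last lra.
apply: wsum_anticoncentration => //; last by rewrite divr_gt0.
by rewrite k0/=; near: m; exists k.
Unshelve. all: by end_near. Qed.

Let wsum_scale m w : wsum m (fun j => D * c j) w = D * wsum m c w.
Proof. by rewrite /wsum mulr_sumr; apply: eq_bigr => j _; rewrite mulrA. Qed.

Hypothesis c_small : B0 / Num.sqrt k%:R <= 4^-1.

Let Dc4 j : 0 <= D * c j <= 4^-1.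
Proof.
apply/andP; split; first by rewrite mulr_ge0// ltW.
apply: le_trans c_small; rewrite -ler_pdivlMl//.
by rewrite (_ : D^-1 * _ = B0 / D / Num.sqrt k%:R) ?c_high//; ring.
Qed.

Lemma cdf_wsum_upper m K : 1 - cdf_wsum m c (\sum_(j < m) c j + K / D) <= expR (4 * V - K).
Proof.
rewrite -pr_wsum_gt; apply: le_trans (@pr_wsum_upper_tail _ _ _ P _ xi_iid m (fun j => D * c j) V K Dc4 (c_sq m)).
apply: pr_le.
- rewrite [X in measurable X](_ : _ = ~` [set w | wsum m c w <= \sum_(j < m) c j + K / D]); last first.
    by apply/seteqP; split=> w /=; rewrite ltNge => /negP.
  exact: measurableC.
- rewrite -[X in measurable X]setTI; apply: measurable_fun_le => //.
  exact: (measurable_wsum xi_iid).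
- move=> w /= /ltW h; rewrite wsum_scale -mulr_sumr -ler_pdivrMl//.
  by apply: le_trans h; rewrite mulrDr mulKf ?gt_eqF// mulrC.
Qed.

Lemma cdf_wsum_lower m K : cdf_wsum m c (\sum_(j < m) c j - K / D) <= expR (4 * V - K).
Proof.
have Dc0 j : 0 <= D * c j by have /andP[] := Dc4 j.
apply: le_trans (@pr_wsum_lower_tail _ _ _ P _ xi_iid m (fun j => D * c j) V K Dc0 (c_sq m)).
apply: pr_le; [exact: mle|exact: mle|].
move=> w /= h; rewrite wsum_scale -mulr_sumr -ler_pdivlMl//.
by apply: le_trans h _; rewrite mulrBr mulKf ?gt_eqF// mulrC.
Qed.

(** The bound [expR (4 * V - K) < cdf_wser c s] keeps [s] above the mean minus [K / D], by the lower
    tail. With [T = 2 K / D] the unreached event lies beyond the mean plus [K / D] and is absorbed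
    by the upper tail. *)
Lemma wser_interval_mass (delta M' K s : R) (N : nat) : 0 < delta -> 0 < M' ->
  N%:R * (delta / (8 * B0)) <= Num.sqrt k%:R ->
  2 * K <= b * (N%:R * (delta / (8 * B0))) / 12 ->
  expR (4 * V - K) < cdf_wser c s ->
  1 - cdf_wser c s <= expR (4 * V - K) + 2 * (2 / 3) ^+ k + N.+1%:R *
    (M' * (cdf_wser c s - cdf_wser c (s - delta / D)) +
     expR ((N%:R * (delta / (8 * B0))) ^+ 2 / 2) / M').
Proof.
move=> delta0 M'0 Nq KN hs.
have dD0 : 0 < delta / D by rewrite divr_gt0.
have dE : delta / D / (8 * (B0 / D)) = delta / (8 * B0) by field; rewrite !gt_eqF.
pose F m := 1 - cdf_wsum m c s - (N.+1%:R * (M' * (cdf_wsum m c s - cdf_wsum m c (s - delta / D)) +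
     expR ((N%:R * (delta / (8 * B0))) ^+ 2 / 2) / M')).
suff : 1 - cdf_wser c s - (N.+1%:R * (M' * (cdf_wser c s - cdf_wser c (s - delta / D)) +
     expR ((N%:R * (delta / (8 * B0))) ^+ 2 / 2) / M')) <= expR (4 * V - K) + 2 * (2 / 3) ^+ k by lra.
set L := (X in X <= _).
have cv : F m @[m --> \oo] --> L.
  apply: cvgB; first by apply: cvgB; [exact: cvg_cst|exact: cvg_cdf_wsum].
  apply: cvgMr; apply: cvgD; last exact: cvg_cst.
  by apply: cvgMr; apply: cvgB; exact: cvg_cdf_wsum.
apply: (cvgr_to_le cv).
near=> m; rewrite /F -pr_wsum_itv; last lra.
(* The distribution function of the series is below that of every partial sum, so one [s] serves all
   [m]. *)
have sm : \sum_(j < m) c j - K / D <= s.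
  rewrite leNgt; apply/negP => h; have := cdf_wsum_lower m K; apply/negP; rewrite -ltNge.
  apply: lt_le_trans hs _; apply: le_trans (cdf_wser_le_wsum s m) _.
  apply: pr_le; [exact: mle|exact: mle|].
  by move=> w /= h'; rewrite (le_trans h')// ltW.
have up : pr P [set w | s + 2 * K / D < wsum m c w] <= expR (4 * V - K).
  rewrite pr_wsum_gt; apply: le_trans (cdf_wsum_upper m K); rewrite lerD2l lerN2.
  apply: pr_le; [exact: mle|exact: mle|].
  move=> w /= h'; rewrite (le_trans h')//.
  by rewrite (_ : 2 * K / D = K / D + K / D); [lra|ring].
have km : (0 < k <= m)%N by rewrite k0/=; near: m; exists k.
have := @wsum_interval_mass _ _ _ P xi xi_iid m k c (b / D) (B0 / D) s (delta / D) (2 * K / D) M' N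
   km (divr_gt0 b0 D0) (divr_gt0 B00 D0) dD0 M'0.
rewrite dE pr_wsum_gt.
have h1 : forall j, (j < k)%N -> b / D / Num.sqrt k%:R <= c j <= B0 / D / Num.sqrt k%:R.
  by move=> j jk; rewrite c_low//= c_high.
have h2 : 2 * K / D <= b / D * (N%:R * (delta / (8 * B0))) / 12.
  rewrite [leRHS](_ : _ = b * (N%:R * (delta / (8 * B0))) / 12 / D); last by field; rewrite !gt_eqF.
  by rewrite ler_pM2r ?invr_gt0.
move=> /(_ h1 Nq h2) h3.
by lra.
Unshelve. all: by end_near. Qed.

(** Along a grid of mesh [e] the distribution function grows by at most [4^-1] per step
    (anticoncentration with [M = 16]), so the first grid point where it reaches [4^-1] cannot
    overshoot [2^-1]. *)
Lemma wser_quantile (Cs : R) : (forall m, \sum_(j < m) c j <= Cs) ->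
  2 / 16 + (2 / 3) ^+ k <= (4^-1 : R) ->
  exists s, 4^-1 <= cdf_wser c s <= 2^-1.
Proof.
move=> cCs hk; set e := b / D / (24 * 16%:R ^+ 2).
have e0 : 0 < e by rewrite !divr_gt0// mulr_gt0// exprn_gt0.
have anti s : cdf_wser c s - cdf_wser c (s - e) <= 4^-1.
  exact: le_trans (@wser_anticoncentration 16 s isT) hk.
have exi : exists i : nat, 4^-1 <= cdf_wser c (i%:R * e).
  pose K := 4 * V + 1.
  have hG : 1 - expR (4 * V - K) <= cdf_wser c (Cs + K / D).
    apply: (cvgr_to_ge (@cvg_cdf_wsum (Cs + K / D))).
    apply: nearW => m; have := cdf_wsum_upper m K.
    have : cdf_wsum m c (\sum_(j < m) c j + K / D) <= cdf_wsum m c (Cs + K / D).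
      apply: pr_le; [exact: mle|exact: mle|].
      by move=> w /= h'; rewrite (le_trans h')// lerD2r cCs.
    by lra.
  have [i hi] : exists i : nat, Cs + K / D <= i%:R * e.
    exists (Num.truncn ((Cs + K / D) / e)).+1.
    rewrite -ler_pdivrMr// ltW//; exact: truncnS_gt.
  exists i; apply: le_trans (cdf_wser_homo hi); apply: le_trans hG.
  rewrite /K (_ : 4 * V - _ = - 1); last by ring.
  have := @expR_ge1Dx R 1; rewrite expRN => h.
  have : (expR 1)^-1 <= 2^-1 :> R by rewrite lef_pV2 ?posrE ?expR_gt0//; lra.
  by lra.
have [i hi himin] := ex_minnP exi.
exists (i%:R * e); rewrite hi/=.
have := anti (i%:R * e); case: i hi himin => [hi _|i hi himin].
  by rewrite mul0r sub0r (@cdf_wser_lt0 (- e)) ?oppr_lt0//; lra.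
rewrite -[i.+1%:R]natr1 mulrDl mul1r addrK => h.
have : cdf_wser c (i%:R * e) < 4^-1.
  by rewrite ltNge; apply/negP => /himin; rewrite ltnn.
by move: hi h; rewrite -[i.+1%:R]natr1 mulrDl mul1r; lra.
Qed.

End nonneg.
End chi_square_series.

(** * Adding a signal to the chi-square sum *)

Section signal.
Context {R : realType} d (Omega : measurableType d) (P : probability Omega R).
Variable xi : nat -> Omega -> R.
Hypothesis xi_iid : iid_std_normal P xi.
Local Notation wsum := (wsum xi).
Variables (ka : nat -> R) (a : R).
Hypothesis ka0 : forall j, 0 <= ka j.

Definition cdf_signal (th : nat -> R) (s : R) : R :=
  pr P [set w | (\sum_(j <oo) (ka j * (th j + a * xi j w) ^+ 2)%:E <= s%:E)%E].

Let mxi j : measurable_fun setT (xi j) := measurable_xi xi_iid j.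

Let t0 th j w : 0 <= ka j * (th j + a * xi j w) ^+ 2.
Proof. by rewrite mulr_ge0 ?sqr_ge0. Qed.

Let mt (th : nat -> R) j : measurable_fun setT (fun w => ka j * (th j + a * xi j w) ^+ 2).
Proof.
apply: measurable_funM => //; apply: measurable_funX; apply: measurable_funD => //.
exact: measurable_funM.
Qed.

Lemma measurable_signal_event th s :
  measurable [set w | (\sum_(j <oo) (ka j * (th j + a * xi j w) ^+ 2)%:E <= s%:E)%E].
Proof. exact: (measurable_series_event (@t0 th) (@mt th)). Qed.

Lemma cdf_signal0 s : cdf_signal (fun=> 0) s = cdf_wser P xi (fun j => ka j * a ^+ 2) s.
Proof.
rewrite /cdf_signal /cdf_wser; congr (pr P _); apply/funext => w /=.
congr (_ <= _)%E; apply: eq_eseriesr => j _.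
by rewrite add0r exprMn mulrA.
Qed.

Variables (th : nat -> R) (v : R).
Hypothesis th_v : forall m, \sum_(j < m) (2 * a * (ka j * th j)) ^+ 2 <= v.

Let signal_split m w : \sum_(j < m) ka j * (th j + a * xi j w) ^+ 2 =
  wsum m (fun j => ka j * a ^+ 2) w + \sum_(j < m) ka j * th j ^+ 2 +
  \sum_(j < m) 2 * a * (ka j * th j) * xi j w.
Proof. by rewrite -!big_split/=; apply: eq_bigr => j _; ring. Qed.

Let msum (f : nat -> Omega -> R) m s : (forall j, measurable_fun setT (f j)) ->
  measurable [set w | \sum_(j < m) f j w <= s].
Proof.
move=> mf; rewrite -[X in measurable X]setTI; apply: measurable_fun_le => //.
exact: measurable_sum.
Qed.

Let msumge (f : nat -> Omega -> R) m s : (forall j, measurable_fun setT (f j)) ->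
  measurable [set w | s <= \sum_(j < m) f j w].
Proof.
move=> mf; rewrite -[X in measurable X]setTI; apply: measurable_fun_le => //.
exact: measurable_sum.
Qed.

Let mX e j : measurable_fun setT (fun w => e * (2 * a * (ka j * th j) * xi j w)).
Proof. by apply: measurable_funM => //; exact: measurable_funM. Qed.

Let mX' u j : measurable_fun setT (fun w => u j * xi j w).
Proof. exact: measurable_funM. Qed.

Let mW j : measurable_fun setT (fun w => ka j * a ^+ 2 * xi j w ^+ 2).
Proof. by apply: measurable_funM => //; exact: measurable_funX. Qed.

Let c0 j : 0 <= ka j * a ^+ 2. Proof. by rewrite mulr_ge0 ?sqr_ge0. Qed.

Let cvgV s : pr P [set w | \sum_(j < m) ka j * (th j + a * xi j w) ^+ 2 <= s] @[m --> \oo] -->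
  cdf_signal th s.
Proof. exact: (@cvg_pr_series _ _ _ P (fun j w => ka j * (th j + a * xi j w) ^+ 2) (@t0 th) (@mt th) s). Qed.

Let tail (e : R) (u eta : R) m : (e = 1) \/ (e = -1) -> 0 <= u ->
  pr P [set w | eta <= \sum_(j < m) e * (2 * a * (ka j * th j) * xi j w)] <=
  expR (u ^+ 2 * v / 2 - u * eta).
Proof.
move=> e1 u0; have e2 : e ^+ 2 = 1 by case: e1 => ->; rewrite ?sqrrN expr1n.
apply: (@le_trans _ _ (pr P [set w | u * eta <= \sum_(j < m) (u * (e * (2 * a * (ka j * th j)))) * xi j w])).
  apply: pr_le.
  - exact: (msumge m eta (@mX e)).
  - exact: (msumge m (u * eta) (@mX' (fun j => u * (e * (2 * a * (ka j * th j)))))).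
  move=> w /= h; have -> : \sum_(j < m) (u * (e * (2 * a * (ka j * th j)))) * xi j w =
    u * (\sum_(j < m) e * (2 * a * (ka j * th j) * xi j w)).
    by rewrite mulr_sumr; apply: eq_bigr => j _; ring.
  exact: ler_wpM2l.
apply: le_trans (pr_linear_tail xi_iid m (fun j => u * (e * (2 * a * (ka j * th j)))) (u * eta)) _.
rewrite ler_expR lerD2r.
rewrite (eq_bigr (fun j : 'I_m => u ^+ 2 / 2 * (2 * a * (ka j * th j)) ^+ 2)); last first.
  by move=> j _; rewrite exprMn (exprMn _ e) e2; ring.
rewrite -mulr_sumr [leRHS]mulrAC; apply: ler_wpM2l (th_v m).
by rewrite divr_ge0// sqr_ge0.
Qed.

(** Expanding the square gives the chi-square sum, an energy at most [A] and a Gaussian cross term.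
    Unless the cross term reaches [eta], the threshold moves by at most [A + eta]; [u] is the free
    Chernoff parameter for that exception. *)
Lemma cdf_signal_ge (A s u eta : R) : 0 <= u ->
  (forall m, \sum_(j < m) ka j * th j ^+ 2 <= A) ->
  cdf_wser P xi (fun j => ka j * a ^+ 2) (s - A - eta) <=
  cdf_signal th s + expR (u ^+ 2 * v / 2 - u * eta).
Proof.
move=> u0 hA.
have cv : pr P [set w | \sum_(j < m) ka j * (th j + a * xi j w) ^+ 2 <= s] +
   expR (u ^+ 2 * v / 2 - u * eta) @[m --> \oo] -->
   cdf_signal th s + expR (u ^+ 2 * v / 2 - u * eta).
  by apply: cvgD; [exact: cvgV|exact: cvg_cst].
apply: (cvgr_to_ge cv); apply: nearW => m.
apply: le_trans (cdf_wser_le_wsum xi_iid c0 _ m) _.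
apply: le_trans (lerD (lexx _) (@tail 1 u eta m _ u0)); last by left.
apply: pr_setU_le.
- exact: (msum m _ mW).
- exact: (msum m _ (@mt th)).
- exact: (msumge m eta (@mX 1)).
move=> w /= h; have [hx|hx] := leP eta (\sum_(j < m) 1 * (2 * a * (ka j * th j) * xi j w)).
  by right.
left; rewrite signal_split; have := hA m.
move: hx; under eq_bigr do rewrite mul1r.
by lra.
Qed.

(** The mirror image of [cdf_signal_ge]. The lower bound on the energy is only asked of long partial
    sums, since these increase to the energy. *)
Lemma cdf_signal_le (A s u eta : R) : 0 <= u ->
  (\forall m \near \oo, A <= \sum_(j < m) ka j * th j ^+ 2) ->
  cdf_signal th s <= cdf_wser P xi (fun j => ka j * a ^+ 2) (s - A + eta) +
     expR (u ^+ 2 * v / 2 - u * eta).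
Proof.
move=> u0 hA.
have cv : cdf_wsum P xi m (fun j => ka j * a ^+ 2) (s - A + eta) +
   expR (u ^+ 2 * v / 2 - u * eta) @[m --> \oo] -->
   cdf_wser P xi (fun j => ka j * a ^+ 2) (s - A + eta) + expR (u ^+ 2 * v / 2 - u * eta).
  by apply: cvgD; [exact: cvg_cdf_wsum|exact: cvg_cst].
apply: (cvgr_to_ge cv); near=> m.
apply: le_trans (pr_series_le P (@t0 th) (@mt th) s m) _.
apply: le_trans (lerD (lexx _) (@tail (-1) u eta m _ u0)); last by right.
apply: pr_setU_le.
- exact: (msum m _ (@mt th)).
- exact: (msum m _ mW).
- exact: (msumge m eta (@mX (-1))).
move=> w /= h; have [hx|hx] := leP eta (\sum_(j < m) (-1) * (2 * a * (ka j * th j) * xi j w)).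
  by right.
left; move: h; rewrite signal_split.
have : A <= \sum_(j < m) ka j * th j ^+ 2 by near: m.
move: hx; rewrite -mulr_sumr.
by lra.
Unshelve. all: by end_near. Qed.

End signal.

(** * Error probabilities as distribution functions *)

Section test_errors.
Context {R : realType} d (Omega : measurableType d) (P : probability Omega R).
Variable xi : nat -> Omega -> R.
Hypothesis xi_iid : iid_std_normal P xi.
Variables (sigma : R) (kap : nat -> nat -> R) (n : nat) (rh : R).
Hypothesis kap0 : forall j, 0 <= kap n j.
Hypothesis rhE : rho kap n = rh%:E.

Let a := sigma / Num.sqrt (Nn n).

Definition centering : R := sigma ^+ 2 / Nn n * rh.

Lemma Tstat_le th w t : (Tstat xi sigma kap n th w <= t%:E)%E =
  (\sum_(j <oo) (kap n j * (th j + a * xi j w) ^+ 2)%:E <= (t + centering)%:E)%E.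
Proof. by rewrite /Tstat rhE -EFinM leeBlDr// EFinD. Qed.

Lemma beta_cdf t th :
  beta P xi sigma kap n t th = (cdf_signal P xi (kap n) a th (t + centering))%:E.
Proof.
rewrite /beta /cdf_signal -prE; last exact: (measurable_signal_event xi_iid).
by congr (P _); apply/funext => w /=; rewrite Tstat_le.
Qed.

Lemma alpha_cdf t :
  alpha P xi sigma kap n t = (1 - cdf_wser P xi (fun j => (kap n j * a ^+ 2)%R) (t + centering))%:E.
Proof.
rewrite -cdf_signal0 /alpha /cdf_signal -pr_setC; last exact: (measurable_signal_event xi_iid).
rewrite -prE; last by apply: measurableC; exact: (measurable_signal_event xi_iid).
by congr (P _); apply/seteqP; split=> w /=; rewrite ltNge Tstat_le => /negP.
Qed.

End test_errors.

(** * Orders of magnitude of the weights *)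

Section weights.
Context {R : realType}.
Variables (sigma r : R) (kap : nat -> nat -> R).
Hypotheses (sigma0 : 0 < sigma) (kap0 : weights_nonneg kap) (H1 : A1 kap).
Hypotheses (H2 : A2 sigma kap) (H3 : A3 r kap) (H5 : A5 kap).

Definition rate (n : nat) : R := Nn n `^ (- r).

Lemma Nn_gt0 n : 0 < Nn n :> R. Proof. by rewrite /Nn ltr0n. Qed.

Lemma rate_gt0 n : 0 < rate n. Proof. by rewrite powR_gt0 ?Nn_gt0. Qed.

Lemma rate_sqr n : Nn n `^ (- (2 * r)) = rate n ^+ 2.
Proof.
rewrite /rate -powR_mulrn ?powR_ge0// -powRrM; congr (_ `^ _); ring.
Qed.

Lemma rho_fin n : exists rh : R, rho kap n = rh%:E.
Proof.
have [c1 [c2 [c10 /(_ n)/andP[h1 h2]]]] := H3.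
exists (fine (rho kap n)); rewrite fineK// fin_numE.
by apply/andP; split; apply/eqP => h; move: h1 h2; rewrite h.
Qed.

Lemma sum_le_rho n rh : rho kap n = rh%:E -> forall m, \sum_(j < m) kap n j <= rh.
Proof. by move=> h; apply/nneseries_le_fin; [exact: kap0|rewrite -h]. Qed.

Lemma kn_exists n : exists k, is_kn kap n k.
Proof.
have [rh rhE] := rho_fin n; have [c1 [c2 [c10 /(_ n)/andP[h1 _]]]] := H3.
have rh0 : 0 < rh.
  rewrite -lte_fin -rhE; apply: lt_le_trans h1.
  by rewrite lte_fin mulr_gt0// powR_gt0// Nn_gt0.
have condE k : kn_cond kap n k = (\sum_(i < k.-1) kap n i <= rh / 2) :> Prop.
  by rewrite /kn_cond rhE -EFinM lee_fin.
have [m hm] : exists m, rh / 2 < \sum_(i < m) kap n i.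
  apply: contrapT => h; have : (rho kap n <= (rh / 2)%:E)%E.
    apply/nneseries_le_fin; first exact: kap0.
    by move=> m; rewrite leNgt; apply/negP => hm; apply: h; exists m.
  by rewrite rhE lee_fin; lra.
have ex1 : exists k, (fun k => \sum_(i < k.-1) kap n i <= rh / 2) k.
  by exists 1%N; rewrite /= big_ord0; lra.
have ub k : (fun k => \sum_(i < k.-1) kap n i <= rh / 2) k -> (k <= m.+1)%N.
  move=> hk; rewrite leqNgt; apply/negP => mk; move: hk; rewrite leNgt => /negP; apply.
  apply: lt_le_trans hm _; have mk' : (m <= k.-1)%N by case: k mk => // k; rewrite ltnS => /ltnW.
  rewrite -(subnKC mk') big_split_ord/= lerDl; apply: sumr_ge0 => j _; exact: kap0.
have [k hk hmax] := ex_maxnP ex1 ub.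
exists k; split; first by apply: hmax; rewrite /= big_ord0; lra.
by split; [rewrite condE|move=> k'; rewrite condE; exact: hmax].
Qed.

(** Write [K] for the weight at [k_n] and [q] for the rate. The weights up to [k_n] are comparable
    to [K], so the definition of [k_n] and A3 give [k K] of order [q^2]. The upper half of A2 bounds
    [N^2 k K^2], hence [N^2 q^2 K], from above; the lower half bounds [N^2 q^2 K] from below. The
    order [N^2 q^4] of [k_n] follows by division. *)
Lemma weight_bounds : exists e1 e2 d1 d2 V : R,
  [/\ 0 < e1, 0 < e2, 0 < d1, 0 < d2 & forall n k, is_kn kap n k ->
   [/\ e1 <= Nn n ^+ 2 * rate n ^+ 2 * kap n k.-1,
       (forall j, Nn n ^+ 2 * rate n ^+ 2 * kap n j <= e2),
       d1 * (Nn n ^+ 2 * rate n ^+ 4) <= k%:R,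
       k%:R <= d2 * (Nn n ^+ 2 * rate n ^+ 4) &
       (forall m, Nn n ^+ 2 * \sum_(j < m) kap n j ^+ 2 <= V)]].
Proof.
have [C1 [C2 [C10 h2]]] := H2.
have [c1 [c2 [c10 h3]]] := H3.
have [[c5 [C [_ [C0 h5]]]] _] := H5.
have c20 : 0 < c2.
  have := h3 0; rewrite rate_sqr => /andP[+ +] => ha hb; have := le_trans ha hb.
  rewrite lee_fin ler_pM2r ?exprn_gt0 ?rate_gt0// => h; exact: lt_le_trans h.
have C20 : 0 < C2.
  by have /andP[ha hb] := h2 0; rewrite -lte_fin (lt_trans _ (lt_trans ha hb))// lte_fin.
pose V := sigma ^+ 4 * C2.
have s40 : 0 < sigma ^+ 4 by rewrite exprn_gt0.
have V0 : 0 < V by rewrite mulr_gt0.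
pose e1 := C1 * sigma ^+ 4 / (C * c2).
pose e2 := C * (2 * C * V / c1).
have e10 : 0 < e1 by rewrite divr_gt0 ?mulr_gt0.
have e20 : 0 < e2 by rewrite mulr_gt0// divr_gt0 ?mulr_gt0.
exists e1, e2, (c1 / (2 * e2)), (c2 / e1), V; split=> //.
- by apply: divr_gt0 => //; exact: mulr_gt0.
- exact: divr_gt0.
move=> n k kn.
have N0 := Nn_gt0 n; have q0 := rate_gt0 n.
have [rh rhE] := rho_fin n.
have /andP[] := h3 n; rewrite rhE rate_sqr !lee_fin => rl ru.
have sum_rh := sum_le_rho rhE.
set N := Nn n in N0 *; set q := rate n in q0 rl ru *.
have N20 : 0 < N ^+ 2 by rewrite exprn_gt0.
have q20 : 0 < q ^+ 2 by rewrite exprn_gt0.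
have sqV m : N ^+ 2 * \sum_(j < m) kap n j ^+ 2 <= V.
  have /andP[_ hb] := h2 n.
  have : (\sum_(j <oo) (kap n j ^+ 2)%:E <= (V / N ^+ 2)%:E)%E.
    move: hb; rewrite -lte_pdivlMl ?mulr_gt0 ?invr_gt0// -EFinM => /ltW hb.
    apply: le_trans hb _; rewrite lee_fin /V invfM invrK -/N.
    by rewrite mulrAC.
  move=> /nneseries_le_fin => /(_ (fun j => sqr_ge0 _) m).
  by rewrite -ler_pdivlMl// mulrC.
(* The sum of squares is at most the largest weight times the total weight. *)
have low2 : C1 * sigma ^+ 4 <= N ^+ 2 * (kap n 0 * rh).
  have /andP[ha _] := h2 n.
  have : (\sum_(j <oo) (kap n j ^+ 2)%:E <= (kap n 0 * rh)%:E)%E.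
    apply/nneseries_le_fin => [j|m]; first exact: sqr_ge0.
    apply: (@le_trans _ _ (kap n 0 * \sum_(j < m) kap n j)); last first.
      by rewrite ler_wpM2l ?kap0.
    rewrite mulr_sumr; apply: ler_sum => j _.
    by rewrite expr2 ler_wpM2r ?kap0// H1.
  move=> hs; have : (C1%:E <= (sigma ^- 4 * N ^+ 2)%:E * (kap n 0 * rh)%:E)%E.
    apply: le_trans (ltW ha) _; apply: lee_wpmul2l => //.
    by rewrite lee_fin mulr_ge0 ?invr_ge0 ?ltW.
  rewrite -EFinM lee_fin -mulrA => h.
  by rewrite mulrC -ler_pdivlMl.
have [k0 [kc kmax]] := kn.
have /andP[_ K0] := h5 _ _ kn.
set K := kap n k.-1 in K0 *.
have Kge0 : 0 <= K by exact: kap0.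
have kR : 0 < k%:R :> R by rewrite ltr0n.
(* Maximality of [k]: the condition fails at [k.+1], where its sum runs over exactly [k] weights. *)
have sk : rh / 2 < \sum_(i < k) kap n i.
  rewrite ltNge; apply/negP => h; have := kmax k.+1.
  by rewrite /kn_cond/= rhE -EFinM lee_fin => /(_ h); rewrite ltnn.
have kK_low : rh / 2 <= k%:R * (C * K).
  apply: le_trans (ltW sk) _.
  rewrite -[X in X%:R * _]card_ord mulr_natl -sumr_const; apply: ler_sum => i _.
  by apply: le_trans K0; exact: H1.
have kK_up : k%:R * K <= rh.
  apply: le_trans (sum_rh k).
  rewrite -[X in X%:R * _]card_ord mulr_natl -sumr_const; apply: ler_sum => i _.
  by apply: H1; rewrite -ltnS prednK.
have kK2 : N ^+ 2 * (k%:R * K ^+ 2) <= V.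
  apply: le_trans (sqV k); rewrite ler_pM2l//.
  rewrite -[X in X%:R * _]card_ord mulr_natl -sumr_const; apply: ler_sum => i _.
  by rewrite lerXn2r ?nnegrE ?kap0//; apply: H1; rewrite -ltnS prednK.
have kKc : c1 * q ^+ 2 <= 2 * C * (k%:R * K) by lra.
have KQ : N ^+ 2 * q ^+ 2 * K <= 2 * C * V / c1.
  rewrite ler_pdivlMr//.
  have h : N ^+ 2 * K * (c1 * q ^+ 2) <= N ^+ 2 * K * (2 * C * (k%:R * K)).
    by rewrite ler_wpM2l// mulr_ge0// ltW.
  have h' : 2 * C * (N ^+ 2 * (k%:R * K ^+ 2)) <= 2 * C * V by rewrite ler_wpM2l// mulr_ge0// ltW.
  by rewrite expr2 in h'; lra.
have KQl : e1 <= N ^+ 2 * q ^+ 2 * K.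
  rewrite ler_pdivrMr ?mulr_gt0//; apply: le_trans low2 _.
  rewrite [leRHS](_ : _ = N ^+ 2 * (C * K * (c2 * q ^+ 2))); last by ring.
  rewrite ler_pM2l//.
  by apply: ler_pM => //; apply: le_trans (sum_rh 0%N); rewrite big_ord0.
split=> //.
- move=> j; apply: (@le_trans _ _ (N ^+ 2 * q ^+ 2 * (C * K))).
    apply: ler_wpM2l; first by rewrite mulr_ge0// ltW.
    by apply: le_trans K0; exact: H1.
  by rewrite mulrCA ler_wpM2l// ltW.
- rewrite mulrAC ler_pdivrMr; last exact: mulr_gt0.
  have h : N ^+ 2 * q ^+ 2 * (c1 * q ^+ 2) <= N ^+ 2 * q ^+ 2 * (2 * C * (k%:R * K)).
    by apply: ler_wpM2l; [apply: mulr_ge0; exact: ltW|].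
  have h' : 2 * C * k%:R * (N ^+ 2 * q ^+ 2 * K) <= 2 * C * k%:R * (2 * C * V / c1).
    by apply: ler_wpM2l; [rewrite !mulr_ge0// ltW|].
  rewrite (_ : q ^+ 4 = q ^+ 2 * q ^+ 2); last by ring.
  have h'' : 2 * C * k%:R * (2 * C * V / c1) = k%:R * (2 * e2) by rewrite /e2; ring.
  by lra.
- rewrite mulrAC ler_pdivlMr//.
  have h : k%:R * e1 <= k%:R * (N ^+ 2 * q ^+ 2 * K) by rewrite ler_pM2l.
  have h' : N ^+ 2 * q ^+ 2 * (k%:R * K) <= N ^+ 2 * q ^+ 2 * (c2 * q ^+ 2).
    by apply: ler_wpM2l; [rewrite mulr_ge0// ltW|lra].
  rewrite (_ : q ^+ 4 = q ^+ 2 * q ^+ 2); last by ring.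
  by lra.
Qed.

End weights.

Section limits.
Context {R : realType}.
Implicit Types (u : nat -> \bar R) (l : R).

Lemma limn_einf_ge_eventually u l :
  (forall e : R, 0 < e -> exists n0, forall n, (n0 <= n)%N -> ((l - e)%:E <= u n)%E) ->
  (l%:E <= limn_einf u)%E.
Proof.
move=> h; rewrite limn_einf_lim; apply/lee_subgt0Pr => e e0.
have [n0 hn] := h e e0; rewrite -EFinB.
apply: lime_ge; first exact: is_cvg_einfs.
exists n0 => // n /= n0n; apply: le_ereal_inf_tmp => _ [m /= nm <-].
by apply: hn; exact: leq_trans nm.
Qed.

Lemma limn_einf_gt_eventually u l (e : R) : (l%:E <= limn_einf u)%E -> 0 < e ->
  exists n0, forall n, (n0 <= n)%N -> ((l - e)%:E <= u n)%E.
Proof.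
move=> hl e0; apply: contrapT => hn.
have : (limn_einf u <= (l - e)%:E)%E.
  rewrite limn_einf_lim; apply: lime_le; first exact: is_cvg_einfs.
  apply: nearW => n; rewrite leNgt; apply/negP => h; apply: hn; exists n => m nm.
  apply: le_trans (ltW h) _; apply: ereal_inf_lbound; by exists m.
by move=> /(le_trans hl); rewrite lee_fin; lra.
Qed.

Lemma limn_esup_le_eventually u l n0 :
  (forall n, (n0 <= n)%N -> (u n <= l%:E)%E) -> (limn_esup u <= l%:E)%E.
Proof.
move=> h; rewrite limn_esup_lim; apply: lime_le; first exact: is_cvg_esups.
exists n0 => // n /= n0n; apply: ge_ereal_sup => _ [m /= nm <-].
by apply: h; exact: leq_trans nm.
Qed.

Lemma geometric_small (e : R) : 0 < e -> exists n0, forall n, (n0 <= n)%N -> (2 / 3 : R) ^+ n <= e.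
Proof.
move=> e0; have : (fun n => (2 / 3 : R) ^+ n) @ \oo --> (0 : R).
  by apply: cvg_expr; rewrite ger0_norm; lra.
move=> /(cvgr_le)/(_ e e0)[n0 _ h]; exists n0 => n nn; exact: h.
Qed.

Lemma expRN_le (x e : R) : 0 < e -> e^-1 <= x -> expR (- x) <= e.
Proof.
move=> e0 ex; have x0 : 0 < x by apply: lt_le_trans ex; rewrite invr_gt0.
rewrite expRN -[leRHS]invrK lef_pV2 ?posrE ?expR_gt0 ?invr_gt0//.
by have := expR_ge1Dx x; lra.
Qed.

Lemma expRN_lt (x e : R) : 0 < e -> e^-1 <= x -> expR (- x) < e.
Proof.
move=> e0 ex; have x0 : 0 < x by apply: lt_le_trans ex; rewrite invr_gt0.
rewrite expRN -[ltRHS]invrK ltf_pV2 ?posrE ?expR_gt0 ?invr_gt0//.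
by have := expR_ge1Dx x; lra.
Qed.

End limits.

Lemma le_sqrtr (R : realType) (x y : R) : 0 <= x -> x ^+ 2 <= y -> x <= Num.sqrt y.
Proof.
move=> x0 xy; rewrite -(ger0_norm x0) -sqrtr_sqr ler_sqrt//.
exact: le_trans (sqr_ge0 x) xy.
Qed.

(** * Power of the quadratic tests *)

Section model.
Context {R : realType} d (Omega : measurableType d) (P : probability Omega R).
Variables (xi : nat -> Omega -> R) (sigma r : R) (kap : nat -> nat -> R).
Hypotheses (sigma0 : 0 < sigma) (r2 : r < 2^-1).
Hypothesis xi_iid : iid_std_normal P xi.
Hypotheses (kap0 : weights_nonneg kap) (H1 : A1 kap).
Hypotheses (H2 : A2 sigma kap) (H3 : A3 r kap) (H5 : A5 kap).
Local Notation rate := (rate r).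

Definition noise n : R := sigma / Num.sqrt (Nn n).

Definition cw n j : R := kap n j * noise n ^+ 2.

Lemma noise_sqr n : noise n ^+ 2 = sigma ^+ 2 / Nn n.
Proof. by rewrite /noise exprMn exprVn sqr_sqrtr// ltW// Nn_gt0. Qed.

Lemma cw_ge0 n j : 0 <= cw n j. Proof. by rewrite mulr_ge0 ?sqr_ge0. Qed.

(** The product is [N^(1 - 2 r)], which diverges since [r < 1/2]. This makes [k_n] unbounded and the
    cross term negligible. *)
Lemma Nrate2_large (x : R) : exists n0, forall n, (n0 <= n)%N -> x <= Nn n * rate n ^+ 2.
Proof.
have p0 : 0 < 1 - 2 * r by have := r2; lra.
pose y := `|x| `^ (1 - 2 * r)^-1.
exists (Num.truncn y) => n hn.
have -> : Nn n * rate n ^+ 2 = Nn n `^ (1 - 2 * r).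
  rewrite -rate_sqr -[X in X * _ = _]powRr1 ?(ltW (Nn_gt0 _))// -powRD//.
  by rewrite gt_eqF ?implybT// Nn_gt0.
have yN : y <= Nn n.
  apply: le_trans (ltW (truncnS_gt y)) _; by rewrite /Nn ler_nat.
apply: le_trans (ler_norm x) _.
have -> : `|x| = y `^ (1 - 2 * r).
  by rewrite /y -powRrM mulVf ?gt_eqF// powRr1.
apply: ge0_ler_powR => //; first exact: ltW.
- by rewrite nnegrE powR_ge0.
- by rewrite nnegrE ltW// Nn_gt0.
Qed.

(** [N^2] times a null weight is [sigma^2 N kap], of order [sigma^2 / (N q^2)] for [j < k_n], and
    [N q^2] is of order [sqrt k_n]; this explains the factors [sqrt d1] and [sqrt d2]. *)
Lemma model_bounds : exists b B0 V : R, [/\ 0 < b, 0 < B0 &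
  forall n k, is_kn kap n k ->
  [/\ forall j, (j < k)%N -> b / Nn n ^+ 2 / Num.sqrt k%:R <= cw n j,
      forall j, cw n j <= B0 / Nn n ^+ 2 / Num.sqrt k%:R &
      forall m, \sum_(j < m) (Nn n ^+ 2 * cw n j) ^+ 2 <= V]].
Proof.
have [e1 [e2 [d1 [d2 [V [e10 e20 d10 d20 hw]]]]]] := weight_bounds sigma0 kap0 H1 H2 H3 H5.
have s20 : 0 < sigma ^+ 2 by rewrite exprn_gt0.
exists (e1 * sigma ^+ 2 * Num.sqrt d1), (e2 * sigma ^+ 2 * Num.sqrt d2), (sigma ^+ 4 * V).
split; rewrite ?mulr_gt0 ?sqrtr_gt0// => n k kn.
have [K1 K2 k1 k2 hV] := hw n k kn.
have [k0 _] := kn.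
have N0 := @Nn_gt0 R n; have q0 := rate_gt0 r n.
set N := Nn n in N0 K1 K2 k1 k2 hV *; set q := rate n in q0 K1 K2 k1 k2 *.
have kR : 0 < k%:R :> R by rewrite ltr0n.
have sk0 : 0 < Num.sqrt (k%:R : R) by rewrite sqrtr_gt0.
have Nq0 : 0 <= N * q ^+ 2 by rewrite mulr_ge0 ?sqr_ge0// ltW.
have sE (x : R) : 0 <= x -> Num.sqrt (x * (N ^+ 2 * q ^+ 4)) = Num.sqrt x * (N * q ^+ 2).
  move=> x0; rewrite sqrtrM//; congr *%R.
  by rewrite (_ : N ^+ 2 * q ^+ 4 = (N * q ^+ 2) ^+ 2) ?sqrtr_sqr ?ger0_norm//; ring.
have s1 : Num.sqrt d1 * (N * q ^+ 2) <= Num.sqrt k%:R.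
  by rewrite -sE ?(ltW d10)// ler_sqrt// ltW.
have s2 : Num.sqrt k%:R <= Num.sqrt d2 * (N * q ^+ 2).
  rewrite -sE ?(ltW d20)// ler_sqrt// mulr_ge0 ?(ltW d20)// mulr_ge0 ?sqr_ge0//.
  by rewrite exprn_ge0// ltW.
have N20 : 0 < N ^+ 2 by rewrite exprn_gt0.
have cE j : cw n j = kap n j * sigma ^+ 2 / N by rewrite /cw noise_sqr mulrA.
split.
- move=> j jk; rewrite cE ler_pdivrMr// ler_pdivrMr//.
  apply: (@le_trans _ _ (N ^+ 2 * q ^+ 2 * kap n k.-1 * sigma ^+ 2 * Num.sqrt d1)).
    by rewrite !ler_pM2r ?sqrtr_gt0.
  have hk : kap n k.-1 <= kap n j by apply: H1; rewrite -ltnS prednK.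
  have z0 : 0 <= sigma ^+ 2 / N * N ^+ 2 by rewrite !mulr_ge0 ?invr_ge0 ?ltW.
  rewrite [leRHS](_ : _ = sigma ^+ 2 / N * N ^+ 2 * (kap n j * Num.sqrt k%:R)); last by ring.
  rewrite [leLHS](_ : _ = sigma ^+ 2 / N * N ^+ 2 * (kap n k.-1 * (Num.sqrt d1 * (N * q ^+ 2)))); last first.
    by field; rewrite gt_eqF.
  rewrite ler_wpM2l//; apply: ler_pM => //; first by rewrite mulr_ge0 ?sqrtr_ge0.
- move=> j; rewrite cE ler_pdivlMr// ler_pdivlMr//.
  apply: (@le_trans _ _ (N ^+ 2 * q ^+ 2 * kap n j * sigma ^+ 2 * Num.sqrt d2)); last first.
    by rewrite !ler_pM2r ?sqrtr_gt0.
  have z0 : 0 <= sigma ^+ 2 / N * N ^+ 2 * kap n j.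
    by apply: mulr_ge0 (kap0 _ _); rewrite !mulr_ge0 ?invr_ge0 ?ltW.
  rewrite [leLHS](_ : _ = sigma ^+ 2 / N * N ^+ 2 * kap n j * Num.sqrt k%:R); last by ring.
  rewrite [leRHS](_ : _ = sigma ^+ 2 / N * N ^+ 2 * kap n j * (Num.sqrt d2 * (N * q ^+ 2))); last first.
    by field; rewrite gt_eqF.
  by rewrite ler_wpM2l.
- move=> m; rewrite (eq_bigr (fun j : 'I_m => sigma ^+ 4 * (N ^+ 2 * kap n j ^+ 2))); last first.
    by move=> j _; rewrite cE; field; rewrite gt_eqF.
  by rewrite -!mulr_sumr; apply: ler_wpM2l (hV m); rewrite exprn_ge0// ltW.
Qed.

Lemma kn_large (x : R) : exists n0, forall n k, (n0 <= n)%N -> is_kn kap n k -> x <= k%:R.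
Proof.
have [e1 [e2 [d1 [d2 [V [e10 e20 d10 d20 hw]]]]]] := weight_bounds sigma0 kap0 H1 H2 H3 H5.
have [n0 hn0] := Nrate2_large (1 + `|x| / d1).
exists n0 => n k nn kn; have [_ _ k1 _ _] := hw n k kn.
apply: le_trans k1; have h := hn0 n nn.
rewrite (_ : Nn n ^+ 2 * rate n ^+ 4 = (Nn n * rate n ^+ 2) ^+ 2); last by ring.
have xd : 0 <= `|x| / d1 by rewrite divr_ge0// ltW.
apply: le_trans (ler_norm x) _; rewrite mulrC -ler_pdivrMr//.
by rewrite expr2; nra.
Qed.

Lemma kn_geometric_small (e : R) : 0 < e -> exists n0, forall n k, (n0 <= n)%N ->
  is_kn kap n k -> (2 / 3 : R) ^+ k <= e.
Proof.
move=> e0; have [k0 hk0] := geometric_small e0; have [n0 hn0] := kn_large k0%:R.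
exists n0 => n k nn kn; apply: hk0; rewrite -(ler_nat R); exact: hn0 kn.
Qed.

Definition bounded_signal (S : R) n (th : nat -> R) : Prop :=
  forall m, \sum_(j < m) th j ^+ 2 <= S * rate n ^+ 2.

Lemma cross_bound (S : R) : 0 < S -> exists2 v0 : R, 0 < v0 & forall n th,
  bounded_signal S n th -> forall m,
  \sum_(j < m) (2 * noise n * (kap n j * th j)) ^+ 2 <=
    v0 / (Nn n * rate n ^+ 2) / (Nn n ^+ 2) ^+ 2.
Proof.
move=> S0.
have [e1 [e2 [d1 [d2 [V [e10 e20 d10 d20 hw]]]]]] := weight_bounds sigma0 kap0 H1 H2 H3 H5.
exists (4 * sigma ^+ 2 * e2 ^+ 2 * S); first by rewrite !mulr_gt0 ?exprn_gt0.
move=> n th hS m; have [k kn] := kn_exists kap0 H3 n.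
have [_ K2 _ _ _] := hw n k kn.
have N0 := @Nn_gt0 R n; have q0 := rate_gt0 r n.
set N := Nn n in N0 K2 *; set q := rate n in q0 K2 *.
have Nq0 : 0 < N ^+ 2 * q ^+ 2 by rewrite mulr_gt0// exprn_gt0.
apply: (@le_trans _ _ (4 * (sigma ^+ 2 / N) * (e2 / (N ^+ 2 * q ^+ 2)) ^+ 2 * \sum_(j < m) th j ^+ 2)).
  rewrite mulr_sumr; apply: ler_sum => j _.
  rewrite (_ : (2 * noise n * (kap n j * th j)) ^+ 2 =
     4 * (sigma ^+ 2 / N) * kap n j ^+ 2 * th j ^+ 2); last first.
    by rewrite -noise_sqr; ring.
  rewrite ler_wpM2r ?sqr_ge0// ler_wpM2l//.
    by rewrite mulr_ge0// divr_ge0 ?sqr_ge0// ltW.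
  rewrite lerXn2r ?nnegrE ?kap0 ?divr_ge0 ?(ltW e20) ?(ltW Nq0)//.
  by rewrite ler_pdivlMr// mulrC.
apply: (@le_trans _ _ (4 * (sigma ^+ 2 / N) * (e2 / (N ^+ 2 * q ^+ 2)) ^+ 2 * (S * q ^+ 2))).
  by rewrite ler_wpM2l// !mulr_ge0 ?invr_ge0 ?sqr_ge0// ?ltW// divr_gt0// exprn_gt0.
by rewrite le_eqVlt; apply/orP; left; apply/eqP; field; rewrite !gt_eqF.
Qed.

Local Notation G n := (cdf_wser P xi (cw n)).
Local Notation H n := (cdf_signal P xi (kap n) (noise n)).

(* Chernoff's exponent at u = L N^2 with the variance proxy of cross_bound. *)
Lemma cross_negligible (S eta e : R) : 0 < S -> 0 < eta -> 0 < e ->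
  exists L n0, 0 < L /\ forall n th, (n0 <= n)%N -> bounded_signal S n th ->
  exists v, (forall m, \sum_(j < m) (2 * noise n * (kap n j * th j)) ^+ 2 <= v) /\
    expR ((L * Nn n ^+ 2) ^+ 2 * v / 2 - L * Nn n ^+ 2 * (eta / Nn n ^+ 2)) <= e.
Proof.
move=> S0 eta0 e0; have [v0 v00 hv] := cross_bound S0.
(* The linear part of the exponent becomes [1/2 + 1/e], the quadratic part is at most [1/2] for
   large [n], and [exp (- 1/e) <= e]. *)
pose L := (2^-1 + e^-1) / eta.
have L0 : 0 < L by rewrite divr_gt0// addr_gt0// invr_gt0.
have [n0 hn0] := Nrate2_large (L ^+ 2 * v0).
exists L, n0; split=> // n th nn hS.
exists (v0 / (Nn n * rate n ^+ 2) / (Nn n ^+ 2) ^+ 2); split; first exact: hv.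
have N0 := @Nn_gt0 R n; have q0 := rate_gt0 r n; have := hn0 n nn.
set N := Nn n in N0 *; set q := rate n in q0 *.
have Nq0 : 0 < N * q ^+ 2 by rewrite mulr_gt0// exprn_gt0.
move=> hN.
have h1 : (L * N ^+ 2) ^+ 2 * (v0 / (N * q ^+ 2) / (N ^+ 2) ^+ 2) / 2 <= 2^-1.
  rewrite (_ : _ / 2 = L ^+ 2 * v0 / (N * q ^+ 2) / 2); last by field; rewrite !gt_eqF.
  rewrite ler_pdivrMr// mulVf// ler_pdivrMr// mul1r//.
have h2 : L * N ^+ 2 * (eta / N ^+ 2) = 2^-1 + e^-1.
  by rewrite /L; field; rewrite !gt_eqF.
apply: (@le_trans _ _ (expR (- e^-1))); first by rewrite ler_expR h2 opprD addrA -[leRHS]add0r lerD2r subr_le0.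
by apply: expRN_le.
Qed.

Lemma interval_mass (a' b' delta : R) : 0 < a' -> 0 < b' -> 0 < delta ->
  exists p n0, 0 < p /\ forall n s, (n0 <= n)%N -> b' <= G n s -> a' <= 1 - G n s ->
  p <= G n s - G n (s - delta / Nn n ^+ 2).
Proof.
move=> a0 b0 delta0; have [b [B0 [V [b00 B00 hb]]]] := model_bounds.
(* The constants are chosen in order: [K] makes the tails smaller than [b'] and [a' / 4], [N] then
   covers the range [2 K], [M'] makes the likelihood-ratio terms sum to [a' / 4], and large [n]
   makes [2 (2/3)^k] at most [a' / 4]. A quarter of [a'] is left for the interval. *)
pose K := 4 * V + (b'^-1 + 4 / a').
have ia0 : 0 < a'^-1 by rewrite invr_gt0.
have ib0 : 0 < b'^-1 by rewrite invr_gt0.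
have i4a0 : 0 < 4 / a' by rewrite divr_gt0.
have KE : 4 * V - K = - (b'^-1 + 4 / a') by rewrite /K; ring.
have Kb : expR (4 * V - K) < b' by rewrite KE; apply: expRN_lt => //; rewrite lerDl ltW.
have Ka : expR (4 * V - K) <= a' / 4.
  rewrite KE; apply: expRN_le; first lra.
  by rewrite invf_div; move: ib0 i4a0; set x := b'^-1; set y := 4 / a'; lra.
pose tau := delta / (8 * B0).
have tau0 : 0 < tau by rewrite divr_gt0// mulr_gt0.
pose N := (Num.truncn (2 * `|K| * 12 / (b * tau))).+1.
have NK : 2 * K <= b * (N%:R * tau) / 12.
  have : 2 * `|K| * 12 / (b * tau) <= N%:R by rewrite ltW// truncnS_gt.
  rewrite ler_pdivrMr; last exact: mulr_gt0.
  by have := ler_norm K => h' h; lra.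
pose Q := expR ((N%:R * tau) ^+ 2 / 2).
have Q0 : 0 < Q by exact: expR_gt0.
have N10 : 0 < N.+1%:R :> R by rewrite ltr0n.
pose M' := N.+1%:R * Q * 4 / a'.
have M'0 : 0 < M' by rewrite divr_gt0// !mulr_gt0.
have [n1 hn1] := kn_large ((N%:R * tau) ^+ 2 + (4 * B0) ^+ 2).
have a80 : 0 < a' / 8 by lra.
have [n2 hn2] := kn_geometric_small a80.
exists (a' / (4 * N.+1%:R * M')), (maxn n1 n2); split.
  by rewrite divr_gt0// !mulr_gt0.
move=> n s; rewrite geq_max => /andP[nn1 nn2] hb' ha'.
have [k kn] := kn_exists kap0 H3 n.
have [c1 c2 c3] := hb n k kn; have [k0 _] := kn.
have hk1 := hn1 n k nn1 kn; have hk2 := hn2 n k nn2 kn.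
have kR : 0 < k%:R :> R by rewrite ltr0n.
have sk0 : 0 < Num.sqrt (k%:R : R) by rewrite sqrtr_gt0.
have q1 : N%:R * tau <= Num.sqrt k%:R.
  apply: le_sqrtr; first by rewrite mulr_ge0// ltW.
  by apply: le_trans hk1; rewrite lerDl sqr_ge0.
have q2 : B0 / Num.sqrt k%:R <= 4^-1.
  rewrite ler_pdivrMr// ler_pdivlMl//.
  apply: le_sqrtr; first by rewrite mulr_ge0// ltW.
  by apply: le_trans hk1; rewrite lerDr sqr_ge0.
have D0 : 0 < Nn n ^+ 2 :> R by rewrite exprn_gt0// Nn_gt0.
have := @wser_interval_mass _ _ _ P xi xi_iid (cw n) (cw_ge0 n) k (Nn n ^+ 2) b B0 V k0 D0 b00 B00
   c1 c2 c3 q2 delta M' K s N delta0 M'0 q1 NK (lt_le_trans Kb hb').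
rewrite -/tau -/Q; set x := G n s - _ => h.
have QM : Q / M' = a' / (4 * N.+1%:R) by rewrite /M'; field; rewrite !gt_eqF.
rewrite QM mulrDr in h.
rewrite (_ : N.+1%:R * (a' / (4 * N.+1%:R)) = a' / 4) in h; last by field; rewrite gt_eqF.
rewrite ler_pdivrMr ?mulr_gt0//.
by lra.
Qed.

(** An energy [delta / N^2] lowers the threshold by that amount; half of it is given up to the cross
    term, and the other half still crosses an interval of mass at least [p], uniformly over [s] in
    the bulk of the null law. *)
Lemma signal_gap (S delta a' b' : R) : 0 < S -> 0 < delta -> 0 < a' -> 0 < b' ->
  exists p n0, 0 < p /\ forall n th s, (n0 <= n)%N -> bounded_signal S n th ->
  (exists m, delta <= Nn n ^+ 2 * \sum_(j < m) kap n j * th j ^+ 2) ->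
  b' <= G n s -> a' <= 1 - G n s -> H n th s <= G n s - p.
Proof.
move=> S0 delta0 a0 b0.
have d20 : 0 < delta / 2 by lra.
have [p [n1 [p0 hp]]] := interval_mass a0 b0 d20.
have p20 : 0 < p / 2 by lra.
have [L [n2 [L0 hL]]] := cross_negligible S0 d20 p20.
exists (p / 2), (maxn n1 n2); split=> //.
move=> n th s; rewrite geq_max => /andP[nn1 nn2] hS [m0 hm0] hb ha.
have [v [hv he]] := hL n th nn2 hS.
have N0 := @Nn_gt0 R n; have D0 : 0 < Nn n ^+ 2 :> R by rewrite exprn_gt0.
have u0 : 0 <= L * Nn n ^+ 2 by rewrite mulr_ge0// ltW.
have hA : \forall m \near \oo, delta / Nn n ^+ 2 <= \sum_(j < m) kap n j * th j ^+ 2.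
  exists m0 => // m /= mm; rewrite ler_pdivrMr// mulrC; apply: le_trans hm0 _.
  rewrite ler_pM2l// -(subnKC mm) big_split_ord/= lerDl; apply: sumr_ge0 => j _.
  by rewrite mulr_ge0 ?sqr_ge0// kap0.
have := cdf_signal_le xi_iid (kap0 n) hv s (delta / 2 / Nn n ^+ 2) u0 hA.
have := hp n s nn1 hb ha.
rewrite (_ : s - delta / Nn n ^+ 2 + delta / 2 / Nn n ^+ 2 = s - delta / 2 / Nn n ^+ 2); last first.
  by field; rewrite gt_eqF.
rewrite -[fun j : nat => kap n j * noise n ^+ 2]/(cw n) => h1 h2.
apply: le_trans h2 _; apply: le_trans (lerD (lexx _) he) _; lra.
Qed.

Lemma small_signal (S e : R) : 0 < S -> 0 < e ->
  exists delta n0, 0 < delta /\ forall n th s, (n0 <= n)%N -> bounded_signal S n th ->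
  (forall m, Nn n ^+ 2 * \sum_(j < m) kap n j * th j ^+ 2 <= delta) ->
  G n s - e <= H n th s.
Proof.
move=> S0 e0; have [b [B0 [V [b00 B00 hb]]]] := model_bounds.
pose M := (Num.truncn (8 / e)).+1.
have M8 : 2 / M%:R <= e / 4.
  have : 8 / e <= M%:R by rewrite ltW// truncnS_gt.
  have MR : 0 < M%:R :> R by rewrite ltr0n.
  by rewrite ler_pdivrMr// => h; rewrite ler_pdivrMr//; lra.
have MR : 0 < M%:R :> R by rewrite ltr0n.
(* Half of the anticoncentration length [b / (24 M^2)]: one half is for the energy, the other for
   the cross term. *)
pose dl := b / (48 * M%:R ^+ 2).
have dl0 : 0 < dl by rewrite divr_gt0// mulr_gt0// exprn_gt0.
have e40 : 0 < e / 4 by lra.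
have [L [n1 [L0 hL]]] := cross_negligible S0 dl0 e40.
have [n2 hn2] := kn_geometric_small e40.
exists dl, (maxn n1 n2); split=> // n th s; rewrite geq_max => /andP[nn1 nn2] hS hA.
have [k kn] := kn_exists kap0 H3 n.
have [c1 c2 c3] := hb n k kn; have [k0 _] := kn.
have [v [hv he]] := hL n th nn1 hS.
have N0 := @Nn_gt0 R n; have D0 : 0 < Nn n ^+ 2 :> R by rewrite exprn_gt0.
have u0 : 0 <= L * Nn n ^+ 2 by rewrite mulr_ge0// ltW.
have hA' m : \sum_(j < m) kap n j * th j ^+ 2 <= dl / Nn n ^+ 2.
  by rewrite ler_pdivlMr// mulrC.
have := cdf_signal_ge xi_iid (kap0 n) hv s (dl / Nn n ^+ 2) u0 hA'.
have := @wser_anticoncentration _ _ _ P xi xi_iid (cw n) (cw_ge0 n) k (Nn n ^+ 2) b k0 D0 b00 c1 M s isT.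
rewrite -[fun j : nat => kap n j * noise n ^+ 2]/(cw n).
rewrite (_ : s - b / Nn n ^+ 2 / (24 * M%:R ^+ 2) = s - dl / Nn n ^+ 2 - dl / Nn n ^+ 2); last first.
  by rewrite /dl; field; rewrite !gt_eqF.
have := hn2 n k nn2 kn.
by lra.
Qed.

End model.

(** * From power bounds to consistency and inconsistency *)

Section consistency.
Context {R : realType} d (Omega : measurableType d) (P : probability Omega R).
Variables (xi : nat -> Omega -> R) (sigma r : R) (kap : nat -> nat -> R).
Hypotheses (sigma0 : 0 < sigma) (r2 : r < 2^-1).
Hypothesis xi_iid : iid_std_normal P xi.
Hypotheses (kap0 : weights_nonneg kap) (H1 : A1 kap).
Hypotheses (H2 : A2 sigma kap) (H3 : A3 r kap) (H5 : A5 kap).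
Local Notation bounded_signal := (bounded_signal r).
Local Notation G n := (cdf_wser P xi (cw sigma kap n)).
Local Notation H n := (cdf_signal P xi (kap n) (noise sigma n)).

Let cen n := centering sigma n (fine (rho kap n)).

Let rhoE n : rho kap n = (fine (rho kap n))%:E.
Proof. by have [rh ->] := rho_fin H3 n. Qed.

Lemma betaE n t th : beta P xi sigma kap n t th = (H n th (t + cen n))%:E.
Proof. exact: (beta_cdf xi_iid _ (kap0 n) (rhoE n)). Qed.

Lemma alphaE n t : alpha P xi sigma kap n t = (1 - G n (t + cen n))%:E.
Proof. exact: (alpha_cdf xi_iid _ (kap0 n) (rhoE n)). Qed.

(** Convergence of the levels to [a] keeps the null distribution function at the thresholds near
    [1 - a], inside the bulk where the gap [p] is uniform. The choice of [e] preserves this and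
    costs at most half of the gap. *)
Lemma consistent_of_large (S delta : R) (f : nat -> nat -> R) : 0 < S -> 0 < delta ->
  (forall n, bounded_signal S n (f n)) ->
  (forall n, exists m, delta <= Nn n ^+ 2 * \sum_(j < m) kap n j * f n j ^+ 2) ->
  consistent P xi sigma kap id f.
Proof.
move=> S0 delta0 fS fd a /andP[a0 a1] t /= ta.
have a20 : 0 < a / 2 by lra.
have b20 : 0 < (1 - a) / 2 by lra.
have [p [n0 [p0 hp]]] := signal_gap sigma0 r2 xi_iid kap0 H1 H2 H3 H5 S0 delta0 a20 b20.
have cv : (1 - G i (t i + cen i)) @[i --> \oo] --> a.
  have -> : (fun i => 1 - G i (t i + cen i)) = fine \o (fun i => alpha P xi sigma kap i (t i)).
    by apply/funext => i /=; rewrite alphaE.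
  exact: fine_cvg ta.
pose e := Num.min (p / 2) (Num.min (a / 2) ((1 - a) / 2)).
have e0 : 0 < e by rewrite !lt_min; apply/andP; split; [lra|rewrite a20 b20].
have [ep [ea eb]] : e <= p / 2 /\ e <= a / 2 /\ e <= (1 - a) / 2.
  by rewrite /e !ge_min !lexx !orbT.
have aem : a < a + e by lra.
have aep : a - e < a by lra.
have [n1 _ h1] := cvgr_le _ cv _ aem.
have [n2 _ h2] := cvgr_ge _ cv _ aep.
apply: (@le_lt_trans _ _ (1 - a - p / 2)%:E); last by rewrite lte_fin; lra.
apply: (@limn_esup_le_eventually _ _ _ (maxn n0 (maxn n1 n2))) => n.
rewrite !geq_max => /and3P[nn0 nn1 nn2].
have /= k1 := h1 n nn1; have /= k2 := h2 n nn2.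
rewrite betaE lee_fin.
have := hp n (f n) (t n + cen n) nn0 (fS n) (fd n).
move=> /(_ ltac:(lra) ltac:(lra)).
by lra.
Qed.

(** [small_signal] is uniform in the threshold, so no control of the level is required; [i <= ns i]
    carries asymptotics in [n] over to the subsequence. *)
Lemma inconsistent_of_small (S : R) (ns : nat -> nat) (g : nat -> nat -> R) : 0 < S ->
  (forall i, (i <= ns i)%N) -> (forall i, bounded_signal S (ns i) (g i)) ->
  (forall delta, 0 < delta -> exists i0, forall i, (i0 <= i)%N -> forall m,
    Nn (ns i) ^+ 2 * \sum_(j < m) kap (ns i) j * g i j ^+ 2 <= delta) ->
  inconsistent P xi sigma kap ns g.
Proof.
move=> S0 nsi gS gd t; apply: limn_einf_ge_eventually => e e0.
have [delta [n0 [delta0 h]]] := small_signal sigma0 r2 xi_iid kap0 H1 H2 H3 H5 S0 e0.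
have [i0 hi0] := gd delta delta0.
exists (maxn n0 i0) => i; rewrite geq_max => /andP[n0i i0i].
rewrite alphaE betaE -EFinD lee_fin.
have := h (ns i) (g i) (t i + cen (ns i)) (leq_trans n0i (nsi i)) (gS i) (hi0 i i0i).
by lra.
Qed.

Lemma quantile_exists : exists n0, forall n, (n0 <= n)%N ->
  exists s, 4^-1 <= G n s <= 2^-1.
Proof.
have [b [B0 [V [b00 B00 hb]]]] := model_bounds sigma0 kap0 H1 H2 H3 H5.
have [n1 hn1] := kn_large sigma0 r2 kap0 H1 H2 H3 H5 ((4 * B0) ^+ 2).
have e80 : 0 < 8^-1 :> R by rewrite invr_gt0.
have [n2 hn2] := kn_geometric_small sigma0 r2 kap0 H1 H2 H3 H5 e80.
exists (maxn n1 n2) => n; rewrite geq_max => /andP[nn1 nn2].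
have [k kn] := kn_exists kap0 H3 n.
have [c1 c2 c3] := hb n k kn; have [k0 _] := kn.
have hk1 := hn1 n k nn1 kn; have hk2 := hn2 n k nn2 kn.
have kR : 0 < k%:R :> R by rewrite ltr0n.
have sk0 : 0 < Num.sqrt (k%:R : R) by rewrite sqrtr_gt0.
have D0 : 0 < Nn n ^+ 2 :> R by rewrite exprn_gt0// Nn_gt0.
have q2 : B0 / Num.sqrt k%:R <= 4^-1.
  rewrite ler_pdivrMr// ler_pdivlMl//.
  by apply: le_sqrtr => //; rewrite mulr_ge0// ltW.
apply: (@wser_quantile _ _ _ P xi xi_iid (cw sigma kap n) (cw_ge0 sigma kap0 n) k (Nn n ^+ 2) b B0 V
  k0 D0 b00 c1 c2 c3 q2 (fine (rho kap n) * noise sigma n ^+ 2)).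
  move=> m; rewrite /cw -mulr_suml ler_wpM2r ?sqr_ge0//.
  exact: (sum_le_rho kap0 (rhoE n)).
by lra.
Qed.

(** Inconsistency concerns every choice of thresholds, so one good choice suffices: at a point where
    the null distribution function lies between [1/4] and [1/2], an energy above [delta] would lower
    the sum of errors to [1 - p], against the bound [1 - p / 2] that holds eventually. *)
Lemma small_of_inconsistent (S : R) (ns : nat -> nat) (g : nat -> nat -> R) : 0 < S ->
  (forall i, (i <= ns i)%N) -> (forall i, bounded_signal S (ns i) (g i)) ->
  inconsistent P xi sigma kap ns g ->
  forall delta, 0 < delta -> exists i0, forall i, (i0 <= i)%N -> forall m,
    Nn (ns i) ^+ 2 * \sum_(j < m) kap (ns i) j * g i j ^+ 2 <= delta.
Proof.
move=> S0 nsi gS inc delta delta0; apply: contrapT => hn.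
have [n1 hq] := quantile_exists.
have /choice[q hq'] : forall n, exists s, (n1 <= n)%N -> 4^-1 <= G n s <= 2^-1.
  move=> n; have [nn|nn] := leqP n1 n; last by exists 0.
  by have [s hs] := hq n nn; exists s.
have e40 : 0 < 4^-1 :> R by rewrite invr_gt0.
have e20 : 0 < 2^-1 :> R by rewrite invr_gt0.
have [p [n0 [p0 hp]]] := signal_gap sigma0 r2 xi_iid kap0 H1 H2 H3 H5 S0 delta0 e20 e40.
have p20 : 0 < p / 2 by lra.
have [i0 hi0] := limn_einf_gt_eventually (inc (fun i => q (ns i) - cen (ns i))) p20.
apply: hn; exists (maxn n0 (maxn n1 i0)) => i; rewrite !geq_max => /and3P[ni0 ni1 ii0] m.
rewrite leNgt; apply/negP => hm.
have := hi0 i ii0; rewrite alphaE betaE -EFinD lee_fin subrK.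
have /andP[q1 q2] := hq' (ns i) (leq_trans ni1 (nsi i)).
have := hp (ns i) (g i) (q (ns i)) (leq_trans ni0 (nsi i)) (gS i).
have hex : exists m, delta <= Nn (ns i) ^+ 2 * \sum_(j < m) kap (ns i) j * g i j ^+ 2.
  by exists m; exact: ltW.
have q2' : 2^-1 <= 1 - G (ns i) (q (ns i)) by lra.
by move=> /(_ hex q1 q2'); lra.
Qed.

End consistency.

(** * The characterization *)

Section square_summable.
Context {R : realType}.
Implicit Types (x y : nat -> R).

Definition head_seq (K : nat) x j : R := if (j < K)%N then x j else 0.
Definition tail_seq (K : nat) x j : R := if (j < K)%N then 0 else x j.

Lemma head_tailE K x j : head_seq K x j + tail_seq K x j = x j.
Proof. by rewrite /head_seq /tail_seq; case: ifP; rewrite ?addr0 ?add0r. Qed.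

Lemma head_tail_sqr K x j : x j ^+ 2 = head_seq K x j ^+ 2 + tail_seq K x j ^+ 2.
Proof.
by rewrite /head_seq /tail_seq; case: ifP; rewrite expr0n/= ?addr0 ?add0r.
Qed.

Lemma tail_seq_sqr_le K x j : tail_seq K x j ^+ 2 <= x j ^+ 2.
Proof. by rewrite [leRHS](head_tail_sqr K) lerDr sqr_ge0. Qed.

Lemma head_seq_sqr_le K x j : head_seq K x j ^+ 2 <= x j ^+ 2.
Proof. by rewrite [leRHS](head_tail_sqr K) lerDl sqr_ge0. Qed.

Lemma tail_seq_anti K L x j : (K <= L)%N -> tail_seq L x j ^+ 2 <= tail_seq K x j ^+ 2.
Proof.
rewrite /tail_seq => KL; case: (ltnP j L) => jL; first by rewrite expr0n sqr_ge0.
by rewrite ltnNge (leq_trans KL jL).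
Qed.

Lemma sqn_le_fin x (s : R) : (sqn x <= s%:E)%E <-> forall m, \sum_(j < m) x j ^+ 2 <= s.
Proof. by apply: nneseries_le_fin => j; exact: sqr_ge0. Qed.

Lemma sqn_gt_fin x (s : R) : (s%:E < sqn x)%E <-> exists m, s < \sum_(j < m) x j ^+ 2.
Proof.
rewrite ltNge; split=> [/negP h|[m hm]].
  apply: contrapT => h'; apply: h; apply/sqn_le_fin => m; rewrite leNgt; apply/negP => hm.
  by apply: h'; exists m.
by apply/negP => /sqn_le_fin/(_ m); rewrite leNgt hm.
Qed.

Lemma sqn_lty x : (sqn x < +oo)%E -> exists s, forall m, \sum_(j < m) x j ^+ 2 <= s.
Proof.
move=> h; have f : sqn x \is a fin_num.
  by rewrite ge0_fin_numE//; apply: nneseries_ge0 => j _ _; rewrite lee_fin sqr_ge0.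
by exists (fine (sqn x)); apply/sqn_le_fin; rewrite fineK.
Qed.

Lemma sum_sqr_homo x m m' : (m <= m')%N -> \sum_(j < m) x j ^+ 2 <= \sum_(j < m') x j ^+ 2.
Proof.
move=> mm; rewrite -(subnKC mm) big_split_ord/= lerDl.
by apply: sumr_ge0 => j _; exact: sqr_ge0.
Qed.

Lemma cvg_sum_sqr x s : (forall m, \sum_(j < m) x j ^+ 2 <= s) ->
  cvgn (series (fun j => x j ^+ 2)).
Proof.
move=> h; apply: nondecreasing_is_cvgn.
  by apply: nondecreasing_series => j _ _; exact: sqr_ge0.
by exists s => _ [m _ <-]; rewrite /series/= big_mkord.
Qed.

Lemma tail_vanish x s e : (forall m, \sum_(j < m) x j ^+ 2 <= s) -> 0 < e ->
  exists K, forall m, \sum_(j < m) tail_seq K x j ^+ 2 <= e.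
Proof.
move=> h e0; have cv := cvg_sum_sqr h.
have nd : nondecreasing_seq (series (fun j => x j ^+ 2)).
  by apply: nondecreasing_series => j _ _; exact: sqr_ge0.
have le_lim := nondecreasing_cvgn_le nd cv.
set l := limn _ in le_lim.
have le : l - e < l by lra.
have [K _ hK] := cvgr_ge _ cv _ le.
exists K => m.
have hKK : l - e <= \sum_(j < K) x j ^+ 2 by have := hK K (leqnn _); rewrite /series/= big_mkord.
pose m' := maxn m K.
apply: (@le_trans _ _ (\sum_(j < m') tail_seq K x j ^+ 2)).
  by apply: sum_sqr_homo; exact: leq_maxl.
have : \sum_(j < m') x j ^+ 2 <= l by have := le_lim m'; rewrite /series/= big_mkord.
have -> : \sum_(j < m') x j ^+ 2 = \sum_(j < m') head_seq K x j ^+ 2 + \sum_(j < m') tail_seq K x j ^+ 2.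
  by rewrite -big_split/=; apply: eq_bigr => j _; exact: head_tail_sqr.
have : \sum_(j < K) x j ^+ 2 <= \sum_(j < m') head_seq K x j ^+ 2.
  apply: le_trans (sum_sqr_homo _ (leq_maxr m K)).
  by apply: ler_sum => j _; rewrite /head_seq ltn_ord.
by lra.
Qed.

(** [ip] is a limit, informative only if the partial sums converge; absolute convergence follows
    from [|x y| <= x^2 + y^2]. Orthogonality can then be used on long partial sums. *)
Lemma cvg_ip x y : (sqn x < +oo)%E -> (sqn y < +oo)%E ->
  \sum_(j < m) x j * y j @[m --> \oo] --> ip x y.
Proof.
move=> /sqn_lty[s hs] /sqn_lty[t ht].
have cn : cvgn [normed series (fun j => x j * y j)].
  apply: (@series_le_cvg _ _ (fun j => x j ^+ 2 + y j ^+ 2)) => [j|j|j|].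
  - exact: normr_ge0.
  - by rewrite addr_ge0 ?sqr_ge0.
  - rewrite -[leLHS]/(`|x j * y j|) normrM -(real_normK (num_real (x j))) -(real_normK (num_real (y j))).
    have := sqr_ge0 (`|x j| - `|y j|); have := sqr_ge0 `|x j|; have := sqr_ge0 `|y j|.
    rewrite (_ : (`|x j| - `|y j|) ^+ 2 = `|x j| ^+ 2 + `|y j| ^+ 2 - 2 * (`|x j| * `|y j|)); last by ring.
    by lra.
  - rewrite (_ : series _ = series (fun j => x j ^+ 2) + series (fun j => y j ^+ 2)); last first.
      by apply/funext => n; rewrite /series/= big_split.
    by apply: is_cvgD; [exact: cvg_sum_sqr hs|exact: cvg_sum_sqr ht].
have E : (fun m => \sum_(j < m) x j * y j) = series (fun j => x j * y j).
  by apply/funext => m; rewrite /series/= big_mkord.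
by rewrite /ip E; exact: (@normed_cvg _ R^o _ cn).
Qed.

End square_summable.

Section characterization.
Context {R : realType} d (Omega : measurableType d) (P : probability Omega R).
Variables (xi : nat -> Omega -> R) (sigma r : R) (kap : nat -> nat -> R).
Hypotheses (sigma0 : 0 < sigma) (r0 : 0 < r) (r2 : r < 2^-1).
Hypothesis xi_iid : iid_std_normal P xi.
Hypotheses (kap0 : weights_nonneg kap) (H1 : A1 kap).
Hypotheses (H2 : A2 sigma kap) (H3 : A3 r kap) (H4 : A4 kap) (H5 : A5 kap).
Variables (f : nat -> nat -> R) (c C : R).
Hypotheses (c0 : 0 < c) (C0 : 0 < C).
Local Notation rate := (rate r).
Hypothesis f_low : forall n, (((c * rate n) ^+ 2)%:E <= sqn (f n))%E.
Hypothesis f_high : forall n, (sqn (f n) <= ((C * rate n) ^+ 2)%:E)%E.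

Let s := r / (2 - 4 * r).

Let s0 : 0 < s.
Proof. by rewrite divr_gt0//; have := r2; lra. Qed.

Lemma rate_powR n : (Nn n ^+ 2 * rate n ^+ 4) `^ (2 * s) = (rate n ^+ 2)^-1.
Proof.
have N0 := @Nn_gt0 R n.
have -> : Nn n ^+ 2 * rate n ^+ 4 = Nn n `^ (2 - 4 * r).
  rewrite /rate -[X in X * _ = _]powR_mulrn ?ltW// -[X in _ * X = _]powR_mulrn ?powR_ge0//.
  rewrite -powRrM -powRD; last by apply/implyP => _; rewrite gt_eqF.
  by congr (_ `^ _); ring.
rewrite -powRrM -rate_sqr -powRN opprK; congr (_ `^ _).
by rewrite /s; field; rewrite gt_eqF//; have := r2; lra.
Qed.

Lemma f_bounded n m : \sum_(j < m) f n j ^+ 2 <= C ^+ 2 * rate n ^+ 2.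
Proof. by rewrite -exprMn; move: m; apply/sqn_le_fin. Qed.

Lemma weights_high (D : nat) : (1 < D)%N -> exists2 e : R, 0 < e & forall n k, is_kn kap n k ->
  e <= Nn n ^+ 2 * rate n ^+ 2 * kap n (D * k).-1.
Proof.
move=> D1; have [_ /(_ D%:R)] := H5; rewrite ltr1n => /(_ D1)[C5 [C50 h5]].
have [e1 [e2 [d1 [d2 [V [e10 e20 d10 d20 hw]]]]]] := weight_bounds sigma0 kap0 H1 H2 H3 H5.
exists (C5 * e1); first exact: mulr_gt0.
move=> n k kn; have [K1 _ _ _ _] := hw n k kn; have := h5 n k kn.
rewrite -natrM natrK => h.
apply: (@le_trans _ _ (C5 * (Nn n ^+ 2 * rate n ^+ 2 * kap n k.-1))).
  by rewrite ler_pM2l.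
rewrite mulrCA ler_pM2l// mulr_gt0// exprn_gt0 ?Nn_gt0 ?rate_gt0//.
Qed.

Lemma head_energy (D : nat) (x : nat -> R) n k m : is_kn kap n k -> (0 < D)%N ->
  kap n (D * k).-1 * \sum_(j < m) head_seq (D * k) x j ^+ 2 <= \sum_(j < m) kap n j * x j ^+ 2.
Proof.
move=> [k0 _] D0; rewrite mulr_sumr; apply: ler_sum => j _; rewrite /head_seq.
case: ifP => jD; last by rewrite expr0n mulr0 mulr_ge0 ?sqr_ge0// kap0.
by rewrite ler_wpM2r ?sqr_ge0// H1// -ltnS prednK// muln_gt0 D0.
Qed.

(** * Besov approximation implies pure consistency *)

Section sufficiency.
Hypothesis approx : forall eps : R, 0 < eps -> exists Peps : R, 0 < Peps /\
  exists f1 : nat -> nat -> R, forall n,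
    besov s Peps (f1 n) /\
    (sqn (fun j => (f n j - f1 n j)%R) <= ((eps * rate n) ^+ 2)%:E)%E.

Lemma besov_tail (eta : R) : 0 < eta -> exists2 D : nat, (1 < D)%N &
  forall n k, is_kn kap n k -> forall m,
  \sum_(j < m) tail_seq (D * k) (f n) j ^+ 2 <= eta * rate n ^+ 2.
Proof.
move=> eta0.
have se0 : 0 < Num.sqrt (eta / 4) by rewrite sqrtr_gt0; lra.
have [Pe [Pe0 [g hg]]] := approx se0.
have [e1 [e2 [d1 [d2 [V [e10 e20 d10 d20 hw]]]]]] := weight_bounds sigma0 kap0 H1 H2 H3 H5.
(* For [D >= x] one has [(D d1)^(2 s) >= 4 Pe / eta], so the tail of the approximant beyond [D k_n]
   has squared norm at most [eta / 4] on the scale [rate n ^+ 2]. The error of approximation takes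
   another [eta / 4], and [(u + v)^2 <= 2 u^2 + 2 v^2] doubles both. *)
pose x := (4 * Pe / eta) `^ (2 * s)^-1 / d1.
have x0 : 0 <= x by rewrite divr_ge0 ?powR_ge0// ltW.
exists (Num.truncn x).+2 => // n k kn m; set D := (Num.truncn x).+2.
have xD : x <= D%:R.
  apply: le_trans (ltW (truncnS_gt x)) _; by rewrite ler_nat.
have [k0 _] := kn; have [_ _ k1 _ _] := hw n k kn.
have [hB hd] := hg n.
have q0 := rate_gt0 r n; have N0 := @Nn_gt0 R n.
have q20 : 0 < rate n ^+ 2 by rewrite exprn_gt0.
have Dk0 : 0 < (D * k)%:R :> R by rewrite ltr0n muln_gt0 k0.
have gt : \sum_(j < m) tail_seq (D * k) (g n) j ^+ 2 <= Pe / (D * k)%:R `^ (2 * s).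
  have := hB (D * k)%:R Dk0; rewrite -lee_pdivlMl ?powR_gt0// -EFinM.
  rewrite eseries_mkcond mulrC => hS; move: m; apply/sqn_le_fin.
  apply: le_trans hS; rewrite /sqn le_eqVlt; apply/orP; left; apply/eqP.
  (* Indices start at 0: the condition [D k < j + 1] selects exactly the coordinates [j >= D k] kept
     by [tail_seq]. *)
  apply: eq_eseriesr => j _; rewrite /tail_seq ltr_nat ltnS.
  by case: ltnP; rewrite ?expr0n.
have Nq0 : 0 <= Nn n ^+ 2 * rate n ^+ 4.
  by apply: mulr_ge0; apply: exprn_ge0; exact: ltW.
have Dd0 : 0 <= D%:R * d1 by apply: mulr_ge0 => //; exact: ltW.
have powDk : 4 * Pe / eta * (rate n ^+ 2)^-1 <= (D * k)%:R `^ (2 * s).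
  rewrite -rate_powR.
  apply: (@le_trans _ _ ((D%:R * (d1 * (Nn n ^+ 2 * rate n ^+ 4))) `^ (2 * s))); last first.
    apply: ge0_ler_powR; rewrite ?nnegrE//.
    - by apply: mulr_ge0 => //; exact: ltW.
    - by rewrite mulrA mulr_ge0.
    - by rewrite natrM ler_wpM2l.
  rewrite [D%:R * (_ * _)]mulrA [leRHS]powRM//.
  apply: ler_wpM2r; first exact: powR_ge0.
  have -> : 4 * Pe / eta = (x * d1) `^ (2 * s).
    have s20 : 2 * s != 0 by rewrite gt_eqF// mulr_gt0.
    rewrite /x divfK ?gt_eqF// -powRrM mulVf// powRr1//.
    by apply: divr_ge0; [apply: mulr_ge0 => //|]; exact: ltW.
  apply: ge0_ler_powR; rewrite ?nnegrE//.
  - by apply: mulr_ge0 => //; exact: ltW.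
  - by apply: mulr_ge0 => //; exact: ltW.
  - by rewrite ler_pM2r.
have gt' : \sum_(j < m) tail_seq (D * k) (g n) j ^+ 2 <= eta / 4 * rate n ^+ 2.
  apply: le_trans gt _; rewrite ler_pdivrMr ?powR_gt0//.
  apply: (@le_trans _ _ (eta / 4 * rate n ^+ 2 * (4 * Pe / eta * (rate n ^+ 2)^-1))).
    rewrite le_eqVlt; apply/orP; left; apply/eqP; field.
    by rewrite !gt_eqF.
  by rewrite ler_wpM2l// mulr_ge0 ?(ltW q20)//; lra.
have hd' : \sum_(j < m) (f n j - g n j) ^+ 2 <= eta / 4 * rate n ^+ 2.
  have -> : eta / 4 * rate n ^+ 2 = (Num.sqrt (eta / 4) * rate n) ^+ 2.
    by rewrite exprMn sqr_sqrtr//; lra.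
  by move: m {gt gt'}; apply/(sqn_le_fin (fun j => f n j - g n j)).
apply: (@le_trans _ _ (\sum_(j < m) (2 * tail_seq (D * k) (g n) j ^+ 2 + 2 * (f n j - g n j) ^+ 2))).
  apply: ler_sum => j _; rewrite /tail_seq; case: ifP => _.
    by rewrite expr0n/=; have := sqr_ge0 (f n j - g n j); lra.
  have := sqr_ge0 (g n j - (f n j - g n j)); rewrite -subr_ge0 => h.
  by rewrite -subr_ge0; apply: le_trans h _; rewrite le_eqVlt; apply/orP; left; apply/eqP; ring.
rewrite big_split/= -!mulr_sumr.
by lra.
Qed.

Lemma energy_large : exists2 delta : R, 0 < delta & forall n, exists m,
  delta <= Nn n ^+ 2 * \sum_(j < m) kap n j * f n j ^+ 2.
Proof.
have c20 : 0 < c ^+ 2 / 4 by rewrite divr_gt0// exprn_gt0.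
have [D D1 hD] := besov_tail c20; have [e e0 he] := weights_high D1.
exists (e * (c ^+ 2 / 4)); first exact: mulr_gt0.
move=> n; have [k kn] := kn_exists kap0 H3 n.
have q0 := rate_gt0 r n; have N0 := @Nn_gt0 R n.
have q20 : 0 < rate n ^+ 2 by rewrite exprn_gt0.
have cq0 : 0 < c ^+ 2 * rate n ^+ 2 by rewrite mulr_gt0// exprn_gt0.
(* Some partial sum exceeds [c^2 / 2]; removing a tail of at most [c^2 / 4] leaves [c^2 / 4] on the
   coordinates where the weights are bounded below. *)
have [m hm] : exists m, c ^+ 2 / 2 * rate n ^+ 2 < \sum_(j < m) f n j ^+ 2.
  apply/sqn_gt_fin; apply: lt_le_trans (f_low n).
  by rewrite lte_fin exprMn; lra.
exists m.
have h1 := hD n k kn m.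
have hs : \sum_(j < m) f n j ^+ 2 = \sum_(j < m) head_seq (D * k) (f n) j ^+ 2 +
    \sum_(j < m) tail_seq (D * k) (f n) j ^+ 2.
  by rewrite -big_split/=; apply: eq_bigr => j _; exact: head_tail_sqr.
have h2 : c ^+ 2 / 4 * rate n ^+ 2 <= \sum_(j < m) head_seq (D * k) (f n) j ^+ 2 by lra.
have h3 := head_energy (f n) m kn (ltnW D1).
apply: (@le_trans _ _ (Nn n ^+ 2 * (kap n (D * k).-1 * (c ^+ 2 / 4 * rate n ^+ 2)))).
  rewrite [leRHS](_ : _ = Nn n ^+ 2 * rate n ^+ 2 * kap n (D * k).-1 * (c ^+ 2 / 4)); last by ring.
  by rewrite ler_pM2r// he.
rewrite ler_pM2l ?exprn_gt0//; apply: le_trans h3.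
by rewrite ler_wpM2l// kap0.
Qed.

Lemma approx_nr_consistent : nr_consistent P xi sigma kap r f.
Proof.
split.
  have [delta delta0 hd] := energy_large.
  have C20 : 0 < C ^+ 2 by rewrite exprn_gt0.
  exact: (consistent_of_large sigma0 r2 xi_iid kap0 H1 H2 H3 H5 C20 delta0 f_bounded hd).
have cC : c <= C.
  have q0 := rate_gt0 r 0.
  have := le_trans (f_low 0%N) (f_high 0%N).
  rewrite lee_fin !exprMn ler_pM2r ?exprn_gt0// ler_pXn2r// nnegrE; exact: ltW.
have c0' := c0; exists (c / 2), (C * 2); split; first lra; split; first lra.
have c20 : 0 < c ^+ 2 by rewrite exprn_gt0.
have C20 : 0 < C ^+ 2 by rewrite exprn_gt0.
move=> n; have q0 : 0 < rate n ^+ 2 by rewrite exprn_gt0// rate_gt0.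
apply/andP; split.
  apply: lt_le_trans (f_low n); rewrite lte_fin -/(rate n) !exprMn ltr_pM2r//.
  by rewrite exprVn; lra.
apply: le_lt_trans (f_high n) _; rewrite lte_fin -/(rate n) !exprMn ltr_pM2r//.
by rewrite ltr_pMr// -natrX ltr1n.
Qed.

Lemma approx_pure : purely_nr_consistent P xi sigma kap r f.
Proof.
split; first exact: approx_nr_consistent.
move=> [ns [f1 [f2 [c1 [nsS [c10 [hdec inc]]]]]]].
have nsi i : (i <= ns i)%N by elim: i => // i IH; exact: leq_ltn_trans (nsS i).
have C20 : 0 < C ^+ 2 by rewrite exprn_gt0.
have cross i (e : R) : 0 < e -> exists m0, forall m, (m0 <= m)%N ->
    - e <= \sum_(j < m) f2 i j * f1 i j <= e.
  move=> e0; have [_ [fin1 [fin2 [ip0 _]]]] := hdec i.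
  have := cvg_ip fin2 fin1; rewrite ip0 => cv.
  have Ne0 : - e < 0 by lra.
  have [m1 _ h1] := cvgr_le _ cv _ e0.
  have [m2 _ h2] := cvgr_ge _ cv _ Ne0.
  exists (maxn m1 m2) => m; rewrite geq_max => /andP[mm1 mm2].
  by apply/andP; split; [exact: h2|exact: h1].
(* On partial sums [f1] and [f2] are only nearly orthogonal; the factor 2 absorbs the remaining
   cross term. *)
have f2S i : bounded_signal r (2 * C ^+ 2) (ns i) (f2 i).
  move=> m; have [hf _] := hdec i.
  have q0 := rate_gt0 r (ns i).
  have q20 : 0 < C ^+ 2 * rate (ns i) ^+ 2 by rewrite mulr_gt0// exprn_gt0.
  have q30 : 0 < C ^+ 2 * rate (ns i) ^+ 2 / 2 by lra.
  have [m0 hm0] := cross i _ q30.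
  apply: le_trans (sum_sqr_homo (f2 i) (leq_maxl m m0)) _.
  have /andP[h1 _] := hm0 _ (leq_maxr m m0).
  have := f_bounded (ns i) (maxn m m0).
  have -> : \sum_(j < maxn m m0) f (ns i) j ^+ 2 = \sum_(j < maxn m m0) f1 i j ^+ 2 +
    2 * (\sum_(j < maxn m m0) f2 i j * f1 i j) + \sum_(j < maxn m m0) f2 i j ^+ 2.
    rewrite mulr_sumr -!big_split/=; apply: eq_bigr => j _; rewrite hf; ring.
  have : 0 <= \sum_(j < maxn m m0) f1 i j ^+ 2 by apply: sumr_ge0 => j _; exact: sqr_ge0.
  by lra.
have C2S : 0 < 2 * C ^+ 2 by lra.
have small := small_of_inconsistent sigma0 r2 xi_iid kap0 H1 H2 H3 H5 C2S nsi f2S inc.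
have c120 : 0 < c1 ^+ 2 by rewrite exprn_gt0.
have eta0 : 0 < c1 ^+ 2 / 8 by lra.
have [D D1 hD] := besov_tail eta0; have [e e0 he] := weights_high D1.
(* The weight in Young's inequality, chosen so that the contribution [mu / 2 * C ^+ 2] of [f] is
   [c1 ^+ 2 / 8]. *)
pose mu := c1 ^+ 2 / (4 * C ^+ 2).
have mu0 : 0 < mu by rewrite divr_gt0// mulr_gt0.
have dl0 : 0 < mu * e * c1 ^+ 2 / 4.
  by apply: divr_gt0 => //; apply: mulr_gt0 => //; exact: mulr_gt0.
have [i hi] := small _ dl0; have {hi} hA := hi i (leqnn _).
have [hf [fin1 [fin2 [ip0 c1f2]]]] := hdec i.
have [k kn] := kn_exists kap0 H3 (ns i).
have q0 := rate_gt0 r (ns i); have N0 := @Nn_gt0 R (ns i).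
have q20 : 0 < rate (ns i) ^+ 2 by rewrite exprn_gt0.
have N20 : 0 < Nn (ns i) ^+ 2 :> R by rewrite exprn_gt0.
have cq0 : 0 < c1 ^+ 2 * rate (ns i) ^+ 2 by rewrite mulr_gt0.
have cq80 : 0 < c1 ^+ 2 * rate (ns i) ^+ 2 / 8 by lra.
have [m0 hm0] := cross i _ cq80.
have /sqn_gt_fin[m1 hm1] := c1f2.
pose m := maxn m0 m1.
have /andP[ip1 _] := hm0 m (leq_maxl _ _).
have big : c1 ^+ 2 * rate (ns i) ^+ 2 < \sum_(j < m) f2 i j ^+ 2.
  apply: lt_le_trans (sum_sqr_homo (f2 i) (leq_maxr m0 m1)).
  by move: hm1; rewrite exprMn.
have low2 : \sum_(j < m) head_seq (D * k) (f2 i) j ^+ 2 <= mu * c1 ^+ 2 / 4 * rate (ns i) ^+ 2.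
  have h3 := head_energy (f2 i) m kn (ltnW D1).
  set X := \sum_(j < m) _ in h3 *.
  have X0 : 0 <= X by apply: sumr_ge0 => j _; exact: sqr_ge0.
  have h4 : e * X <= mu * e * c1 ^+ 2 / 4 * rate (ns i) ^+ 2.
    apply: (@le_trans _ _ (rate (ns i) ^+ 2 * (Nn (ns i) ^+ 2 * (kap (ns i) (D * k).-1 * X)))).
      rewrite [leRHS](_ : _ = Nn (ns i) ^+ 2 * rate (ns i) ^+ 2 * kap (ns i) (D * k).-1 * X); last by ring.
      by rewrite ler_wpM2r// he.
    rewrite [leRHS]mulrC ler_pM2l//; apply: le_trans (hA m).
    by rewrite ler_pM2l.
  rewrite -(ler_pM2l e0); apply: le_trans h4 _.
  by rewrite le_eqVlt; apply/orP; left; apply/eqP; ring.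
have tl := hD (ns i) k kn m.
have fb := f_bounded (ns i) m.
(* Young's inequality with different weights on the two ranges: on the head [f2] is small and [f]
   merely bounded, on the tail [f] is small. In units of [c1^2 rate^2] this yields
   [X - 1/8 <= 3/8 + X / 4] for the squared norm [X > 1] of [f2], a contradiction. *)
have key : \sum_(j < m) f (ns i) j * f2 i j <=
    mu / 2 * \sum_(j < m) f (ns i) j ^+ 2 +
    (2 * mu)^-1 * \sum_(j < m) head_seq (D * k) (f2 i) j ^+ 2 +
    4^-1 * \sum_(j < m) f2 i j ^+ 2 + \sum_(j < m) tail_seq (D * k) (f (ns i)) j ^+ 2.
  rewrite !mulr_sumr -!big_split/=; apply: ler_sum => j _.
  rewrite /head_seq /tail_seq; set u := f (ns i) j; set v := f2 i j.
  have u2 := sqr_ge0 u; have v2 := sqr_ge0 v.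
  have muu : 0 <= mu / 2 * u ^+ 2 by rewrite mulr_ge0//; lra.
  case: ifP => _; rewrite expr0n/=.
    have im0 : 0 < (2 * mu)^-1 by rewrite invr_gt0; lra.
    have := mulr_ge0 (ltW im0) (sqr_ge0 (mu * u - v)).
    rewrite (_ : (2 * mu)^-1 * (mu * u - v) ^+ 2 = mu / 2 * u ^+ 2 + (2 * mu)^-1 * v ^+ 2 - u * v); last first.
      by field; rewrite gt_eqF.
    by lra.
  have := sqr_ge0 (u - v / 2).
  rewrite (_ : (u - v / 2) ^+ 2 = u ^+ 2 - u * v + 4^-1 * v ^+ 2); last by field.
  by lra.
have muE : mu / 2 * (C ^+ 2 * rate (ns i) ^+ 2) = c1 ^+ 2 / 8 * rate (ns i) ^+ 2.
  by rewrite /mu; field; rewrite gt_eqF.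
have k1 : mu / 2 * \sum_(j < m) f (ns i) j ^+ 2 <= c1 ^+ 2 / 8 * rate (ns i) ^+ 2.
  by rewrite -muE; apply: ler_wpM2l fb; lra.
have k2 : (2 * mu)^-1 * \sum_(j < m) head_seq (D * k) (f2 i) j ^+ 2 <= c1 ^+ 2 / 8 * rate (ns i) ^+ 2.
  rewrite [leRHS](_ : _ = (2 * mu)^-1 * (mu * c1 ^+ 2 / 4 * rate (ns i) ^+ 2)); last first.
    by field; rewrite gt_eqF.
  by apply: ler_wpM2l low2; rewrite invr_ge0; lra.
have fE : \sum_(j < m) f (ns i) j * f2 i j = \sum_(j < m) f2 i j * f1 i j + \sum_(j < m) f2 i j ^+ 2.
  by rewrite -big_split/=; apply: eq_bigr => j _; rewrite hf; ring.
rewrite fE in key.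
by lra.
Qed.

End sufficiency.

(** * Pure consistency implies Besov approximation *)

Section necessity.
Variable kn : nat -> nat.
Hypothesis knP : forall n, is_kn kap n (kn n).
Hypothesis pure : purely_nr_consistent P xi sigma kap r f.

Let bad (eps : R) (D n : nat) := exists m,
  (eps * rate n) ^+ 2 < \sum_(j < m) tail_seq (D * kn n) (f n) j ^+ 2.

(** If no [D] works for all [n], tails beyond [(i + 2) k_n] stay above [eps * rate] along a
    subsequence. Head and tail there are orthogonal, and A4 makes the weights on the tail, hence its
    energy, vanish: an inconsistent component that purity forbids. *)
Lemma tail_uniform (eps : R) : 0 < eps -> exists2 D : nat, (0 < D)%N &
  forall n m, \sum_(j < m) tail_seq (D * kn n) (f n) j ^+ 2 <= (eps * rate n) ^+ 2.
Proof.
move=> eps0.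
have [good|allbad] := pselect (exists D, forall n, ~ bad eps D n).
  have [D hD] := good; exists D.+1 => // n m; rewrite leNgt; apply/negP => h.
  apply: (hD n); exists m; apply: lt_le_trans h _; apply: ler_sum => j _.
  by apply: tail_seq_anti; rewrite leq_mul2r leqnSn orbT.
exfalso.
have bad_anti D D' n : (D <= D')%N -> bad eps D' n -> bad eps D n.
  move=> DD' [m hm]; exists m; apply: lt_le_trans hm _; apply: ler_sum => j _.
  by apply: tail_seq_anti; rewrite leq_mul2r DD' orbT.
(* A fixed [n] is not bad for large [D], so finitely many indices can be cured together by summing
   their cut-offs; badness for every [D] must therefore occur at arbitrarily large [n]. *)
have io D m : exists n, (m <= n)%N /\ bad eps D n.
  apply: contrapT => hn; apply: allbad.
  have /choice[K hK] : forall n, exists K, ~ bad eps K n.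
    move=> n; have e0 : 0 < (eps * rate n) ^+ 2 by rewrite exprn_gt0// mulr_gt0// rate_gt0.
    have [K hK] := tail_vanish (f_bounded n) e0; exists K => -[m' hm'].
    have := hK m'; rewrite leNgt => /negP; apply; apply: lt_le_trans hm' _.
    apply: ler_sum => j _; apply: tail_seq_anti.
    by have [k0 _] := knP n; rewrite leq_pmulr.
  exists (D + \sum_(i < m) K i)%N => n hb.
  have [mn|nm] := leqP m n.
    by apply: hn; exists n; split=> //; apply: bad_anti hb; exact: leq_addr.
  apply: (hK n); apply: bad_anti hb; apply: leq_trans (leq_addl _ _).
  by rewrite (bigD1 (Ordinal nm))//= leq_addr.
have /choice[h hh] : forall Dm : nat * nat, exists n, (Dm.2 <= n)%N /\ bad eps Dm.1 n.
  by move=> [D m]; exact: io.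
(* The cut-off is [i + 2], so that A4 applies with [delta = i + 1 > 0]. *)
pose ns := fix ns (i : nat) : nat :=
  match i with 0 => h (2, 0)%N | i'.+1 => h (i'.+3, (ns i').+1) end.
have nsS i : (ns i < ns i.+1)%N by have [] := hh (i.+3, (ns i).+1).
have nsb i : bad eps i.+2 (ns i).
  by case: i => [|i]; [have [] := hh (2, 0)%N|have [] := hh (i.+3, (ns i).+1)].
have nsi i : (i <= ns i)%N by elim: i => // i IH; exact: leq_ltn_trans (nsS i).
case: pure => _; apply.
pose K i := (i.+2 * kn (ns i))%N.
exists ns, (fun i => head_seq (K i) (f (ns i))), (fun i => tail_seq (K i) (f (ns i))), eps.
have tS i m : \sum_(j < m) tail_seq (K i) (f (ns i)) j ^+ 2 <= C ^+ 2 * rate (ns i) ^+ 2.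
  apply: le_trans (f_bounded (ns i) m); apply: ler_sum => j _; exact: tail_seq_sqr_le.
have hS i m : \sum_(j < m) head_seq (K i) (f (ns i)) j ^+ 2 <= C ^+ 2 * rate (ns i) ^+ 2.
  apply: le_trans (f_bounded (ns i) m); apply: ler_sum => j _; exact: head_seq_sqr_le.
split=> //; split=> //; split.
  move=> i; split; first by move=> j; rewrite head_tailE.
  split; first by apply: le_lt_trans (ltry (C ^+ 2 * rate (ns i) ^+ 2)); apply/sqn_le_fin.
  split; first by apply: le_lt_trans (ltry (C ^+ 2 * rate (ns i) ^+ 2)); apply/sqn_le_fin.
  split; last by apply/sqn_gt_fin; exact: nsb.
  rewrite /ip [X in lim (X @ _)](_ : _ = cst 0) ?lim_cst//.
  apply/funext => m; apply: big1 => j _; rewrite /head_seq /tail_seq.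
  by case: ifP; rewrite ?mul0r ?mulr0.
have C20 : 0 < C ^+ 2 by rewrite exprn_gt0.
apply: (inconsistent_of_small sigma0 r2 xi_iid kap0 H1 H2 H3 H5 C20 nsi) => //.
move=> delta delta0.
have [C4 [lam [C40 [lam1 h4]]]] := H4.
have [e1 [e2 [d1 [d2 [V [e10 e20 d10 d20 hw]]]]]] := weight_bounds sigma0 kap0 H1 H2 H3 H5.
(* Since [lam > 1], the tail energy times [N^2] is at most [C4 * C ^+ 2 * e2 / (i + 2)]. *)
pose x := C4 * C ^+ 2 * e2 / delta.
exists (Num.truncn x).+1 => i hi m.
have q0 := rate_gt0 r (ns i); have N0 := @Nn_gt0 R (ns i).
have [k0 _] := knP (ns i); have [_ K2 _ _ _] := hw _ _ (knP (ns i)).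
have i20 : 0 < i.+2%:R :> R by rewrite ltr0n.
have := h4 i.+1%:R (ns i) (kn (ns i)) ltac:(by rewrite ltr0n) (knP (ns i)).
rewrite addrC natr1 -natrM natrK -/(K i) => hk.
have hpow : i.+2%:R `^ (- lam) <= i.+2%:R^-1.
  have -> : i.+2%:R^-1 = i.+2%:R `^ (-1) :> R by rewrite powR_inv1.
  by apply: ler_powR; [rewrite ler1n|lra].
have hkj j : (K i <= j)%N -> kap (ns i) j <= C4 * i.+2%:R^-1 * kap (ns i) (kn (ns i)).-1.
  move=> Kj; apply: (@le_trans _ _ (kap (ns i) (K i).-1)).
    by apply: H1; apply: leq_trans Kj; exact: leq_pred.
  apply: le_trans (ltW hk) _; rewrite ler_wpM2r ?kap0//.
  by rewrite ler_pM2l.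
set kk := kap (ns i) (kn (ns i)).-1 in hk hkj *.
apply: (@le_trans _ _ (Nn (ns i) ^+ 2 * (C4 * i.+2%:R^-1 * kk * (C ^+ 2 * rate (ns i) ^+ 2)))).
  rewrite ler_pM2l ?exprn_gt0//.
  apply: (@le_trans _ _ (C4 * i.+2%:R^-1 * kk * \sum_(j < m) tail_seq (K i) (f (ns i)) j ^+ 2)); last first.
    apply: ler_wpM2l => //; rewrite mulr_ge0 ?kap0// mulr_ge0 ?invr_ge0 ?ltW//.
  rewrite mulr_sumr; apply: ler_sum => j _; rewrite /tail_seq.
  case: ltnP => jK; first by rewrite expr0n !mulr0.
  by rewrite ler_wpM2r ?sqr_ge0// hkj.
rewrite (_ : _ * _ = C4 * C ^+ 2 / i.+2%:R * (Nn (ns i) ^+ 2 * rate (ns i) ^+ 2 * kk)); last by ring.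
apply: (@le_trans _ _ (C4 * C ^+ 2 / i.+2%:R * e2)).
  by apply: ler_wpM2l (K2 _); rewrite divr_ge0 ?mulr_ge0// ltW.
rewrite mulrAC ler_pdivrMr//.
have xi' : x <= i.+2%:R.
  apply: le_trans (ltW (truncnS_gt x)) _; rewrite ler_nat.
  by apply: leq_trans hi _; rewrite -addn2 leq_addr.
by move: xi'; rewrite /x ler_pdivrMr// [i.+2%:R * _]mulrC.
Qed.

(** The approximant is [f n] cut at [D k_n], which makes the Pythagorean identity exact. Its Besov
    condition is void for [lam >= D k_n]; below, [lam^(2 s)] is at most [(D d2)^(2 s) / rate^2],
    which cancels the bound [C^2 rate^2] on the norm. *)
Lemma pure_approx (eps : R) : 0 < eps -> exists Peps : R, 0 < Peps /\
  exists f1 : nat -> nat -> R, forall n,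
    besov s Peps (f1 n) /\
    (sqn (fun j => (f n j - f1 n j)%R) <= ((eps * rate n) ^+ 2)%:E)%E /\
    sqn (f n) = (sqn (f1 n) + sqn (fun j => (f n j - f1 n j)%R))%E.
Proof.
move=> eps0; have [D D0 hD] := tail_uniform eps0.
have [e1 [e2 [d1 [d2 [V [e10 e20 d10 d20 hw]]]]]] := weight_bounds sigma0 kap0 H1 H2 H3 H5.
have C20 : 0 < C ^+ 2 by rewrite exprn_gt0.
have DR : 0 < D%:R :> R by rewrite ltr0n.
exists ((D%:R * d2) `^ (2 * s) * C ^+ 2); split; first by rewrite mulr_gt0 ?powR_gt0 ?mulr_gt0.
exists (fun n => head_seq (D * kn n) (f n)) => n.
have dE : (fun j => f n j - head_seq (D * kn n) (f n) j) = tail_seq (D * kn n) (f n).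
  by apply/funext => j; rewrite -[X in X - _](head_tailE (D * kn n)) addrAC subrr add0r.
rewrite dE; split; last split.
- move=> lam lam0.
  have q0 := rate_gt0 r n; have N0 := @Nn_gt0 R n.
  have q20 : 0 < rate n ^+ 2 by rewrite exprn_gt0.
  have [_ _ _ k2 _] := hw _ _ (knP n).
  have P0 : 0 < (D%:R * d2) `^ (2 * s) * C ^+ 2 by rewrite mulr_gt0 ?powR_gt0 ?mulr_gt0.
  rewrite -lee_pdivlMl ?powR_gt0// -EFinM eseries_mkcond.
  have [lD|lD] := ltP lam (D * kn n)%:R; last first.
    rewrite eseries0; first by rewrite lee_fin mulr_ge0 ?invr_ge0 ?powR_ge0// ltW.
    move=> j _ _; case: ifP => // lj; rewrite /head_seq ifF ?expr0n//.
    apply/negbTE; rewrite -leqNgt -ltnS -(ltr_nat R); exact: le_lt_trans lj.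
  apply: (@le_trans _ _ (\sum_(j <oo) (f n j ^+ 2)%:E)%E).
    apply: lee_nneseries => [j _ _|j _].
      by case: ifP => //; rewrite lee_fin sqr_ge0.
    by case: ifP => _; rewrite lee_fin ?sqr_ge0// head_seq_sqr_le.
  apply: le_trans (f_high n) _; rewrite lee_fin ler_pdivlMl ?powR_gt0// mulrC.
  have hl : lam `^ (2 * s) <= (D%:R * d2) `^ (2 * s) * (rate n ^+ 2)^-1.
    rewrite -rate_powR -powRM; last 2 first.
    - by rewrite mulr_ge0// ltW.
    - by rewrite mulr_ge0 ?exprn_ge0// ltW.
    apply: ge0_ler_powR; rewrite ?nnegrE ?(ltW lam0)//.
    - by rewrite mulr_ge0// ltW.
    - by rewrite !mulr_ge0 ?exprn_ge0// ltW.
    - by apply: le_trans (ltW lD) _; rewrite natrM -mulrA ler_pM2l.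
  rewrite exprMn; apply: (@le_trans _ _ (C ^+ 2 * rate n ^+ 2 * ((D%:R * d2) `^ (2 * s) * (rate n ^+ 2)^-1))).
    by apply: ler_wpM2l hl; rewrite mulr_ge0// ltW.
  rewrite le_eqVlt; apply/orP; left; apply/eqP; field.
  by rewrite gt_eqF.
- by apply/sqn_le_fin.
- rewrite /sqn -nneseriesD; last 2 first.
  - by move=> j _ _; rewrite lee_fin sqr_ge0.
  - by move=> j _ _; rewrite lee_fin sqr_ge0.
  by apply: eq_eseriesr => j _; rewrite -EFinD -head_tail_sqr.
Qed.

End necessity.
End characterization.

Theorem theorem11 (R : realType) (d : measure_display) (Omega : measurableType d)
    (P : probability Omega R) (xi : nat -> Omega -> R)
    (sigma r : R) (kap : nat -> nat -> R) (f : nat -> nat -> R) (c C : R) :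
  0 < sigma -> 0 < r -> r < 2^-1 ->
  iid_std_normal P xi ->
  weights_nonneg kap -> A1 kap -> A2 sigma kap -> A3 r kap -> A4 kap -> A5 kap ->
  0 < c -> c < C ->
  (forall n, (((c * Nn n `^ (- r)) ^+ 2)%:E <= sqn (f n)
                <= ((C * Nn n `^ (- r)) ^+ 2)%:E)%E) ->
  let s := r / (2 - 4 * r) in
  purely_nr_consistent P xi sigma kap r f <->
  (forall eps : R, 0 < eps -> exists Peps : R, 0 < Peps /\
     exists f1 : nat -> nat -> R, forall n,
       besov s Peps (f1 n) /\
       (sqn (fun j => (f n j - f1 n j)%R) <= ((eps * Nn n `^ (- r)) ^+ 2)%:E)%E /\
       sqn (f n) = (sqn (f1 n) + sqn (fun j => (f n j - f1 n j)%R))%E).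
Proof.
move=> sigma0 r0 r2 xi_iid kap0 H1 H2 H3 H4 H5 c0 cC hf s.
have C0 : 0 < C := lt_trans c0 cC.
have f_low n : (((c * rate r n) ^+ 2)%:E <= sqn (f n))%E by have /andP[] := hf n.
have f_high n : (sqn (f n) <= ((C * rate r n) ^+ 2)%:E)%E by have /andP[] := hf n.
split=> [pure eps eps0|approx].
  have /choice[kn knP] := kn_exists kap0 H3.
  exact: (pure_approx sigma0 r0 r2 xi_iid kap0 H1 H2 H3 H4 H5 C0 f_high knP pure eps0).
apply: (approx_pure sigma0 r0 r2 xi_iid kap0 H1 H2 H3 H5 c0 C0 f_low f_high).
move=> eps eps0; have [Pe [Pe0 [f1 hf1]]] := approx eps eps0.
exists Pe; split=> //; exists f1 => n; have [h1 [h2 _]] := hf1 n.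
by split.
Qed.
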